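(* Let $\alpha,s\in(0,1)$ and let $u$, $u_t=u(\cdot,t)$, be the solution of $$\partial_t^\alpha u=-(-\Delta)^su+f(u)\ \text{ in }\Omega\times(0,T),\qquad u=0\ \text{ on }\partial\Omega\times(0,T),\qquad u(x,0)=u_0(x)\ \text{ in }\Omega,$$ given by $$u_t=S_\alpha(t)u_0+\int_0^t(t-\tau)^{\alpha-1}P_\alpha(t-\tau)f(u_\tau)\,d\tau .$$ Then $u$ is positive on its interval of existence, i.e. $u(x,t)>0$ for $x\in\Omega$ and every $t>0$ in the interval of existence.
   Context: $\Omega\subset\mathbb{R}^d$ is an open bounded domain with smooth boundary. Let $\{(\lambda_n,e_n)\}_{n\in\mathbb{N}}\subset\mathbb{R}^+\times H_0^1(\Omega)$ be the Dirichlet eigenpairs of $-\Delta$ on $\Omega$, with $\{e_n\}$ an orthonormal basis of $L^2(\Omega)$, and $w_n=\int_\Omega we_n\,dx$. The spectral fractional Laplacian is $(-\Delta)^s w=\sum_n\lambda_n^s w_n e_n$, and $\mathbb{H}^s(\Omega)=\{w=\sum_n w_ne_n\in L^2(\Omega):\|w\|_{\mathbb{H}^s(\Omega)}^2=\sum_n\lambda_n^s|w_n|^2<\infty\}$. Put $X=C([0,T],\mathbb{H}^s(\Omega))$ with norm $\|u_t\|=\sup_{t\in[0,T]}\|u_t\|_{\mathbb{H}^s(\Omega)}$. $\partial_t^\alpha$ is the Caputo derivative of order $\alpha\in(0,1)$: $\partial_t^\alpha v(t)=\frac{d}{dt}\,\frac{1}{\Gamma(1-\alpha)}\int_0^t(t-\tau)^{-\alpha}(v(\tau)-v(0))\,d\tau$.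 Standing assumptions on data: $c>0$ is a constant and $0<\rho<c$; $B_\rho=\{u\in L^\infty(\Omega):\|u\|_\infty<\rho\}$. The reaction term $f:B_\rho\to\mathbb{R}^+$ (a function of the scalar value of $u$, acting pointwise, with scalar values up to $c$ admitted in the limit below) is continuous, convex, monotonically increasing on $B_\rho$, satisfies $\lim_{u\to c^-}f(u)=+\infty$, and satisfies a local Lipschitz condition on $B_\rho$: there is a continuous function $L_f:\mathbb{R}^+\to\mathbb{R}^+$ such that for $u,v\in B_\rho$, $\|f(u)-f(v)\|_{\mathbb{H}^s(\Omega)}\le L_f(c)\|u-v\|_{\mathbb{H}^s(\Omega)}$. The initial datum $u_0:\Omega\to\mathbb{R}^+$ is continuous with $0\le u_0\ll c$ (it may vanish), $u_0\in\mathbb{H}^s(\Omega)$. With $E_{\alpha,\beta}(z)=\sum_{n\ge0}z^n/\Gamma(\beta+\alpha n)$ and $A=(-\Delta)^s$, $S_\alpha(t)=E_{\alpha,1}(-zt^\alpha)(A)$ and $P_\alpha(t)=E_{\alpha,\alpha}(-zt^\alpha)(A)$ in the sense of functional calculus, i.e. $S_\alpha(t)w=\sum_nE_{\alpha,1}(-\lambda_n^st^\alpha)w_ne_n$ and $P_\alpha(t)w=\sum_nE_{\alpha,\alpha}(-\lambda_n^st^\alpha)w_ne_n$. A solution is a mild solution: $u_t\in X$ with $\|u_t\|<c$ satisfying the displayed integral equation for all $t\in[0,T]$; the interval of existence is the interval on which this solution exists. *)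

(* Defs.v *)
From HB Require Import structures.
From mathcomp Require Import all_boot all_order all_algebra.
From mathcomp Require Import all_classical all_reals all_analysis.

Set Implicit Arguments.
Unset Strict Implicit.
Unset Printing Implicit Defensive.
Import Order.TTheory GRing.Theory Num.Theory.
Import numFieldNormedType.Exports.
Local Open Scope classical_set_scope.
Local Open Scope ring_scope.

(* The row vectors ['rV[R]_d] carry the sigma-algebra generated by the
coordinates, i.e. the product of the Borel sigma-algebras of [R]; it coincides
with the Borel sigma-algebra of the (sup-norm) topology of ['rV[R]_d]. *)

Definition rV_display : measure_display. Proof. exact. Qed.

Section rV_measurable.
Context (R : realType) (d : nat).

Definition coord (i : 'I_d) (x : 'rV[R]_d) : measurableTypeR R := x ord0 i.

Let rV_set0 : g_sigma_preimage coord set0.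
Proof. exact: sigma_algebra0. Qed.

Let rV_setC A : g_sigma_preimage coord A -> g_sigma_preimage coord (~` A).
Proof. exact: sigma_algebraC. Qed.

Let rV_bigcup (F : (set 'rV[R]_d)^nat) :
  (forall i, g_sigma_preimage coord (F i)) ->
  g_sigma_preimage coord (\bigcup_i (F i)).
Proof. exact: sigma_algebra_bigcup. Qed.

HB.instance Definition _ := @isMeasurable.Build rV_display 'rV[R]_d
  (g_sigma_preimage coord) rV_set0 rV_setC rV_bigcup.

End rV_measurable.

Lemma measurable_coord (R : realType) d (i : 'I_d) :
  measurable_fun [set: 'rV[R]_d] (@coord R d i).
Proof.
move=> _ Y mY; rewrite setTI; apply: sub_sigma_algebra => /=.
rewrite -bigcup_seq/=; exists i => /=; first by rewrite mem_index_enum.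
by exists Y => //; rewrite setTI.
Qed.

Lemma measurable_fun_rVP (R : realType) n d1 (T1 : measurableType d1)
    (f : T1 -> 'rV[R]_n) :
  (forall i, measurable_fun [set: T1] (@coord R n i \o f)) ->
  measurable_fun [set: T1] f.
Proof.
move=> mf.
suff prefS : g_sigma_preimage (fun i => @coord R n i \o f) `<=` measurable.
  move: prefS; rewrite g_sigma_preimage_comp => prefS _ A mA.
  by apply: prefS; exists A.
apply: smallest_sub; first exact: sigma_algebra_measurable.
case: n => [|n] in f mf *; first by rewrite big_ord0.
rewrite -bigcup_mkord_ord => A [i /= ni [B mB <-]].
by have /(_ measurableT B mB) := mf (inord i).
Qed.

Section lebesgue_rV.
Context (R : realType).

Definition consrV n (p : 'rV[R]_n * measurableTypeR R) : 'rV[R]_n.+1 :=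
  \row_j oapp (fun k => p.1 ord0 k) (p.2 : R) (unlift ord0 j).

Lemma measurable_consrV n : measurable_fun setT (@consrV n).
Proof.
apply: measurable_fun_rVP => i; rewrite /comp /coord.
case: (unliftP ord0 i) => [j|] ->.
- rewrite (_ : (fun _ => _) = @coord R n j \o fst).
    exact: (measurableT_comp (@measurable_coord R n j) measurable_fst).
  by apply/funext => p; rewrite /consrV mxE liftK.
- rewrite (_ : (fun _ => _) = snd); first exact: measurable_snd.
  by apply/funext => p; rewrite /consrV mxE unlift_none.
Qed.

HB.instance Definition _ n :=
  isMeasurableFun.Build _ _ _ _ (@consrV n) (@measurable_consrV n).

Section step.
Variables (n : nat) (m : {measure set 'rV[R]_n -> \bar R}).

Definition leb_step : set 'rV[R]_n.+1 -> \bar R :=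
  pushforward (m \x (@lebesgue_measure R))%E (@consrV n).

Let leb_step0 : leb_step set0 = 0%E.
Proof. exact: measure0. Qed.

Let leb_step_ge0 A : (0 <= leb_step A)%E.
Proof. exact: measure_ge0. Qed.

Let leb_step_sigma_additive : semi_sigma_additive leb_step.
Proof. exact: measure_semi_sigma_additive. Qed.

HB.instance Definition _ := isMeasure.Build _ _ _ leb_step
  leb_step0 leb_step_ge0 leb_step_sigma_additive.
End step.

(* Lebesgue measure on R^d, as an iterated product measure *)
Fixpoint leb (d : nat) : {measure set 'rV[R]_d -> \bar R} :=
  match d with
  | 0 => @dirac _ 'rV[R]_0 0 R
  | n.+1 => leb_step (leb n)
  end.

End lebesgue_rV.

Section domains.
Context (R : realType) (d : nat).
Implicit Types (Omega : set 'rV[R]_d) (phi : 'rV[R]_d -> R).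

Definition basis_vec (i : 'I_d) : 'rV[R]_d := delta_mx ord0 i.

Definition partial (i : 'I_d) phi : 'rV[R]_d -> R :=
  fun x => 'D_(basis_vec i) phi x.

Definition iter_partial (l : seq 'I_d) phi : 'rV[R]_d -> R :=
  foldr partial phi l.

Definition smooth phi :=
  forall l : seq 'I_d, continuous (iter_partial l phi) /\
    forall (i : 'I_d) x, derivable (iter_partial l phi) x (basis_vec i).

Definition domain Omega := [/\ open Omega, connected Omega & Omega !=set0].

(* Near each boundary point, [Omega] is a strict sublevel set of a smooth
   function with nonvanishing gradient. *)
Definition smooth_boundary Omega :=
  forall x, (closure Omega `\` interior Omega) x ->
  exists psi : 'rV[R]_d -> R,
    [/\ smooth psi, exists i, partial i psi x != 0 &
        \forall y \near x, Omega y <-> psi y < 0].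

(* C_c^oo(Omega) *)
Definition test_fun Omega phi :=
  smooth phi /\ exists K : set 'rV[R]_d,
    [/\ compact K, K `<=` Omega & forall x, ~ K x -> phi x = 0].

End domains.

(* A function on [Omega] is represented by a total function on R^d whose values
outside [Omega] are irrelevant. *)

Section function_spaces.
Context (R : realType) (d : nat) (Omega : set 'rV[R]_d).
Implicit Types (w v : 'rV[R]_d -> R).
Let mu := leb R d.

Definition L2 w := w \_ Omega \in Lfun mu 2%:E.

Definition L2norm w : \bar R := 'N[mu]_2%:E[EFin \o (w \_ Omega)]%E.

Definition ip w v : R := \int[mu]_(x in Omega) (w x * v x).

Definition cvgL2 (w_ : nat -> 'rV[R]_d -> R) w :=
  L2norm (fun x => w_ n x - w x) @[n --> \oo] --> 0%E.

Definition ae_eqO w v := {ae mu, forall x, Omega x -> w x = v x}.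

(* [w] belongs to H^1_0(Omega), the closure of C_c^oo(Omega) in H^1(Omega), and
   [g] is its (weak) gradient. *)
Definition H10_grad w (g : 'I_d -> 'rV[R]_d -> R) :=
  [/\ L2 w, forall i, L2 (g i) &
    exists phi : nat -> 'rV[R]_d -> R,
      [/\ forall k, test_fun Omega (phi k), cvgL2 phi w &
          forall i, cvgL2 (fun k => partial i (phi k)) (g i)]].

(* [-Delta e = l e] in [Omega], [e = 0] on the boundary, in the weak sense *)
Definition dirichlet_eigenpair (l : R) (e : 'rV[R]_d -> R) :=
  exists g : 'I_d -> 'rV[R]_d -> R, H10_grad e g /\
    forall phi, test_fun Omega phi ->
      \sum_(i < d) ip (g i) (partial i phi) = l * ip e phi.

Definition orthonormal_basis (e : nat -> 'rV[R]_d -> R) :=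
  [/\ forall n, L2 (e n), forall m n, ip (e m) (e n) = (m == n)%:R &
      forall w, L2 w ->
        cvgL2 (fun N x => \sum_(0 <= n < N) ip w (e n) * e n x) w].

(* B_r, the open ball of L^oo(Omega) *)
Definition Linfty_ball (r : R) w :=
  w \_ Omega \in Lfun mu +oo%E /\
  ('N[mu]_+oo[EFin \o (w \_ Omega)] < r%:E)%E.

(* [J] is the integral over [D] of the L^2(Omega)-valued function [g], in the
   weak (Pettis) sense: it is obtained by testing against all elements of the
   dual space of L^2(Omega). A Bochner integral is such an integral. *)
Definition L2_integral (D : set R) (g : R -> 'rV[R]_d -> R) J :=
  L2 J /\ forall v, L2 v ->
    (@lebesgue_measure R).-integrable D (fun tau => (ip (g tau) v)%:E) /\
    ip J v = \int[@lebesgue_measure R]_(tau in D) ip (g tau) v.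

End function_spaces.

Section mittag_leffler.
Context (R : realType).

(* Euler's Gamma function, for [x > 0] *)
Definition Gamma (x : R) : R :=
  \int[@lebesgue_measure R]_(t in `]0, +oo[) (t `^ (x - 1) * expR (- t)).

Definition mittag_leffler (a b z : R) : R :=
  limn (series (fun n : nat => z ^+ n / Gamma (b + a * n%:R))).

End mittag_leffler.

Section spectral.
Context (R : realType) (d : nat) (Omega : set 'rV[R]_d).
Context (lambda : nat -> R) (e : nat -> 'rV[R]_d -> R) (s : R).
Implicit Types (w v : 'rV[R]_d -> R).

(* an element of [0, +oo] *)
Definition Hs_norm w : \bar R :=
  ((\sum_(0 <= n <oo) (lambda n `^ s * `|ip Omega w (e n)| ^+ 2)%:E) `^ 2^-1)%E.

Definition Hs w := L2 Omega w /\ (Hs_norm w < +oo)%E.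

(* [v = m(A) w] for [A] the spectral fractional Laplacian of order [s], whose
   eigenvalues are the [lambda n `^ s]; the series converges in L^2(Omega). *)
Definition spectral_calculus (m : R -> R) w v :=
  L2 Omega v /\
  cvgL2 Omega (fun N x =>
    \sum_(0 <= n < N) m (lambda n `^ s) * ip Omega w (e n) * e n x) v.

(* [v = S_alpha(t) w] *)
Definition S_rel (alpha t : R) w v :=
  spectral_calculus (fun z => mittag_leffler alpha 1 (- z * t `^ alpha)) w v.

(* [v = P_alpha(t) w] *)
Definition P_rel (alpha t : R) w v :=
  spectral_calculus (fun z => mittag_leffler alpha alpha (- z * t `^ alpha)) w v.

(* [u] in C([0, T], H^s(Omega)) *)
Definition C_Hs (T : R) (u : R -> 'rV[R]_d -> R) :=
  forall t, `[0, T]%classic t -> Hs (u t) /\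
    Hs_norm (fun x => u r x - u t x) @[r --> within `[0, T]%classic (nbhs t)]
      --> 0%E.

Definition X_norm (T : R) (u : R -> 'rV[R]_d -> R) : \bar R :=
  ereal_sup [set Hs_norm (u t) | t in `[0, T]%classic].

(* In the integral equation, [v] is [S_alpha(t) u0], [h tau] is
   [P_alpha(t - tau) (f (u tau))] and [J] is the integral. The term
   [f (u tau)] makes sense in L^2(Omega) when [u tau] takes its values in the
   domain ]-c, c[ of [f] and [f (u tau)] is square integrable; as usual for an
   integrand this is required for almost every [tau]. *)
Definition mild_solution (alpha T c : R) (f : R -> R) (u0 : 'rV[R]_d -> R)
    (u : R -> 'rV[R]_d -> R) :=
  [/\ C_Hs T u, (X_norm T u < c%:E)%E &
    forall t, 0 <= t <= T ->
    exists (v : 'rV[R]_d -> R) (h : R -> 'rV[R]_d -> R) (J : 'rV[R]_d -> R),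
      [/\ S_rel alpha t u0 v,
          {ae @lebesgue_measure R, forall tau, 0 < tau < t ->
            [/\ {ae leb R d, forall x, Omega x -> - c < u tau x < c},
                L2 Omega (f \o u tau) &
                P_rel alpha (t - tau) (f \o u tau) (h tau)]},
          L2_integral Omega `]0, t[%classic
            (fun tau x => (t - tau) `^ (alpha - 1) * h tau x) J &
          ae_eqO Omega (u t) (fun x => v x + J x)]].

End spectral.

Section data.
Context (R : realType) (d : nat) (Omega : set 'rV[R]_d).
Context (lambda : nat -> R) (e : nat -> 'rV[R]_d -> R) (s : R).

(* [f] is a function on the interval ]-c, c[ with values in ]0, +oo[ (its
   values elsewhere are irrelevant), acting on functions by composition. *)
Definition reaction_term (c rho : R) (f Lf : R -> R) :=
  [/\ forall y, - c < y < c -> 0 < f y,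
      {in `]- rho, rho[, continuous f},
      convex_function (`]- rho, rho[%classic : set R^o) (f : R^o -> R^o),
      {in `]- rho, rho[ &, {homo f : x y / x <= y}} &
      f y @[y --> c^'-] --> +oo] /\
  [/\ forall r, 0 < r -> 0 < Lf r,
      {in `]0, +oo[, continuous Lf} &
      forall u v, Linfty_ball Omega rho u -> Linfty_ball Omega rho v ->
        Hs Omega lambda e s u -> Hs Omega lambda e s v ->
        (Hs_norm Omega lambda e s (fun x => (f (u x) - f (v x))%R)
          <= (Lf c)%:E * Hs_norm Omega lambda e s (fun x => (u x - v x)%R))%E].

Definition initial_datum (c : R) (u0 : 'rV[R]_d -> R) :=
  [/\ {within Omega, continuous u0}, forall x, Omega x -> 0 <= u0 x < c &
      Hs Omega lambda e s u0].

End data.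

(* Main.v *)
(* Call a multiplier [m] positive when [F >= 0] implies [m(-Delta) F >= 0].
Positive multipliers are closed under sums, products and bounded pointwise
limits, so the whole semigroup theory reduces to scalar approximations.

- [1 / (1 + eps l)] is positive: replacing [w] by [|w|] does not increase the
  Dirichlet energy, hence the minimiser of the functional defining the resolvent
  is nonnegative. Smooth truncations are replaced by polynomial ones, given by
  the binomial series of [sqrt (1 - h)] at [h = 1 - x^2].
- With [h = 1 / (1 + eps l)], the function [1 - (1 - h)^s] is a power series in
  [h] with nonnegative coefficients. A geometric series turns it into
  [1 / (1 + A (1 - h)^s)], and [eps --> 0] gives [1 / (1 + delta l^s)].
- The implicit Gruenwald-Letnikov scheme for [D^alpha y + z y = 0] only involves
  nonnegative combinations of powers of [1 / (1 + delta z)], because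
  [1 - (1 - x)^alpha] has nonnegative coefficients. Its solution is a series in
  [z] converging to [E_(alpha, beta) (- z)], by Gauss's formula for [Gamma].

Hence both terms of the mild solution are nonnegative. Let [g] be the indicator
of [{u_t <= 0}]. Then [<P_alpha(t - tau) f(u_tau), g>] vanishes for almost every
[tau]. As [f(u_tau) > 0], every [G >= 0] is a limit of functions dominated by
multiples of [f(u_tau)], so [<P_alpha(t - tau) G, g> = 0] for all [G], in
particular for [G = e_n]: each [E_(alpha, alpha) (- l_n^s (t - tau)^alpha) g_n]
is zero. For [tau] close to [t] the Mittag-Leffler factor is positive, whence
[g = 0] almost everywhere. No strong maximum principle is needed. *)

Require Import Defs.
From mathcomp Require Import all_boot all_order all_algebra.
From mathcomp Require Import all_classical all_reals all_analysis.
From mathcomp Require Import measurable_realfun.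
From mathcomp Require Import ring lra.
Import Order.TTheory GRing.Theory Num.Theory.
Import numFieldNormedType.Exports.
Local Open Scope classical_set_scope.
Local Open Scope ring_scope.

Set Implicit Arguments.
Unset Strict Implicit.
Unset Printing Implicit Defensive.

(** * Binomial series *)

(** One parameter [g] covers both operators: [g = 1] gives $S_\alpha$, [g = alpha] gives $P_\alpha$,
    and [alpha <= g] makes the source term [rbin (g - alpha) n] of the scheme nonnegative. The
    scheme stems from the generating function $(1-x)^{\alpha-g}/((1-x)^\alpha+z)$. Expanded in $z$
    it is $\sum_k(-z)^k(1-x)^{-(g+\alpha k)}$, whose coefficients in $x$ are rising binomials;
    solved recursively in $x$, it only involves nonnegative combinations of powers of $1/(1+z)$. For
    $z=y(N+1)^{-\alpha}$ the coefficient of $x^N$, multiplied by $(N+1)^{1-g}$, tends to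
    $E_{\alpha,g}(-y)$. Two obstacles shape the rest. The eigenvalues are unbounded, so every limit
    of multipliers needs a bound uniform in the eigenvalue, while convergence is only pointwise;
    comparison with $z=0$ gives this bound for the scheme. Next, gradients of approximations of
    $|w|$ need not converge, so energies are compared through finitely many coefficients, and
    positivity of $m(-\Delta)F$ is expressed on coefficient sequences up to an $\ell^2$ error. As
    $u_0$ may vanish, strict positivity must come from the integral term. *)

Section rising_binomial.
Context {R : realType}.
Implicit Types (b g h s x : R) (n : nat).

(* The coefficient of [x ^+ n] in [(1 - x) `^ (- b)]. *)
Definition rbin b n : R := \prod_(i < n) ((b + i%:R) / i.+1%:R).

Lemma rbin0 b : rbin b 0 = 1.
Proof. by rewrite /rbin big_ord0. Qed.

Lemma rbinS b n : rbin b n.+1 = rbin b n * ((b + n%:R) / n.+1%:R).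
Proof. by rewrite /rbin big_ord_recr. Qed.

Lemma rbinS_mul b n : n.+1%:R * rbin b n.+1 = (b + n%:R) * rbin b n.
Proof. by rewrite rbinS; field; rewrite addrC natr1 pnatr_eq0. Qed.

Lemma rbin_ge0 b n : 0 <= b -> 0 <= rbin b n.
Proof. by move=> b0; apply: prodr_ge0 => i _; rewrite divr_ge0// addr_ge0. Qed.

Lemma rbin_1l n : rbin 1 n = 1.
Proof.
by rewrite /rbin big1// => i _; rewrite addrC natr1 divff// pnatr_eq0.
Qed.

(** Coefficientwise form of $(1-x)^{-b}(1-x)^{-g}=(1-x)^{-(b+g)}$. The induction writes
    $n+1=j+(n+1-j)$ in each term, which is the product rule for derivatives. *)
Lemma rbinD b g n :
  \sum_(j < n.+1) rbin b j * rbin g (n - j) = rbin (b + g) n.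
Proof.
elim: n => [|n IH]; first by rewrite big_ord1 !rbin0 mulr1.
apply: (@mulfI _ n.+1%:R); first by rewrite pnatr_eq0.
rewrite rbinS_mul -IH.
have -> : n.+1%:R * (\sum_(j < n.+2) rbin b j * rbin g (n.+1 - j)) =
   \sum_(j < n.+2) (j%:R * rbin b j) * rbin g (n.+1 - j) +
   \sum_(j < n.+2) rbin b j * ((n.+1 - j)%:R * rbin g (n.+1 - j)).
  rewrite mulr_sumr -big_split; apply: eq_bigr => j _ /=.
  have jn : (j <= n.+1)%N by rewrite -ltnS.
  by rewrite -{1}(subnKC jn) natrD; ring.
rewrite [X in X + _]big_ord_recl [X in _ + X]big_ord_recr/= !mul0r add0r.
rewrite subnn mul0r mulr0 addr0 -big_split/= mulr_sumr; apply: eq_bigr => j _.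
have jn : (j <= n)%N by rewrite -ltnS.
rewrite /bump/= add1n subSS subSn// !rbinS_mul.
have -> : (n%:R : R) = j%:R + (n - j)%:R by rewrite -natrD subnKC.
by ring.
Qed.

Lemma rbin_sum b n : \sum_(j < n.+1) rbin b j = rbin (b + 1) n.
Proof. by rewrite -rbinD; apply: eq_bigr => j _; rewrite rbin_1l mulr1. Qed.

(** The derivative of $(1-x)^{-b}$ is $b(1-x)^{-b-1}$, read on coefficients. *)
Lemma rbin_step b n : n.+1%:R * rbin b n.+1 = b * rbin (b + 1) n.
Proof.
elim: n => [|n IH]; first by rewrite rbinS !rbin0 addr0 mul1r divr1 mul1r mulr1.
rewrite rbinS_mul (rbinS (b + 1)) mulrA -IH -[n.+1%:R]natr1.
by field.
Qed.

Lemma rbinN_le0 s n : 0 < s < 1 -> rbin (- s) n.+1 <= 0.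
Proof.
move=> /andP[s0 s1]; have := rbin_step (- s) n => H.
rewrite -(@pmulr_rle0 _ n.+1%:R)// H mulNr oppr_le0; apply: mulr_ge0; first exact: ltW.
by apply: rbin_ge0; lra.
Qed.

Definition rbin_poly b n : {poly R} := \poly_(j < n.+1) rbin b j.

Lemma rbin_polyE b n x : (rbin_poly b n).[x] = \sum_(j < n.+1) rbin b j * x ^+ j.
Proof. by rewrite horner_poly. Qed.

Lemma deriv_rbin_poly b n : (rbin_poly b n.+1)^`() = b *: rbin_poly (b + 1) n.
Proof.
apply/polyP => j; rewrite coef_deriv coefZ !coef_poly ltnS.
by case: ltnP => // _; rewrite ?mul0rn ?mulr0// -mulr_natl rbin_step.
Qed.

(** The full series solves $(1-x)y'=by$; for a partial sum only the term of top degree is left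
    over. *)
Lemma deriv_rbin_poly_ode b n x :
  (1 - x) * (rbin_poly b n)^`().[x] - b * (rbin_poly b n).[x] =
  - (b + n%:R) * rbin b n * x ^+ n.
Proof.
elim: n => [|n IH].
  rewrite /rbin_poly poly_def big_ord1 expr0 alg_polyC derivC !hornerC rbin0.
  by ring.
have E : rbin_poly b n.+1 = rbin_poly b n + rbin b n.+1 *: 'X^(n.+1).
  by rewrite /rbin_poly !poly_def big_ord_recr.
have E2 : n.+1%:R * rbin b n.+1 = (b + n%:R) * rbin b n by exact: rbinS_mul.
rewrite E derivD derivZ derivXn !hornerE.
rewrite hornerMn hornerXn -mulr_natr.
transitivity ((1 - x) * (rbin_poly b n)^`().[x] - b * (rbin_poly b n).[x]
  + (1 - x) * (n.+1%:R * rbin b n.+1) * x ^+ n - b * rbin b n.+1 * x ^+ n.+1).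
  by ring.
rewrite IH !mulNr -E2 exprS -[n.+1%:R]natr1.
by ring.
Qed.

Lemma is_derive_rbin_poly b n x : x < 1 ->
  is_derive x 1 (fun y => (rbin_poly b n).[y] * (1 - y) `^ b)
    (- (b + n%:R) * rbin b n * x ^+ n * (1 - x) `^ (b - 1)).
Proof.
move=> x1.
have H : is_derive (1 - x) 1 ((@powR R)^~ b) (b * (1 - x) `^ (b - 1)).
  by apply: is_derive1_powR; rewrite subr_gt0.
have H2 : is_derive x 1 (fun y => (1 - y) `^ b) (- (b * (1 - x) `^ (b - 1))).
  have H3 : is_derive x (1 : R) (fun y : R => 1 - y) (- 1).
    have := is_deriveB (is_derive_cst (1 : R) x 1) (is_derive_id x (1 : R)).
    by rewrite sub0r.
  have := @is_derive1_comp R ((@powR R)^~ b) (fun y => 1 - y) x _ _ H H3.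
  by move=> /(@is_derive_eq _ _ _ _ _ _ _); apply; rewrite mulrN1.
have H4 := is_derive_poly (rbin_poly b n) x.
apply: (is_derive_eq (is_deriveM H4 H2)).
rewrite -!deriv_rbin_poly_ode /GRing.scale/=.
have -> : (1 - x) `^ b = (1 - x) * (1 - x) `^ (b - 1).
  have p : 0 < 1 - x by rewrite subr_gt0.
  rewrite -[X in X * _](powRr1 (ltW p)) -powRD; last by rewrite (gt_eqF p) implybT.
  by congr (_ `^ _); ring.
by ring.
Qed.

(** Multiplying the partial sum by $(1-h)^b$ turns the defect of the differential equation into the
    whole derivative. The mean value theorem then gives a remainder with visible sign and size. *)
Lemma rbin_poly_mvt b n h : 0 <= h < 1 -> exists2 x, 0 <= x <= h &
  (rbin_poly b n).[h] * (1 - h) `^ b - 1 =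
    - (b + n%:R) * rbin b n * x ^+ n * (1 - x) `^ (b - 1) * h.
Proof.
move=> /andP[h0 h1].
have [||x] := @MVT_segment R (fun y => (rbin_poly b n).[y] * (1 - y) `^ b)
  (fun x => - (b + n%:R) * rbin b n * x ^+ n * (1 - x) `^ (b - 1)) 0 h h0.
- move=> x; rewrite in_itv/= => /andP[x0 xh].
  by apply: is_derive_rbin_poly; apply: lt_trans h1.
- apply: derivable_within_continuous => x; rewrite in_itv/= => /andP[x0 xh].
  by have [] := is_derive_rbin_poly b n (le_lt_trans xh h1).
rewrite in_itv/= => xh E; exists x => //; rewrite -[h in RHS]subr0 -E.
have -> : (rbin_poly b n).[0] = 1.
  rewrite rbin_polyE big_ord_recl/= rbin0 mulr1 big1 ?addr0// => i _.
  by rewrite /bump/= add1n expr0n mulr0.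
by rewrite subr0 powR1 mulr1.
Qed.

Lemma rbin_poly_le b n h : 0 <= b -> 0 <= h < 1 ->
  (rbin_poly b n).[h] * (1 - h) `^ b <= 1.
Proof.
move=> b0 h01; have [x /andP[x0 xh] /eqP] := rbin_poly_mvt b n h01.
rewrite subr_eq => /eqP ->; rewrite gerDr !mulNr oppr_le0.
rewrite !mulr_ge0 ?powR_ge0 ?exprn_ge0 ?rbin_ge0 ?addr_ge0//.
by case/andP : h01.
Qed.

End rising_binomial.

(** * Fractional powers and the absolute value as limits of polynomials *)

Section rising_binomial2.
Context {R : realType}.
Implicit Types (b g h s x : R) (n : nat).

Lemma rbin_le1 b n : 0 <= b <= 1 -> rbin b n <= 1.
Proof.
move=> /andP[b0 b1]; elim: n => [|n IH]; first by rewrite rbin0.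
rewrite rbinS mulr_ile1// ?rbin_ge0 ?divr_ge0 ?addr_ge0//.
by rewrite ler_pdivrMr// mul1r -natr1 addrC lerD2l.
Qed.

Lemma rbin_poly_dist s n h : 0 < s < 1 -> 0 <= h < 1 ->
  `|(rbin_poly (- s) n).[h] - (1 - h) `^ s| <= h ^+ n / (1 - h).
Proof.
move=> s01 /[dup] h01 /andP[h0 h1].
have [x /andP[x0 xh] E] := rbin_poly_mvt (- s) n h01.
have p1 : 0 < 1 - h by rewrite subr_gt0.
have px : 0 < 1 - x by rewrite subr_gt0 (le_lt_trans xh).
have E2 : (rbin_poly (- s) n).[h] - (1 - h) `^ s =
   - ((- s + n%:R) * rbin (- s) n) * (x ^+ n * h) *
   ((1 - h) `^ s * (1 - x) `^ (- s - 1)).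
  transitivity ((1 - h) `^ s * ((rbin_poly (- s) n).[h] * (1 - h) `^ (- s) - 1)).
    rewrite mulrBr mulrCA -powRD; last by rewrite (gt_eqF p1) implybT.
    by rewrite subrr powRr0 !mulr1.
  by rewrite E; ring.
(* This coefficient is [n.+1%:R * rbin (- s) n.+1 = - s * rbin (1 - s) n] up to sign, a product of
   two factors of modulus at most 1. *)
have K1 : `|- ((- s + n%:R) * rbin (- s) n)| <= 1.
  have r0 : 0 <= rbin (- s + 1) n by apply: rbin_ge0; lra.
  have r1 : rbin (- s + 1) n <= 1 by apply: rbin_le1; lra.
  by rewrite normrN -rbinS_mul rbin_step normrM normrN !ger0_norm//; [nra|lra].
have K2 : `|x ^+ n * h| <= h ^+ n.
  rewrite ger0_norm ?mulr_ge0 ?exprn_ge0// -[leRHS]mulr1.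
  apply: ler_pM => //; [exact: exprn_ge0| |exact: ltW].
  by apply: lerXn2r; rewrite // nnegrE.
have K3 : `|(1 - h) `^ s * (1 - x) `^ (- s - 1)| <= (1 - h)^-1.
  rewrite ger0_norm ?mulr_ge0 ?powR_ge0// -opprD powRN.
  rewrite ler_pdivrMr ?powR_gt0// mulrC ler_pdivlMr//.
  have -> : (1 - h) `^ s * (1 - h) = (1 - h) `^ (s + 1).
    by rewrite powRD ?powRr1 ?(ltW p1)// (gt_eqF p1) implybT.
  by rewrite ge0_ler_powR// ?nnegrE; lra.
rewrite E2 normrM -[h ^+ n]mul1r; apply: ler_pM => //.
by rewrite normrM; apply: ler_pM.
Qed.

Lemma rbin_poly_cvg s h : 0 < s < 1 -> 0 <= h < 1 ->
  (rbin_poly (- s) n).[h] @[n --> \oo] --> (1 - h) `^ s.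
Proof.
move=> s01 /[dup] h01 /andP[h0 h1].
apply/cvgrPdist_lt => e e0.
have : geometric ((1 - h)^-1) h n @[n --> \oo] --> (0 : R).
  by apply: cvg_geometric; rewrite ger0_norm.
move=> /cvgrPdist_lt/(_ _ e0); apply: filterS => n.
rewrite sub0r normrN /= distrC => /(le_lt_trans (ler_norm _)).
by apply: le_lt_trans; rewrite mulrC rbin_poly_dist.
Qed.

(* The partial sums of the binomial series of [sqrt (1 - h)] at
   [h = 1 - x ^+ 2], with the value at [x = 0] removed, approximate [`|x|]. *)
Definition abs_poly n : {poly R} :=
  rbin_poly (- 2^-1) n.+1 \Po (1 - 'X^2) - ((rbin_poly (- 2^-1) n.+1).[1])%:P.

Lemma abs_polyE n x : (abs_poly n).[x] =
  (rbin_poly (- 2^-1) n.+1).[1 - x ^+ 2] - (rbin_poly (- 2^-1) n.+1).[1].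
Proof. by rewrite /abs_poly !hornerE horner_comp !hornerE. Qed.

Lemma abs_poly0 n : (abs_poly n).[0] = 0.
Proof. by rewrite abs_polyE expr0n subr0 subrr. Qed.

Lemma deriv_abs_poly n x :
  (abs_poly n)^`().[x] = x * (rbin_poly 2^-1 n).[1 - x ^+ 2].
Proof.
rewrite /abs_poly derivB derivC subr0 deriv_comp deriv_rbin_poly.
rewrite derivB derivXn derivC sub0r !hornerE horner_comp !hornerE /=.
have -> : - 2^-1 + 1 = 2^-1 :> R by field.
by field.
Qed.

Lemma normr_sqrt_onem x : `|x| <= 1 -> (1 - (1 - x ^+ 2)) `^ 2^-1 = `|x|.
Proof.
move=> x1; have -> : 1 - (1 - x ^+ 2) = x ^+ 2 by ring.
by rewrite powR12_sqrt ?sqr_ge0// sqrtr_sqr.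
Qed.

(** With $h=1-x^2$ one has $|x|=(1-h)^{1/2}$, and the derivative is $x$ times a partial sum of
    $(1-h)^{-1/2}$; [rbin_poly_le] bounds the product by exactly 1. Composition with this polynomial
    therefore cannot increase a gradient. *)
Lemma deriv_abs_poly_le1 n x : `|x| <= 1 -> `|(abs_poly n)^`().[x]| <= 1.
Proof.
move=> x1; rewrite deriv_abs_poly normrM.
have [->|x0] := eqVneq x 0; first by rewrite normr0 mul0r.
have h0 : 0 <= 1 - x ^+ 2 < 1.
  by rewrite subr_ge0 -real_normK ?num_real// expr_le1//= x1 ltrBlDr ltrDl exprn_gt0 ?normr_gt0.
have p0 : 0 <= (rbin_poly (2^-1) n).[1 - x ^+ 2].
  rewrite rbin_polyE sumr_ge0// => i _; rewrite mulr_ge0 ?rbin_ge0//.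
  by rewrite exprn_ge0//; case/andP : h0.
have half : 0 <= (2^-1 : R) by [].
rewrite (ger0_norm p0) mulrC -(normr_sqrt_onem x1); exact: rbin_poly_le.
Qed.

(** The coefficient is $\binom{2n}{n}4^{-n}$. The induction step amounts to
    $(n+\frac12)^2(n+2)\le(n+1)^3$. *)
Lemma rbin_half_sqr n : rbin (2^-1 : R) n ^+ 2 <= n.+1%:R^-1.
Proof.
elim: n => [|n IH]; first by rewrite rbin0 invr1 expr1n.
rewrite rbinS exprMn.
apply: (@le_trans _ _ (n.+1%:R^-1 * ((2^-1 + n%:R) / n.+1%:R) ^+ 2)).
  by rewrite ler_wpM2r// sqr_ge0.
rewrite -[n.+2%:R]natr1 -[n.+1%:R]natr1.
have : 0 <= n%:R :> R by []. move: (n%:R : R) => y y0.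
have y1 : 0 < y + 1 by lra.
have y2 : 0 < y + 1 + 1 by lra.
have -> : (y + 1)^-1 * ((2^-1 + y) / (y + 1)) ^+ 2 = (2^-1 + y) ^+ 2 / (y + 1) ^+ 3.
  by field; rewrite gt_eqF.
rewrite ler_pdivrMr ?exprn_gt0// mulrC ler_pdivlMr// !exprS !expr0 !mulr1.
by nra.
Qed.

Lemma rbin_half_cvg0 : rbin (2^-1 : R) n @[n --> \oo] --> (0 : R).
Proof.
apply/cvgrPdist_lt => e e0.
have : (n.+1%:R^-1 : R) @[n --> \oo] --> (0 : R) by exact: cvg_harmonic.
move=> /cvgrPdist_lt/(_ (e ^+ 2)); rewrite exprn_gt0// => /(_ isT).
apply: filterS => n /=.
rewrite !sub0r !normrN ger0_norm// => H.
have := le_lt_trans (rbin_half_sqr n) H.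
by rewrite ltr_pXn2r ?nnegrE ?rbin_ge0 ?(ltW e0)// ger0_norm ?rbin_ge0.
Qed.

Lemma rbin_poly1 b n : (rbin_poly b n).[1] = rbin (b + 1) n.
Proof.
by rewrite -rbin_sum rbin_polyE; apply: eq_bigr => j _; rewrite expr1n mulr1.
Qed.

(** All coefficients after the constant one are nonpositive, so each increment at [h] is dominated
    by the increment at 1, and those telescope. The bound is uniform up to [h = 1], where that of
    [rbin_poly_dist] blows up. *)
Lemma rbin_poly_tail s n m h : 0 < s < 1 -> 0 <= h <= 1 ->
  0 <= (rbin_poly (- s) n).[h] - (rbin_poly (- s) (n + m)).[h] <=
    rbin (1 - s) n - rbin (1 - s) (n + m).
Proof.
move=> s01 /andP[h0 h1]; elim: m => [|m IH]; first by rewrite addn0 !subrr lexx.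
have S k y : (rbin_poly (- s) k.+1).[y] = (rbin_poly (- s) k).[y] + rbin (- s) k.+1 * y ^+ k.+1.
  by rewrite !rbin_polyE big_ord_recr.
have S1 k : rbin (1 - s) k.+1 = rbin (1 - s) k + rbin (- s) k.+1.
  by rewrite addrC -!rbin_poly1 S expr1n mulr1.
rewrite addnS S S1 !opprD !addrA.
have := rbinN_le0 (n + m) s01; move: (rbin (-s) _) => a a0.
have : 0 <= h ^+ (n + m).+1 <= 1 by rewrite exprn_ge0// exprn_ile1.
move: (h ^+ _) => y /andP[y0 y1].
have : a <= a * y <= 0 by apply/andP; nra.
by move: IH; move: (a * y) => ay; lra.
Qed.

(** The error of the partial sum and the constant subtracted from it both lie between 0 and
    [rbin (2^-1) n.+1], hence so does the modulus of their difference. *)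
Lemma abs_poly_dist n x : `|x| <= 1 ->
  `| (abs_poly n).[x] - `|x| | <= rbin (2^-1) n.+1.
Proof.
move=> x1; rewrite abs_polyE rbin_poly1.
have half : 0 < (2^-1 : R) < 1 by lra.
have E : - 2^-1 + 1 = 2^-1 :> R by field.
have E2 : 1 - 2^-1 = 2^-1 :> R by field.
have [->|x0] := eqVneq x 0.
  by rewrite expr0n subr0 rbin_poly1 subrr normr0 subr0 normr0 rbin_ge0//; lra.
have h0 : 0 <= 1 - x ^+ 2 < 1.
  by rewrite subr_ge0 -real_normK ?num_real// expr_le1//= x1 ltrBlDr ltrDl exprn_gt0 ?normr_gt0.
have := rbin_poly_cvg half h0; rewrite normr_sqrt_onem// => C.
rewrite E.
have h01 : 0 <= 1 - x ^+ 2 <= 1 by case/andP : h0 => -> /ltW.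
have tail m := rbin_poly_tail n.+1 m half h01.
have C2 : (rbin_poly (- 2^-1) n.+1).[1 - x ^+ 2] - (rbin_poly (- 2^-1) (n.+1 + m)).[1 - x ^+ 2]
    @[m --> \oo] --> (rbin_poly (- 2^-1) n.+1).[1 - x ^+ 2] - `|x|.
  apply: cvgB; first exact: cvg_cst.
  under eq_fun do rewrite addnC.
  by have := C; rewrite -(cvg_shiftn n.+1).
have L : 0 <= (rbin_poly (- 2^-1) n.+1).[1 - x ^+ 2] - `|x|.
  apply: (ler_cvg_to (cvg_cst 0) C2); apply: nearW => m.
  by have /andP[] := tail m.
have U : (rbin_poly (- 2^-1) n.+1).[1 - x ^+ 2] - `|x| <= rbin (2^-1) n.+1.
  apply: (ler_cvg_to C2 (cvg_cst _)); apply: nearW => m.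
  have /andP[_] := tail m; rewrite E2 => /le_trans; apply.
  by rewrite gerBl rbin_ge0//; lra.
have : 0 <= rbin (2^-1 : R) n.+1 by apply: rbin_ge0; lra.
by rewrite ler_norml; lra.
Qed.

End rising_binomial2.

(** * The Gamma function *)

Section Gamma_function.
Context {R : realType}.
Implicit Types (b c t x y : R) (n : nat).
Let leb1 := @lebesgue_measure R.

(** The integral is kept in [\bar R] until it is known to be finite: the real-valued [Gamma] would
    turn an infinite integral into 0. *)
Definition eGamma x : \bar R :=
  (\int[leb1]_(t in `]0%R, +oo[) (t `^ (x - 1) * expR (- t))%:E)%E.

Lemma measurable_Gamma_integrand x (D : set R) : measurable D ->
  measurable_fun D (fun t : R => t `^ x * expR (- t)).
Proof.
move=> mD; apply: measurable_funTS; apply: measurable_funM.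
  exact: measurable_powR.
by apply: measurableT_comp => //; exact: measurable_oppr.
Qed.

Lemma eGamma_ge0 x : (0 <= eGamma x)%E.
Proof. by apply: integral_ge0 => t _; rewrite lee_fin mulr_ge0 ?powR_ge0 ?expR_ge0. Qed.

(** Compact intervals exhausting the half-line; starting at 2 makes every one of them
    nondegenerate. *)
Let I n : set (measurableTypeR R) := `[n.+2%:R^-1, n.+2%:R]%classic.

Let bigcupI : \bigcup_n I n = `]0%R, +oo[%classic.
Proof.
apply/seteqP; split => [t [n _]|t]; rewrite /I /= !in_itv/= => /andP[].
  by move=> nt _; rewrite andbT (lt_le_trans _ nt).
move=> t0 _.
have [N HN] : exists n, t <= n.+2%:R /\ t^-1 <= n.+2%:R.
  exists (maxn (Num.truncn t) (Num.truncn t^-1)).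
  have H y : y <= (Num.truncn y).+2%:R.
    by apply/ltW/(lt_le_trans (truncnS_gt y)); rewrite ler_nat.
  split; apply: (le_trans (H _)); rewrite ler_nat !ltnS ?leq_maxl//.
  by rewrite leq_maxr.
exists N => //=; rewrite in_itv/= HN.1 andbT.
by rewrite -[t]invrK lef_pV2 ?posrE ?invr_gt0// HN.2.
Qed.

Let eGamma_lim x :
  (\int[leb1]_(t in I n) (t `^ (x - 1) * expR (- t))%:E)%E @[n --> \oo] -->
  eGamma x.
Proof.
rewrite /eGamma -bigcupI; apply: ge0_nondecreasing_set_cvg_integral.
- move=> n m nm; apply/subsetPset; apply: subset_itvScc => //=.
    by rewrite bnd_simp lef_pV2 ?posrE// ler_nat !ltnS.
  by rewrite bnd_simp ler_nat !ltnS.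
- by move=> n; exact: measurable_itv.
- by move=> n; apply/measurable_EFinP; apply: measurable_Gamma_integrand; exact: measurable_itv.
- by move=> n t _; rewrite lee_fin mulr_ge0 ?powR_ge0 ?expR_ge0.
Qed.

Let is_derive_mono x t : 0 < t ->
  is_derive t (1 : R) (fun t => t `^ x * expR (- t))
    (x * (t `^ (x - 1) * expR (- t)) - t `^ x * expR (- t)).
Proof.
move=> t0.
have H : is_derive t (1:R) (fun t : R => expR (- t)) (- expR (- t)).
  have := @is_derive1_comp R (@expR R) (fun t
    => - t) t _ _ _ (is_deriveN (is_derive_id t (1:R))).
  by move=> /(_ _ (is_derive_expR _)); rewrite mulrN1.
apply: (is_derive_eq (is_deriveM (is_derive1_powR x t0) H)).
by rewrite /GRing.scale/=; ring.
Qed.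

Let continuous_mono x n : {within I n, continuous (fun t : R => t `^ x * expR (- t))}.
Proof.
rewrite /I; apply: derivable_within_continuous => t; rewrite in_itv/= => /andP[ta _].
have t0 : 0 < t by apply: lt_le_trans ta; rewrite invr_gt0.
by have [] := is_derive_mono x t0.
Qed.

Let integrable_mono x n : leb1.-integrable (I n) (EFin \o (fun t : R => t `^ x * expR (- t))).
Proof.
by apply: continuous_compact_integrable; [exact: segment_compact|exact: continuous_mono].
Qed.

Let eGamma_part x n : 0 < x ->
  (\int[leb1]_(t in I n) (t `^ ((x + 1) - 1) * expR (- t))%:E =
   ((n.+2%:R^-1) `^ x * expR (- (n.+2%:R^-1)) - n.+2%:R `^ x * expR (- n.+2%:R))%:E +
   x%:E * \int[leb1]_(t in I n) (t `^ (x - 1) * expR (- t))%:E)%E.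
Proof.
move=> x0; rewrite addrK.
have a0 : 0 < n.+2%:R^-1 :> R by rewrite invr_gt0.
have ab : (n.+2%:R^-1 : R) < n.+2%:R.
  by apply: (@lt_trans _ _ 1); rewrite ?invf_lt1// ltr1n.
have mI : measurable (I n) by exact: measurable_itv.
have := @continuous_FTC2 R (fun t => x * (t `^ (x - 1) * expR (- t)) - t `^ x * expR (- t))
  (fun t => t `^ x * expR (- t)) _ _ ab.
have D t : 0 < t -> derivable (fun t => t `^ x * expR (- t)) t 1.
  by move=> t0; have [] := is_derive_mono x t0.
have C t : 0 < t -> {for t, continuous (fun t => t `^ x * expR (- t))}.
  by move=> t0; apply: differentiable_continuous; apply/derivable1_diffP; exact: D.
have C1 : {within `[n.+2%:R^-1, n.+2%:R], continuous
   (fun t => x * (t `^ (x - 1) * expR (- t)) - t `^ x * expR (- t))}.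
  move=> t; apply: cvgB; last exact: continuous_mono.
  by apply: cvgMr; exact: continuous_mono.
have b0 := lt_trans a0 ab.
move=> /(_ C1) H.
have {H} : (\int[leb1]_(t in I n) (x * (t `^ (x - 1) * expR (- t)) - t `^ x * expR (- t))%:E =
   (n.+2%:R `^ x * expR (- n.+2%:R))%:E - (n.+2%:R^-1 `^ x * expR (- n.+2%:R^-1))%:E)%E.
  apply: H.
    split.
    - by move=> t; rewrite in_itv/= => /andP[ta _]; apply: D; exact: lt_trans ta.
    - by apply: cvg_at_right_filter; exact: C.
    - by apply: cvg_at_left_filter; exact: C.
  move=> t; rewrite in_itv/= => /andP[ta _].
  by rewrite derive1E; have [_ ->] := is_derive_mono x (lt_trans a0 ta).
under eq_integral do rewrite EFinB EFinM.
rewrite integralB//; last 2 first.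
- by apply: integrableZl => //; exact: integrable_mono.
- exact: integrable_mono.
rewrite integralZl//; last exact: integrable_mono.
have i1 := integrable_fin_num mI (integrable_mono x n).
have i2 := integrable_fin_num mI (integrable_mono (x - 1) n).
move: i1 i2 => /=.
move: (\int[leb1]_(t in I n) _)%E => A.
move: (\int[leb1]_(t in I n) _)%E => B fA fB.
rewrite -(fineK fA) -(fineK fB) -!EFinM -!EFinB => -[E].
by congr EFin; move: E; lra.
Qed.

Let bound_infty x : 0 < x ->
  (n.+2%:R^-1) `^ x * expR (- (n.+2%:R^-1)) - n.+2%:R `^ x * expR (- n.+2%:R) @[n --> \oo]
    --> (0 : R).
Proof.
move=> x0; rewrite -[X in _ --> X]subr0.
have inv0 : n.+2%:R^-1 @[n --> \oo] --> (0 : R).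
  by have := @cvg_harmonic R; rewrite -(cvg_shiftn 1) /=; under eq_fun do rewrite addn1.
apply: cvgB.
  have P : n.+2%:R^-1 `^ x @[n --> \oo] --> (0 : R).
    have /cvg_at_rightP/(_ (fun n => n.+2%:R^-1)) := powR_cvg0 x0.
    by apply; split => [n|//]; rewrite invr_gt0.
  apply: (@squeeze_cvgr _ _ _ _ (fun=> 0) (fun n => n.+2%:R^-1 `^ x))
    => //; last exact: cvg_cst.
  apply: nearW => n; rewrite mulr_ge0 ?powR_ge0 ?expR_ge0//= ler_piMr ?powR_ge0//.
(* For [k] at least [x] and $t\ge1$, $t^x\le t^k$ and $e^t\ge t^{k+1}/(k+1)!$, so the boundary term
   at infinity is at most $(k+1)!/t$. *)
pose k := (Num.truncn x).+1.
have xk : x <= k%:R by apply/ltW/truncnS_gt.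
apply: (@squeeze_cvgr _ _ _ _ (fun=> 0) (fun n => n.+2%:R^-1 * (k.+1)`!%:R)).
- apply: nearW => n; rewrite mulr_ge0 ?powR_ge0 ?expR_ge0//= expRN.
  rewrite ler_pdivrMr ?expR_gt0//.
  apply: (@le_trans _ _ (n.+2%:R ^+ k)); first by rewrite -powR_mulrn// ler_powR// ler1n.
  have := @expR_ge1Dxn R n.+2%:R k (ler0n _ _) => H.
  have {H} : n.+2%:R ^+ k.+1 / (k.+1)`!%:R <= expR (n.+2%:R : R) by apply: le_trans H;
    rewrite lerDr.
  rewrite ler_pdivrMr ?ltr0n ?fact_gt0// => H.
  by rewrite -mulrA mulrC ler_pdivlMr ?ltr0n// -exprSr mulrC.
- exact: cvg_cst.
- rewrite -[0 in X in _ --> X](mul0r ((k.+1)`!%:R : R)).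
  by apply: cvgM => //; exact: cvg_cst.
Qed.

(** Integration by parts on each [I n]; the boundary terms vanish in the limit. *)
Lemma eGammaS x : 0 < x -> eGamma (x + 1) = (x%:E * eGamma x)%E.
Proof.
move=> x0.
have H : (\int[leb1]_(t in I n) (t `^ (x + 1 - 1) * expR (- t))%:E)%E @[n --> \oo] -->
    (0%:E + x%:E * eGamma x)%E.
  under eq_fun do rewrite eGamma_part//.
  apply: cvgeD; first exact: fin_num_adde_defr.
    by apply: cvg_EFin; [exact: nearW|exact: bound_infty].
  by apply: cvgeZl => //; exact: eGamma_lim.
by rewrite -[RHS]add0e; apply: (cvg_unique _ (eGamma_lim (x := x + 1)) H).
Qed.

Let is_derive_expN t : is_derive t (1:R) (fun t : R => expR (- t)) (- expR (- t)).
Proof.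
have := @is_derive1_comp R (@expR R) (fun t => - t) t _ _ _ (is_deriveN (is_derive_id t (1:R))).
by move=> /(_ _ (is_derive_expR _)); rewrite mulrN1.
Qed.

Let derivable_expN t : derivable (fun t : R => expR (- t)) t 1.
Proof. by have [] := is_derive_expN t. Qed.

Let is_derive_expNN t : is_derive t (1:R) (fun t : R => - expR (- t)) (expR (- t)).
Proof. by have := is_deriveN (is_derive_expN t); rewrite opprK. Qed.

Lemma eGamma1 : eGamma 1 = 1%E.
Proof.
have E : (\int[leb1]_(t in `[0%R, +oo[) (expR (- t))%:E = (0 - (- 1))%:E)%E.
  rewrite (@ge0_continuous_FTC2y R (fun t => expR (- t)) (fun t => - expR (- t)) 0 0).
  - by rewrite oppr0 expR0.
  - by move=> t _; exact: expR_ge0.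
  - by apply: derivable_within_continuous => t _; exact: derivable_expN.
  - by rewrite -oppr0; apply: cvgN; exact: cvgr_expR.
  - by move=> t _; apply: derivableN; exact: derivable_expN.
  - have C0 : {for (0 : R), continuous (fun t : R => - expR (- t))}.
      apply: differentiable_continuous.
      by apply/derivable1_diffP; have [] := is_derive_expNN 0.
    by apply: cvg_at_right_filter; exact: C0.
  - by move=> t _; rewrite derive1E; have [_ ->] := is_derive_expNN t.
rewrite /eGamma; under eq_integral do rewrite subrr powRr0 mul1r.
rewrite integral_itv_obnd_cbnd ?E ?opprK ?add0r//.
by apply/measurable_EFinP; apply: measurableT_comp => //; exact: measurable_funTS.
Qed.

(** Integers follow from the functional equation; for $y\ge1$, $t^{y-1}\le1+t^k$ with an integer [k]
    above [y]; the remaining arguments are reached by reading the functional equation backwards. *)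
Lemma eGamma_fin x : 0 < x -> (eGamma x < +oo)%E.
Proof.
have nat_fin n : (eGamma n.+1%:R < +oo)%E.
  elim: n => [|n IH]; first by rewrite eGamma1 ltry.
  by rewrite -[n.+2%:R]natr1 eGammaS// lte_mul_pinfty.
have ge1_fin y : 1 <= y -> (eGamma y < +oo)%E.
  move=> y1; pose k := (Num.truncn y).+1.
  have yk : y <= k%:R by apply/ltW/truncnS_gt.
  have := nat_fin k; have := nat_fin 0%N => h0 hk.
  apply: (@le_lt_trans _ _ (eGamma 1 + eGamma k.+1%:R)%E); last exact: lte_add_pinfty.
  rewrite /eGamma -ge0_integralD//=; last 4 first.
  - by move=> t _; rewrite lee_fin mulr_ge0 ?powR_ge0 ?expR_ge0.
  - by apply/measurable_EFinP; exact: measurable_Gamma_integrand.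
  - by move=> t _; rewrite lee_fin mulr_ge0 ?powR_ge0 ?expR_ge0.
  - by apply/measurable_EFinP; exact: measurable_Gamma_integrand.
  apply: ge0_le_integral => //.
  - by move=> t _; rewrite lee_fin mulr_ge0 ?powR_ge0 ?expR_ge0.
  - by apply/measurable_EFinP; exact: measurable_Gamma_integrand.
  - by apply: emeasurable_funD; apply/measurable_EFinP; exact: measurable_Gamma_integrand.
  move=> t; rewrite /= in_itv/= andbT => t0.
  rewrite -EFinD lee_fin -mulrDl ler_wpM2r ?expR_ge0// subrr powRr0.
  have [t1|/ltW t1] := leP 1 t.
    rewrite ler_wpDl// ler_powR//.
    by rewrite -natr1; lra.
  rewrite ler_wpDr ?powR_ge0//.
  have := @ge0_ler_powR R (y - 1) _ t 1; rewrite powR1 subr_ge0 !nnegrE.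
  by apply => //; exact: ltW.
move=> x0; have : (eGamma (x + 1) < +oo)%E by apply: ge1_fin; lra.
rewrite eGammaS//; have := eGamma_ge0 x.
by case: (eGamma x) => [r _ _|//|//]; rewrite ?ltry// mulry gtr0_sg// mul1e.
Qed.

Lemma EFin_Gamma x : 0 < x -> (Gamma x)%:E = eGamma x.
Proof.
by move=> x0; rewrite /Gamma /Rintegral fineK// ge0_fin_numE ?eGamma_ge0//; exact: eGamma_fin.
Qed.

Lemma GammaS x : 0 < x -> Gamma (x + 1) = x * Gamma x.
Proof.
move=> x0; apply: EFin_inj; rewrite EFinM !EFin_Gamma// ?eGammaS//.
by lra.
Qed.

Lemma Gamma_ge0 x : 0 < x -> 0 <= Gamma x.
Proof. by move=> x0; rewrite -lee_fin EFin_Gamma// eGamma_ge0. Qed.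

(** Concavity of $t^b$ at 1. With [m] the value of the tangent, $\ln y\le y-1$ is used at $t/m$ and
    $1/m$ with weights $b$ and $1-b$, for which the right-hand sides cancel. *)
Lemma powR_le_tangent b t : 0 <= b <= 1 -> 0 < t -> t `^ b <= 1 + b * (t - 1).
Proof.
move=> /andP[b0 b1] t0.
have m0 : 0 < 1 + b * (t - 1).
  have [->|b1'] := eqVneq b 1; first by lra.
  have : b < 1 by rewrite lt_neqAle b1'.
  have : 0 <= b * t by rewrite mulr_ge0// ltW.
  by lra.
have lnle y : 0 < y -> ln y <= y - 1.
  by move=> y0; rewrite -{1}[y](subrKC 1) le_ln1Dx//; lra.
set m := (X in _ <= X) in m0 *.
rewrite -ler_ln ?posrE ?powR_gt0// ln_powR.
have := lnle (t / m); have := lnle m^-1.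
rewrite invr_gt0 divr_gt0// ln_div ?posrE// lnV ?posrE// => /(_ m0) h1 /(_ isT) h2.
have E : b * (t / m - 1) + (1 - b) * (m^-1 - 1) = 0.
  transitivity ((1 + b * (t - 1)) / m - 1); first by field; rewrite gt_eqF.
  by rewrite divff ?subrr// gt_eqF.
have : b * (ln t - ln m) <= b * (t / m - 1) by rewrite ler_wpM2l.
have : (1 - b) * (- ln m) <= (1 - b) * (m^-1 - 1) by rewrite ler_wpM2l// subr_ge0.
by lra.
Qed.

Lemma powR_le_tangent_at b c t : 0 <= b <= 1 -> 0 < c -> 0 < t ->
  t `^ b <= c `^ b * ((1 - b) + b * (t / c)).
Proof.
move=> b01 c0 t0; have := powR_le_tangent b01 (divr_gt0 t0 c0).
rewrite -(ler_pM2l (powR_gt0 b c0)) -powRM ?divr_ge0 ?(ltW c0) ?(ltW t0)// mulrCA divff ?gt_eqF// mulr1.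
by move/le_trans; apply; rewrite le_eqVlt; apply/orP; left; apply/eqP; ring.
Qed.

(** The concave inequality with exponent [b^-1] at the point $1+bt$, raised to the power [b]. *)
Lemma bernoulli_ge1 b t : 1 <= b -> 0 <= t -> 1 + b * t <= (1 + t) `^ b.
Proof.
move=> b1 t0; have b0 : 0 < b by lra.
have bt : 0 <= b * t by rewrite mulr_ge0// ltW.
have := @powR_le_tangent b^-1 (1 + b * t).
rewrite invr_ge0 invf_le1// (ltW b0) b1 => /(_ isT).
have -> : b^-1 * (1 + b * t - 1) = t by field; rewrite gt_eqF.
have p0 : 0 < 1 + b * t by lra.
move=> /(_ p0) H.
have := @ge0_ler_powR R b (ltW b0) _ _ _ _ H; rewrite !nnegrE powR_ge0 -powRrM mulVf ?gt_eqF//.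
by rewrite powRr1 ?(ltW p0)//; apply => //; lra.
Qed.

(** A linearised form of log-convexity: the tangent inequality at [c] is integrated against
    $t^{x-1}e^{-t}$. Taking [c = x] yields $\Gamma(x+b)\le x^b\Gamma(x)$. *)
Lemma Gamma_tangent x b c : 0 < x -> 0 <= b <= 1 -> 0 < c ->
  Gamma (x + b) <= c `^ b * ((1 - b) * Gamma x + b * (Gamma (x + 1) / c)).
Proof.
move=> x0 b01 c0; have /andP[b0 b1] := b01.
have x1 : 0 < x + 1 by lra. have xb : 0 < x + b by lra.
have k1 : 0 <= c `^ b * (1 - b) by rewrite mulr_ge0 ?powR_ge0 ?subr_ge0.
have k2 : 0 <= c `^ b * b / c by rewrite divr_ge0 ?mulr_ge0 ?powR_ge0// ltW.
rewrite -lee_fin EFin_Gamma//.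
have -> : c `^ b * ((1 - b) * Gamma x + b * (Gamma (x + 1) / c)) =
  (c `^ b * (1 - b)) * Gamma x + (c `^ b * b / c) * Gamma (x + 1) by ring.
rewrite EFinD !EFinM -!EFinM EFinM [X in (_ <= _ + X)%E]EFinM !EFin_Gamma//.
have mG y : measurable_fun (`]0%R, +oo[%classic : set (measurableTypeR R)) (fun t : R
  => (t `^ y * expR (- t))%:E).
  by apply/measurable_EFinP; exact: measurable_Gamma_integrand.
have G0 y (t : R) : `]0%R, +oo[%classic t -> (0 <= (t `^ y * expR (- t))%:E)%E.
  by move=> _; rewrite lee_fin mulr_ge0 ?powR_ge0 ?expR_ge0.
rewrite /eGamma -!ge0_integralZl//; try exact: G0.
rewrite -ge0_integralD//; last 4 first.
- by move=> t _; rewrite -EFinM lee_fin !mulr_ge0 ?powR_ge0 ?expR_ge0// subr_ge0.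
- by apply: measurable_funeM.
- by move=> t _; rewrite -EFinM lee_fin mulr_ge0// mulr_ge0 ?powR_ge0 ?expR_ge0.
- by apply: measurable_funeM.
apply: ge0_le_integral => //.
- exact: G0.
- by apply: emeasurable_funD; apply: measurable_funeM.
move=> t; rewrite /= in_itv/= andbT => t0.
rewrite -!EFinM -EFinD lee_fin.
have pw y : t `^ (x - 1 + y) = t `^ (x - 1) * t `^ y.
  by rewrite powRD// (gt_eqF t0) implybT.
have -> : x + b - 1 = x - 1 + b by ring.
have -> : x + 1 - 1 = x - 1 + 1 by ring.
rewrite !pw powRr1 ?(ltW t0)//.
have := powR_le_tangent_at b01 c0 t0 => H.
have : t `^ (x - 1) * expR (- t) * t `^ b <=
   t `^ (x - 1) * expR (- t) * (c `^ b * (1 - b + b * (t / c))).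
  by rewrite ler_wpM2l// mulr_ge0 ?powR_ge0 ?expR_ge0.
by move=> H2; apply: le_trans (le_trans _ H2) _; rewrite le_eqVlt; apply/orP; left;
  apply/eqP; ring.
Qed.

End Gamma_function.

(** * Gauss's limit formula and positivity of Gamma *)

Section Gamma_limit.
Context {R : realType}.
Implicit Types (b c t x y : R) (n N : nat).

Lemma Gamma1 : Gamma (1 : R) = 1.
Proof. by apply: EFin_inj; rewrite EFin_Gamma// eGamma1. Qed.

Lemma Gamma_rising x n : 0 < x ->
  Gamma (x + n%:R) = rbin x n * n`!%:R * Gamma x.
Proof.
move=> x0; elim: n => [|n IH]; first by rewrite addr0 rbin0 !mul1r.
have xn : 0 < x + n%:R by rewrite ltr_wpDr.
have -> : x + n.+1%:R = x + n%:R + 1 by rewrite -natr1 addrA.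
rewrite (GammaS xn) IH factS.
have -> : (n.+1 * n`!)%:R = n.+1%:R * n`!%:R :> R by rewrite natrM.
by rewrite [in RHS]mulrA -[rbin x n.+1 * _]mulrC rbinS_mul; ring.
Qed.

Lemma Gamma_nat n : Gamma (1 + n%:R : R) = n`!%:R.
Proof. by rewrite Gamma_rising// rbin_1l Gamma1 mul1r mulr1. Qed.

(** [Gamma_tangent] with [x] and [c] equal to $n+1$, that is $\Gamma(n+1+b)\le(n+1)^b\,n!$. *)
Lemma Gamma_upper b n : 0 <= b <= 1 ->
  Gamma (1 + b) * rbin (1 + b) n <= n.+1%:R `^ b.
Proof.
move=> /[dup] b01 /andP[b0 b1].
have p : 0 < 1 + b by lra.
have c0 : 0 < n.+1%:R :> R by [].
have f0 : 0 < n`!%:R :> R by rewrite ltr0n fact_gt0.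
have x0 : 0 < 1 + n%:R :> R by rewrite addrC natr1.
have := Gamma_tangent x0 b01 c0.
have -> : Gamma (1 + n%:R + 1) = (n.+1)`!%:R :> R by rewrite -addrA natr1 Gamma_nat.
rewrite Gamma_nat factS natrM [_ * _ / _]mulrAC divff ?gt_eqF// mul1r.
rewrite [1 + n%:R + b]addrAC Gamma_rising// -mulrDl subrK mul1r => H.
rewrite -(ler_pM2r f0); apply: le_trans H.
by rewrite le_eqVlt; apply/orP; left; apply/eqP; ring.
Qed.

(** The same inequality with exponent $1-b$, starting from $n+1+b$ and ending at the integer
    $n+2$. *)
Lemma Gamma_lower b n : 0 <= b <= 1 ->
  n.+1%:R <= (n.+1%:R + b) `^ (1 - b) * (Gamma (1 + b) * rbin (1 + b) n).
Proof.
move=> /[dup] b01 /andP[b0 b1].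
have p : 0 < 1 + b by lra.
have f0 : 0 < n`!%:R :> R by rewrite ltr0n fact_gt0.
have x0 : 0 < n.+1%:R + b :> R by rewrite ltr_wpDr.
have b01' : 0 <= 1 - b <= 1 by lra.
have := Gamma_tangent x0 b01' x0.
rewrite GammaS// [_ * Gamma _ / _]mulrAC divff ?gt_eqF// mul1r -mulrDl subrK mul1r.
have -> : n.+1%:R + b + (1 - b) = 1 + n.+1%:R by ring.
rewrite Gamma_nat.
have -> : n.+1%:R + b = 1 + b + n%:R by rewrite -natr1; ring.
rewrite Gamma_rising// factS natrM => H.
rewrite -(ler_pM2r f0); apply: (le_trans H).
by rewrite le_eqVlt; apply/orP; left; apply/eqP; ring.
Qed.

(** [Gamma_lower] at [n = 0] excludes the value 0 on $[1,2]$; the functional equation spreads this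
    to all positive arguments. *)
Lemma Gamma_gt0 x : 0 < x -> 0 < Gamma x.
Proof.
move=> x0.
have H b : 0 <= b <= 1 -> 0 < Gamma (1 + b).
  move=> /[dup] b01 /andP[b0 b1].
  have := Gamma_lower 0 b01; rewrite rbin0 mulr1 => H.
  rewrite lt_neqAle Gamma_ge0 ?andbT; last by lra.
  by apply/eqP => E; move: H; rewrite -E mulr0; lra.
suff : forall n y, y <= n.+1%:R -> 0 < y -> 0 < Gamma y.
  by apply; [|exact: x0]; apply/ltW/truncnS_gt.
elim=> [|n IH] y yn y0.
  have : 0 < Gamma (1 + y) by apply: H; rewrite (ltW y0) yn.
  by rewrite addrC GammaS// pmulr_rgt0.
have [y1|y1] := leP y 1; first by apply: IH => //; apply: (le_trans y1); rewrite ler1n.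
rewrite -[y](subrK 1) GammaS ?mulr_gt0 ?subr_gt0//; apply: IH; rewrite ?subr_gt0//.
by rewrite lerBlDr natr1.
Qed.

(* Gauss's product formula: [Gamma (1 + b) = lim 1 / gauss_quot b N]. *)
Definition gauss_quot b N : R := rbin (1 + b) N / N.+1%:R `^ b.

Lemma gauss_quot_ge0 b N : 0 <= b -> 0 <= gauss_quot b N.
Proof. by move=> b0; rewrite divr_ge0 ?powR_ge0 ?rbin_ge0//; lra. Qed.

Lemma gauss_quotD1 b N : 0 <= b ->
  Gamma (1 + (b + 1)) * gauss_quot (b + 1) N =
  Gamma (1 + b) * gauss_quot b N * (1 + b / N.+1%:R).
Proof.
move=> b0; have p : 0 < 1 + b by lra.
have q : 0 < N.+1%:R :> R by [].
rewrite addrA GammaS// /gauss_quot.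
rewrite powRD; last by rewrite (gt_eqF q) implybT.
rewrite powRr1 ?(ltW q)//.
have E : (1 + b) * rbin (1 + (b + 1)) N = (1 + b + N%:R) * rbin (1 + b) N.
  by rewrite addrA -rbin_step rbinS_mul.
have -> : 1 + b / N.+1%:R = (1 + b + N%:R) / N.+1%:R.
  by rewrite -natr1; field; rewrite natr1 pnatr_eq0.
have pw : 0 < (N.+1%:R : R) `^ b by rewrite powR_gt0.
transitivity (Gamma (1 + b) * ((1 + b) * rbin (1 + (b + 1)) N) / (N.+1%:R `^ b * N.+1%:R)).
  by rewrite addrA; ring.
by rewrite E; field; rewrite (gt_eqF pw) addrC natr1 (gt_eqF q).
Qed.

(** For [b] in $[0,1]$ the two Gamma bounds squeeze the product; larger [b] are reached in unit
    steps, each contributing a factor that tends to 1. *)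
Lemma gauss_quot_cvg1 b : 0 <= b ->
  Gamma (1 + b) * gauss_quot b N @[N --> \oo] --> (1 : R).
Proof.
suff H n : forall b, 0 <= b <= n.+1%:R ->
    Gamma (1 + b) * gauss_quot b N @[N --> \oo] --> (1 : R).
  by move=> b0; apply: (H (Num.truncn b)); rewrite b0 ltW// truncnS_gt.
elim: n => [|n IH] {}b.
  move=> b01; have /andP[b0 b1] := b01.
  apply: (@squeeze_cvgr _ _ _ _ (fun N => 1 - N.+1%:R^-1) (fun=> 1)); last 2 first.
  - by rewrite -[X in _ --> X]subr0; apply: cvgB; [exact: cvg_cst|exact: cvg_harmonic].
  - exact: cvg_cst.
  apply: nearW => N.
  have q : 0 < N.+1%:R :> R by [].
  have q' : 0 < N.+1%:R + b :> R by rewrite ltr_wpDr.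
  have pw : 0 < (N.+1%:R : R) `^ b by rewrite powR_gt0.
  have pw' : 0 < (N.+1%:R + b) `^ (1 - b) by rewrite powR_gt0.
  rewrite /gauss_quot mulrA ler_pdivrMr// mul1r Gamma_upper// andbT.
  rewrite ler_pdivlMr//.
  have H := Gamma_lower N b01.
  (* Merging the two powers replaces $q=N+1$ by $q+b$, and $(1-1/q)(q+b)\le q$ because $b\le1$. *)
  have H2 : (N.+1%:R + b) `^ (1 - b) * N.+1%:R `^ b <= N.+1%:R + b.
    rewrite -[leRHS](powRr1 (ltW q')).
    have -> : (N.+1%:R + b) `^ 1 = (N.+1%:R + b) `^ (1 - b) * (N.+1%:R + b) `^ b.
      by rewrite -powRD ?subrK// (gt_eqF q') implybT.
    by rewrite ler_wpM2l ?powR_ge0// ge0_ler_powR ?nnegrE ?(ltW q) ?(ltW q') ?lerDl.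
  rewrite -(ler_pM2l pw'); apply: le_trans H.
  have k : 0 <= 1 - N.+1%:R^-1 :> R by rewrite subr_ge0 invf_le1// ler1n.
  rewrite mulrCA; apply: (le_trans (ler_wpM2l k H2)).
  have : N.+1%:R^-1 * N.+1%:R = 1 :> R by rewrite mulVf.
  have : 0 <= N.+1%:R^-1 * b :> R by rewrite mulr_ge0.
  move: b1 b0; rewrite /=; move: (N.+1%:R : R) (N.+1%:R^-1 : R) => y i.
  by nra.
move=> /andP[b0 bn]; have [b1|b1] := leP b 1.
  by apply: IH; rewrite b0 (le_trans b1)// ler1n.
have c0 : 0 <= b - 1 by rewrite subr_ge0 ltW.
have cn : 0 <= b - 1 <= n.+1%:R by rewrite c0 lerBlDr natr1.
have : Gamma (1 + (b - 1)) * gauss_quot (b - 1) N * (1 + (b - 1) / N.+1%:R)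
    @[N --> \oo] --> (1 * (1 + (b - 1) * 0) : R).
  apply: cvgM; first exact: IH.
  apply: cvgD; first exact: cvg_cst.
  by apply: cvgM; [exact: cvg_cst|exact: cvg_harmonic].
rewrite mulr0 addr0 mulr1 => H.
by rewrite -[b](subrK 1); under eq_fun do rewrite gauss_quotD1//.
Qed.

End Gamma_limit.

(** * Mittag-Leffler functions *)

Section tannery.
Context {R : realType}.
Implicit Types (f g : R^nat).

Lemma cvg_sumr (I T : Type) (F : set_system T) (FF : ProperFilter F) (r : seq I)
    (f : I -> T -> R) (l : I -> R) : (forall i, f i x @[x --> F] --> l i) ->
  \sum_(i <- r) f i x @[x --> F] --> \sum_(i <- r) l i.
Proof.
move=> fl; elim: r => [|i r IH].
  by rewrite big_nil; under eq_fun do rewrite big_nil; exact: cvg_cst.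
by rewrite big_cons; under eq_fun do rewrite big_cons; exact: cvgD.
Qed.

Lemma dominated_series_cvg f g : (forall k, `|f k| <= g k) ->
  cvgn (series g) -> cvgn (series f).
Proof.
move=> fg cg; apply: normed_cvg; apply: series_le_cvg cg => //= k.
by apply: le_trans (fg k).
Qed.

Lemma dominated_series_tail f g K : (forall k, `|f k| <= g k) ->
  cvgn (series g) ->
  `|limn (series f) - series f K| <= limn (series g) - series g K.
Proof.
move=> fg cg; have cf := dominated_series_cvg fg cg.
have C1 : `|series f M - series f K| @[M --> \oo] --> `|limn (series f) - series f K|.
  by apply: cvg_norm; apply: cvgB => //; exact: cvg_cst.
have C2 : series g M - series g K @[M --> \oo] --> limn (series g) - series g K.
  by apply: cvgB => //; exact: cvg_cst.
apply: (ler_cvg_to C1 C2); exists K => // M /= KM.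
rewrite !sub_series_geq//; apply: le_trans (ler_norm_sum _ _ _) _.
by apply: ler_sum => k _.
Qed.

Lemma tannery (f : nat -> R^nat) F g :
  (\forall N \near \oo, forall k, `|f N k| <= g k) -> cvgn (series g) ->
  (forall k, f N k @[N --> \oo] --> F k) ->
  limn (series (f N)) @[N --> \oo] --> limn (series F).
Proof.
move=> fg cg fF.
have Fg k : `|F k| <= g k.
  apply: (ler_cvg_to (cvg_norm (fF k)) (cvg_cst _)).
  by near=> N; near: N; apply: filterS fg => N; apply.
apply/cvgrPdist_le => e e0.
have /cvgrPdist_le/(_ (e / 3)) : series g K @[K --> \oo] --> limn (series g) by [].
rewrite divr_gt0// => /(_ isT) [K _ /(_ K (leqnn K)) HK].
have HK' : limn (series g) - series g K <= e / 3 by apply: le_trans HK; exact: ler_norm.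
have cK : series (f N) K @[N --> \oo] --> series F K.
  rewrite /series /=; apply: cvg_sumr => k; exact: fF.
have /cvgrPdist_le/(_ (e / 3)) := cK; rewrite divr_gt0// => /(_ isT) H.
near=> N.
have h1 : `|series F K - series (f N) K| <= e / 3 by near: N.
have h2 : `|limn (series (f N)) - series (f N) K| <= e / 3.
  apply: le_trans HK'; apply: dominated_series_tail => //.
  by near: N.
have h3 := le_trans (dominated_series_tail K Fg cg) HK'.
move: h1 h2 h3; rewrite !ler_norml; lra.
Unshelve. all: by end_near.
Qed.

End tannery.

(** * Mittag-Leffler series as limits of scaled binomial coefficients *)

Section mittag_leffler_limit.
Context {R : realType}.
Implicit Types (a b g x y z : R) (n N k : nat).

(** The ratio of consecutive terms is $(1+\frac b{m+1})/(1+\frac1{m+1})^b$, at most 1 by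
    Bernoulli. *)
Lemma gauss_quot_noninc b n m : 1 <= b -> (n <= m)%N ->
  gauss_quot b m <= gauss_quot b n.
Proof.
move=> b1; elim: m => [|m IH]; first by rewrite leqn0 => /eqP ->.
rewrite leq_eqVlt => /orP[/eqP -> //|]; rewrite ltnS => /IH; apply: le_trans.
have p : 0 < (m.+1%:R : R) by [].
have p2 : 0 < (m.+2%:R : R) by [].
rewrite /gauss_quot rbinS -mulrA; apply: ler_wpM2l; first by apply: rbin_ge0; lra.
rewrite ler_pdivrMr ?powR_gt0// ler_pdivlMl ?powR_gt0//.
have i0 : 0 <= (m.+1%:R^-1 : R) by [].
have -> : m.+2%:R = (1 + m.+1%:R^-1) * m.+1%:R :> R.
  by rewrite mulrDl mulVf// mul1r addrC -[m.+2%:R]natr1 addrC.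
have i1 : 0 <= 1 + m.+1%:R^-1 :> R by rewrite addr_ge0.
rewrite powRM//.
rewrite [leLHS]mulrC.
apply: ler_wpM2r; first exact: powR_ge0.
apply: le_trans (bernoulli_ge1 b1 i0).
rewrite le_eqVlt; apply/orP; left; apply/eqP.
by rewrite -natr1; field; rewrite natr1 gt_eqF.
Qed.

Lemma gauss_quot_le2 b N : 0 <= b <= 1 -> gauss_quot b N <= 2.
Proof.
move=> /[dup] b01 /andP[b0 b1].
have G0 : 0 < Gamma (1 + b) by apply: Gamma_gt0; lra.
have H1 := Gamma_lower 0 b01; have H2 := Gamma_upper N b01.
rewrite rbin0 mulr1 in H1.
have q : 0 < N.+1%:R `^ b by rewrite powR_gt0.
rewrite /gauss_quot ler_pdivrMr//.
have H3 : (1 + b) `^ (1 - b) <= 2.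
  rewrite (@le_trans _ _ (1 + b))//; last by lra.
  by rewrite ler1_powR//; lra.
have r0 : 0 <= rbin (1 + b) N by apply: rbin_ge0; lra.
have H4 : 1 <= 2 * Gamma (1 + b) by apply: (le_trans H1); rewrite ler_wpM2r// ltW.
by nra.
Qed.

(** Domination by the value at [N0], uniformly in [b]. Monotonicity settles $b\ge1$; the factor
    [2 * N0.+1%:R] pays for smaller [b], where the quotient is only known to be at most 2. *)
Lemma gauss_quot_dom b N0 N : 0 <= b -> (N0 <= N)%N ->
  gauss_quot b N <= 2 * N0.+1%:R * gauss_quot b N0.
Proof.
move=> b0 NN; have [b1|/ltW b1] := leP 1 b.
  apply: (le_trans (gauss_quot_noninc b1 NN)).
  rewrite ler_peMl ?gauss_quot_ge0// -natrM ler1n.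
  by rewrite muln_gt0.
apply: (@le_trans _ _ 2); first by apply: gauss_quot_le2; rewrite b0.
rewrite -mulrA ler_peMr// /gauss_quot mulrA.
rewrite ler_pdivlMr ?powR_gt0// mul1r.
apply: (@le_trans _ _ N0.+1%:R); first by rewrite ler1_powR ?ler1n.
rewrite ler_peMr// /rbin.
elim: (N0) => [|n IH]; first by rewrite big_ord0.
rewrite big_ord_recr/= mulr_ege1// ler_pdivlMr// mul1r -natr1; lra.
Qed.

Lemma rbin_le_expn b n : 0 <= b -> rbin b n <= (1 + b) ^+ n.
Proof.
move=> b0; elim: n => [|n IH]; first by rewrite rbin0.
rewrite rbinS exprSr; apply: ler_pM => //; first exact: rbin_ge0.
  by rewrite divr_ge0// addr_ge0.
rewrite ler_pdivrMr// -natr1 mulrDl mul1r mulrDr mulr1.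
have : 0 <= b * n%:R by rewrite mulr_ge0.
lra.
Qed.

Lemma expn_le_expR x n : 0 <= x -> x ^+ n <= n`!%:R * expR x.
Proof.
move=> x0; case: n => [|n].
  by rewrite expr0 mul1r -expR0 ler_expR.
have := expR_ge1Dxn n x0 => H.
rewrite mulrC -ler_pdivrMr ?ltr0n ?fact_gt0//.
by apply: le_trans H; rewrite lerDr.
Qed.

(** Normalised to tend to $1/\Gamma(b)$. For $b=g+ak$ the power splits as
    $(N+1)^{1-g}((N+1)^{-a})^k$: a global factor and a rescaling of $z$. *)
Definition norm_rbin b N : R := N.+1%:R `^ (1 - b) * rbin b N.

Lemma norm_rbinE b N : 0 < b ->
  norm_rbin b N = N.+1%:R / (b + N%:R) * b * gauss_quot b N.
Proof.
move=> b0; have q : 0 < N.+1%:R :> R by [].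
have bN : 0 < b + N%:R by rewrite ltr_wpDr.
rewrite /norm_rbin /gauss_quot powRD; last by rewrite (gt_eqF q) implybT.
rewrite powRr1 ?(ltW q)// powRN.
have E : b * rbin (1 + b) N = (b + N%:R) * rbin b N.
  by rewrite [1 + b]addrC -rbin_step rbinS_mul.
transitivity (N.+1%:R / (b + N%:R) * (b * rbin (1 + b) N) / N.+1%:R `^ b).
  rewrite E; field; rewrite (gt_eqF bN) andbT gt_eqF// powR_gt0//.
by ring.
Qed.

Lemma norm_rbin_ge0 b N : 0 <= b -> 0 <= norm_rbin b N.
Proof. by move=> b0; rewrite mulr_ge0 ?powR_ge0 ?rbin_ge0. Qed.

Lemma norm_rbin_cvg b : 0 < b -> norm_rbin b N @[N --> \oo] --> (Gamma b)^-1.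
Proof.
move=> b0; have G0 := Gamma_gt0 b0.
have E : norm_rbin b = fun N => (1 + (b - 1) / N.+1%:R)^-1 *
    (Gamma (1 + b) * gauss_quot b N) * (Gamma b)^-1.
  apply/funext => N; rewrite norm_rbinE// [1 + b]addrC GammaS//.
  have q : 0 < N.+1%:R :> R by [].
  have bN : 0 < b + N%:R by rewrite ltr_wpDr.
  have -> : 1 + (b - 1) / N.+1%:R = (b + N%:R) / N.+1%:R.
    by rewrite -natr1; field; rewrite natr1 gt_eqF.
  by rewrite invf_div; field; rewrite (gt_eqF bN) (gt_eqF G0).
have H1 := gauss_quot_cvg1 (ltW b0).
have H2 : (1 + (b - 1) / N.+1%:R) @[N --> \oo] --> (1 + (b - 1) * 0 : R).
  apply: cvgD; first exact: cvg_cst.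
  by apply: cvgM; [exact: cvg_cst|exact: cvg_harmonic].
rewrite mulr0 addr0 in H2.
have H3 : (1 + (b - 1) / N.+1%:R)^-1 @[N --> \oo] --> (1^-1 : R).
  by apply: cvgV => //; rewrite oner_neq0.
have H4 : (1 + (b - 1) / N.+1%:R)^-1 * (Gamma (1 + b) * gauss_quot b N) * (Gamma b)^-1
    @[N --> \oo] --> 1^-1 * 1 * (Gamma b)^-1.
  by apply: cvgM; [exact: cvgM|exact: cvg_cst].
by rewrite E; move: H4; rewrite invr1 !mul1r.
Qed.

(** For fixed [N0] the bound is a constant times $(e/(N_0+1))^b$, hence geometric in [k] along
    $b=g+ak$, with a ratio made small by the choice of [N0]. *)
Lemma norm_rbin_dom b N0 N : 0 < b -> (N0 <= N)%N ->
  norm_rbin b N <= (2 * N0.+1%:R * (N0.+1)`!%:R) * expR (1 + b) / N0.+1%:R `^ b.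
Proof.
move=> b0 NN; rewrite norm_rbinE//.
have bN : 0 < b + N%:R by rewrite ltr_wpDr.
apply: (@le_trans _ _ ((1 + b) * gauss_quot b N)).
  rewrite ler_wpM2r ?gauss_quot_ge0 ?(ltW b0)// mulrAC ler_pdivrMr// -natr1.
  have : 0 <= b * N%:R by rewrite mulr_ge0// ltW.
  have : 0 <= b * b by rewrite mulr_ge0// ltW.
  have : 0 <= N%:R :> R by [].
  by nra.
have b1 : 0 <= 1 + b by lra.
apply: (@le_trans _ _ ((1 + b) * (2 * N0.+1%:R * gauss_quot b N0))).
  by rewrite ler_wpM2l// gauss_quot_dom// ltW.
rewrite /gauss_quot !mulrA; apply: ler_wpM2r; first by rewrite invr_ge0 powR_ge0.
have H : rbin (1 + b) N0 <= (1 + b) ^+ N0.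
  elim: (N0) => [|n IH]; first by rewrite rbin0.
  rewrite rbinS exprSr; apply: ler_pM => //; first exact: rbin_ge0.
    by rewrite divr_ge0// addr_ge0.
  rewrite ler_pdivrMr// -natr1 mulrDl mul1r mulrDr mulr1.
  have : 0 <= b * n%:R by rewrite mulr_ge0// ltW.
  by lra.
have H2 := expn_le_expR N0.+1 b1.
apply: (@le_trans _ _ (2 * N0.+1%:R * (1 + b) ^+ N0.+1)).
  have k : 0 <= 2 * N0.+1%:R * (1 + b) by rewrite mulr_ge0.
  rewrite exprS mulrA [leLHS](_ : _ = 2 * N0.+1%:R * (1 + b) * rbin (1 + b) N0); last by ring.
  exact: ler_wpM2l.
by rewrite -mulrA -[leRHS]mulrA -[leRHS]mulrA ler_wpM2l// ler_wpM2l.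
Qed.

Lemma norm_rbin_geometric a g z : 0 < a -> 0 < g -> 0 <= z ->
  exists C q : R, [/\ 0 <= q < 1, cvgn (series (geometric C q)) &
    \forall N \near \oo, forall k,
      z ^+ k * norm_rbin (g + a * k%:R) N <= geometric C q k].
Proof.
move=> a0 g0 z0.
have bk k : 0 < g + a * k%:R by rewrite ltr_wpDr// mulr_ge0// ltW.
(* The quotient is the ratio of the dominating geometric series. *)
have [N0 HN0] : exists N0 : nat, z * expR a / N0.+1%:R `^ a <= 2^-1.
  pose x := (2 * (z * expR a)) `^ a^-1; exists (Num.truncn x).
  have zr : 0 <= 2 * (z * expR a) by rewrite !mulr_ge0// expR_ge0.
  rewrite ler_pdivrMr ?powR_gt0// ler_pdivlMl//.
  have -> : 2 * (z * expR a) = x `^ a by rewrite /x -powRrM mulVf ?gt_eqF// powRr1.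
  apply: ge0_ler_powR; [exact: ltW|by rewrite nnegrE powR_ge0|by rewrite nnegrE ler0n|].
  exact/ltW/truncnS_gt.
set q := z * expR a / N0.+1%:R `^ a in HN0.
have q0 : 0 <= q by rewrite divr_ge0 ?mulr_ge0 ?expR_ge0 ?powR_ge0.
pose C := 2 * N0.+1%:R * (N0.+1)`!%:R * expR (1 + g) / N0.+1%:R `^ g.
have q1 : q < 1 by apply: (le_lt_trans HN0); lra.
exists C, q; split; first by rewrite q0.
  by apply: is_cvg_geometric_series; rewrite ger0_norm.
exists N0 => // N /= NN k.
apply: le_trans (ler_wpM2l (exprn_ge0 k z0) (norm_rbin_dom (bk k) NN)) _.
rewrite le_eqVlt; apply/orP; left; apply/eqP; rewrite /C /q /=.
have p : 0 < N0.+1%:R :> R by [].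
rewrite powRD; last by rewrite (gt_eqF p) implybT.
rewrite powRrM powR_mulrn ?powR_ge0// addrA expRD.
rewrite expRM_natr !exprMn exprVn.
by rewrite invfM; ring.
Qed.

Lemma mittag_leffler_cvg a g z : 0 < a -> 0 < g -> 0 <= z ->
  limn (series (fun k => (- z) ^+ k * norm_rbin (g + a * k%:R) N)) @[N --> \oo]
  --> mittag_leffler a g (- z).
Proof.
move=> a0 g0 z0.
have bk k : 0 < g + a * k%:R by rewrite ltr_wpDr// mulr_ge0// ltW.
have [C [q [q01 cq dom]]] := norm_rbin_geometric a0 g0 z0.
apply: (@tannery R _ _ (geometric C q)) => //.
- apply: filterS dom => N H k.
  by rewrite normrM normrX normrN (ger0_norm z0) ger0_norm ?norm_rbin_ge0 ?(ltW (bk k)).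
- move=> k; apply: cvgM; first exact: cvg_cst.
  exact: norm_rbin_cvg.
Qed.

(** Continuity at 0, where the value is $1/\Gamma(g)>0$. A sequence of counterexamples tending to 0
    would contradict [tannery], the terms being dominated by those for $z=1$. *)
Lemma mittag_leffler_gt0 a g : 0 < a -> 0 < g ->
  exists2 h : R, 0 < h & forall x, 0 <= x <= h -> 0 < mittag_leffler a g (- x).
Proof.
move=> a0 g0; apply: contrapT => H.
have bk k : 0 < g + a * k%:R by rewrite ltr_wpDr// mulr_ge0// ltW.
have /choice[x Hx] : forall n : nat, exists x, 0 <= x <= n.+1%:R^-1
  /\ mittag_leffler a g (- x) <= 0.
  move=> n; apply: contrapT => K; apply: H; exists n.+1%:R^-1 => // x xn.
  by rewrite ltNge; apply/negP => N; apply: K; exists x.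
have [C [q [q01 cq dom]]] := norm_rbin_geometric a0 g0 (@ler01 R).
have D k : (Gamma (g + a * k%:R))^-1 <= geometric C q k.
  apply: (ler_cvg_to (norm_rbin_cvg (bk k)) (cvg_cst _)).
  by apply: filterS dom => N /(_ k); rewrite expr1n mul1r.
have x0 : x n @[n --> \oo] --> (0 : R).
  apply: (@squeeze_cvgr _ _ _ _ (fun=> 0) (fun n => n.+1%:R^-1)).
  - by apply: nearW => n; have [] := Hx n.
  - exact: cvg_cst.
  - exact: cvg_harmonic.
have L : mittag_leffler a g (- x n) @[n --> \oo] --> mittag_leffler a g (0 : R).
  apply: (@tannery R _ _ (geometric C q)) => //.
  - apply: nearW => n k; have [/andP[xn0 xn1] _] := Hx n.
    rewrite normrM normrX normrN (ger0_norm xn0) ger0_norm; last first.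
      by rewrite invr_ge0 ltW// Gamma_gt0.
    apply: le_trans (D k); rewrite ler_piMl//; first by rewrite invr_ge0 ltW// Gamma_gt0.
    by rewrite exprn_ile1// (le_trans xn1)// invf_le1// ler1n.
  - move=> k; apply: cvgM; last exact: cvg_cst.
    have Nx0 : - x n @[n --> \oo] --> (0 : R) by rewrite -oppr0; exact: cvgN.
    exact: (continuous_cvg _ (@exprn_continuous R k 0) Nx0).
have E0 : mittag_leffler a g (0 : R) = (Gamma g)^-1.
  apply/cvg_lim => //; rewrite -(cvg_shiftn 1) /=.
  rewrite (_ : (fun _ => _) = cst (Gamma g)^-1); first exact: cvg_cst.
  apply/funext => n; rewrite /series /= addn1 big_nat_recl//= big1 ?addr0//.
    by rewrite mulr0 addr0 expr0 mul1r.
  by move=> i _; rewrite exprS !mul0r.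
have : mittag_leffler a g (0 : R) <= 0.
  by apply: (ler_cvg_to L (cvg_cst 0)); apply: nearW => n; have [] := Hx n.
by rewrite E0 leNgt invr_gt0 Gamma_gt0.
Qed.

End mittag_leffler_limit.

(** * The implicit Gruenwald-Letnikov scheme *)

Section scheme.
Context {R : realType}.
Implicit Types (a g y z : R) (n N k : nat).

Section def.
Variables (a g y : R).

(** Each step uses all earlier values, so the whole history is carried along. *)
Fixpoint scheme_seq n : seq R :=
  if n is m.+1 then
    let l := scheme_seq m in
    rcons l (y * (\sum_(j < m) - rbin (- a) j.+1 * l`_(m - j.+1) + rbin (g - a) m))
  else [::].

(* One step of the implicit Gruenwald-Letnikov discretisation of the
   fractional equation with relaxation factor [y = 1 / (1 + z)]. *)
Definition scheme n := (scheme_seq n.+1)`_n.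

Lemma size_scheme_seq n : size (scheme_seq n) = n.
Proof. by elim: n => //= n IH; rewrite size_rcons IH. Qed.

Lemma nth_scheme_seq n i : (i < n)%N -> (scheme_seq n)`_i = scheme i.
Proof.
elim: n => // n IH; rewrite ltnS leq_eqVlt => /orP[/eqP->//|i_n].
by rewrite /= nth_rcons size_scheme_seq i_n IH.
Qed.

Lemma schemeE n : scheme n =
  y * (\sum_(j < n) - rbin (- a) j.+1 * scheme (n - j.+1) + rbin (g - a) n).
Proof.
rewrite {1}/scheme /= nth_rcons size_scheme_seq ltnn eqxx; congr (_ * (_ + _)).
apply: eq_bigr => j _; rewrite nth_scheme_seq//.
by rewrite ltn_subrL (leq_ltn_trans _ (ltn_ord j)).
Qed.

End def.

(** [rbin g n] solves the recursion for [y = 1], and the recursion is monotone in [y] and in the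
    earlier values because its weights are nonnegative. *)
Lemma scheme_bounds a g y n : 0 < a < 1 -> a <= g -> 0 <= y <= 1 ->
  0 <= scheme a g y n <= rbin g n.
Proof.
move=> a01 ag /andP[y0 y1]; elim/ltn_ind: n => n IH.
have E : rbin g n = \sum_(j < n) - rbin (- a) j.+1 * rbin g (n - j.+1) + rbin (g - a) n.
  have -> : g - a = - a + g by ring.
  rewrite -rbinD big_ord_recl rbin0 mul1r subn0 addrCA -big_split/=.
  rewrite big1 ?addr0// => j _.
  by rewrite /bump/= add1n mulNr addNr.
have cj (j : 'I_n) : 0 <= - rbin (- a) j.+1 by rewrite oppr_ge0 rbinN_le0.
have IHj (j : 'I_n) : 0 <= scheme a g y (n - j.+1) <= rbin g (n - j.+1).
  by apply: IH; rewrite ltn_subrL (leq_ltn_trans _ (ltn_ord j)).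
have b0 : 0 <= rbin (g - a) n by apply: rbin_ge0; rewrite subr_ge0.
have S0 : 0 <= \sum_(j < n) - rbin (- a) j.+1 * scheme a g y (n - j.+1).
  by apply: sumr_ge0 => j _; rewrite mulr_ge0//; case/andP : (IHj j).
have S1 : \sum_(j < n) - rbin (- a) j.+1 * scheme a g y (n - j.+1) <=
    \sum_(j < n) - rbin (- a) j.+1 * rbin g (n - j.+1).
  by apply: ler_sum => j _; rewrite ler_wpM2l//; case/andP : (IHj j).
rewrite schemeE E mulr_ge0 ?addr_ge0//=.
apply: (@le_trans _ _ (1 * (\sum_(j < n) - rbin (- a) j.+1 * scheme a g y (n - j.+1)
  + rbin (g - a) n))).
  by rewrite ler_wpM2r// addr_ge0.
by rewrite mul1r lerD2r.
Qed.

(* Both sides are the coefficient of [x ^+ n] in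
   [(1 - x) `^ (a - g) / ((1 - x) `^ a + z)]. *)
Lemma scheme_series a g z n : 0 < a < 1 -> a <= g -> 0 <= z -> z * expR a < 1 ->
  series (fun k => (- z) ^+ k * rbin (g + a * k%:R) n) K @[K --> \oo] -->
    scheme a g (1 + z)^-1 n.
Proof.
move=> /[dup] a01 /andP[a0 a1] ag z0 za.
have g0 : 0 < g by exact: lt_le_trans ag.
have bk k : 0 < g + a * k%:R by rewrite ltr_wpDr// mulr_ge0// ltW.
pose v m k := (- z) ^+ k * rbin (g + a * k%:R) m.
(* Since $(1+b)^m\le m!\,e^{1+b}$, the terms are geometric in [k] with ratio $ze^a$, whence the
   smallness condition on [z]. *)
have cv m : cvgn (series (v m)).
  apply: (@dominated_series_cvg _ _ (geometric (m`!%:R * expR (1 + g)) (z * expR a))).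
    move=> k; rewrite normrM normrX normrN (ger0_norm z0) ger0_norm ?rbin_ge0 ?(ltW (bk k))//=.
    have := rbin_le_expn m (ltW (bk k)) => H.
    have p1 : 0 <= 1 + (g + a * k%:R) by have := bk k; lra.
    have {}H := le_trans H (expn_le_expR m p1).
    apply: le_trans (ler_wpM2l (exprn_ge0 k z0) H) _.
    rewrite addrA expRD expRM_natr exprMn le_eqVlt; apply/orP; left; apply/eqP; ring.
  by apply: is_cvg_geometric_series; rewrite ger0_norm// mulr_ge0// expR_ge0.
pose V m := limn (series (v m)).
(* Convolution with the coefficients of $(1-x)^a$ lowers the exponent $g+a(k+1)$ to $g+ak$. The term
   $k=0$ becomes the source and the others reproduce $-z$ times the series; hence [K.+1] terms on
   one side and [K] on the other. *)
have recV m : \sum_(j < m.+1) rbin (- a) j * V (m - j)%N = rbin (g - a) m - z * V m.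
  have C1 : \sum_(j < m.+1) rbin (- a) j * series (v (m - j)%N) K.+1 @[K --> \oo] -->
      \sum_(j < m.+1) rbin (- a) j * V (m - j)%N.
    apply: cvg_sumr => j; apply: cvgM; first exact: cvg_cst.
    by have := cv (m - j)%N; rewrite -(cvg_shiftS (series (v (m - j)%N))).
  have C2 : rbin (g - a) m - z * series (v m) K @[K --> \oo] --> rbin (g - a) m - z * V m.
    by apply: cvgB; [exact: cvg_cst|apply: cvgM; [exact: cvg_cst|exact: cv]].
  suff FE : (fun K => \sum_(j < m.+1) rbin (- a) j * series (v (m - j)%N) K.+1) =
      (fun K => rbin (g - a) m - z * series (v m) K).
    by rewrite FE in C1; exact: (cvg_unique _ C1 C2).
  apply/funext => K; rewrite /series /=.
  under eq_bigr do rewrite mulr_sumr.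
  rewrite exchange_big/= big_nat_recl//=; congr (_ + _).
    transitivity (\sum_(i < m.+1) rbin (- a) i * rbin g (m - i)).
      by apply: eq_bigr => i _; rewrite /v expr0 mul1r mulr0 addr0.
    by rewrite rbinD addrC.
  rewrite mulr_sumr -sumrN; apply: eq_bigr => k _.
  transitivity ((- z) ^+ k.+1 * (\sum_(i < m.+1) rbin (- a) i * rbin (g
    + a * k.+1%:R) (m - i))).
    by rewrite mulr_sumr; apply: eq_bigr => i _; rewrite /v; ring.
  rewrite rbinD /v exprS.
  have -> : - a + (g + a * k.+1%:R) = g + a * k%:R by rewrite -natr1; ring.
  by ring.
suff -> : scheme a g (1 + z)^-1 n = V n by exact: cv.
elim/ltn_ind: n => n IH.
rewrite schemeE.
have z1 : 1 + z != 0 by rewrite gt_eqF//; lra.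
apply: (@mulfI _ (1 + z)) => //; rewrite mulrA divff// mul1r.
have := recV n; rewrite big_ord_recl rbin0 mul1r subn0 => E.
rewrite mulrDl mul1r.
have -> : \sum_(j < n) - rbin (- a) j.+1 * scheme a g (1 + z)^-1 (n - j.+1) =
    - \sum_(i < n) rbin (- a) (bump 0 i) * V (n - bump 0 i)%N.
  rewrite -sumrN; apply: eq_bigr => j _.
  by rewrite /bump /= add1n mulNr IH// ltn_subrL (leq_ltn_trans _ (ltn_ord j)).
by move: E => /=; lra.
Qed.

End scheme.

(** * Cones of multipliers *)

Section mult_cone.
Context {R : realType}.
Implicit Types (a g s : R) (f m x : nat -> R) (P : (nat -> R) -> Prop).

(** Separates the scalar constructions from analysis on [Omega]; the argument of a multiplier is the
    index of an eigenvalue. The limit clause asks for pointwise convergence but for a bound uniform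
    in this index. *)
Record mult_cone P : Prop := MultCone {
  mult_cone_cst : forall c : R, 0 <= c -> P (fun=> c) ;
  mult_cone_add : forall m1 m2, P m1 -> P m2 -> P (fun n => m1 n + m2 n) ;
  mult_cone_mul : forall m1 m2, P m1 -> P m2 -> P (fun n => m1 n * m2 n) ;
  mult_cone_lim : forall (F : nat -> nat -> R) m (M : R),
    (forall k, P (F k)) -> (forall k n, `|F k n| <= M) ->
    (forall n, F k n @[k --> \oo] --> m n) -> P m }.

Section closure.
Variables (P : (nat -> R) -> Prop) (HP : mult_cone P).

Lemma mult_cone_scale c m : 0 <= c -> P m -> P (fun n => c * m n).
Proof. by move=> c0 Pm; apply: mult_cone_mul => //; exact: mult_cone_cst. Qed.

Lemma mult_cone_exp m k : P m -> P (fun n => m n ^+ k).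
Proof.
move=> Pm; elim: k => [|k IH].
  by under eq_fun do rewrite expr0; exact: mult_cone_cst.
by under eq_fun do rewrite exprS; exact: mult_cone_mul.
Qed.

Lemma mult_cone_sum (I : Type) (r : seq I) (F : I -> nat -> R) :
  (forall i, P (F i)) -> P (fun n => \sum_(i <- r) F i n).
Proof.
move=> PF; elim: r => [|i r IH].
  by under eq_fun do rewrite big_nil; exact: mult_cone_cst.
by under eq_fun do rewrite big_cons; exact: mult_cone_add.
Qed.

(** The expansion is $\sum_j-c_{j+1}m^{j+1}$ with $c_{j+1}\le0$ the coefficients of $(1-x)^s$; its
    partial sums at 1 are [1 - rbin (1 - s) k], hence the uniform bound 1. *)
Lemma mult_cone_binomial m s : 0 < s < 1 -> (forall n, 0 <= m n < 1) ->
  P m -> P (fun n => 1 - (1 - m n) `^ s).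
Proof.
move=> s01 m01 Pm.
pose F k n := \sum_(j < k) - rbin (- s) j.+1 * m n ^+ j.+1.
have FE k n : F k n = 1 - (rbin_poly (- s) k).[m n].
  rewrite rbin_polyE big_ord_recl rbin0 expr0 mulr1 opprD addrA subrr sub0r -sumrN.
  by apply: eq_bigr => j _; rewrite mulNr.
have cj j : 0 <= - rbin (- s) j.+1 by rewrite oppr_ge0 rbinN_le0.
apply: (mult_cone_lim HP (F := F) (M := 1)).
- move=> k; apply: mult_cone_sum => j; apply: mult_cone_scale => //.
  exact: mult_cone_exp.
- move=> k n; have /andP[m0 /ltW m1] := m01 n.
  rewrite ger0_norm; last first.
    by apply: sumr_ge0 => j _; rewrite mulr_ge0// exprn_ge0.
  apply: (@le_trans _ _ (\sum_(j < k) - rbin (- s) j.+1)).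
    by apply: ler_sum => j _; rewrite ler_piMr// exprn_ile1.
  have := rbin_sum (- s) k; rewrite big_ord_recl rbin0 => E.
  have : 0 <= rbin (- s + 1) k by apply: rbin_ge0; lra.
  rewrite sumrN -E; suff -> : \sum_(i < k) rbin (- s) (lift ord0 i) =
    \sum_(j < k) rbin (- s) j.+1 by lra.
  by apply: eq_bigr => i _; rewrite lift0.
- move=> n; under eq_fun do rewrite FE.
  by apply: cvgB; [exact: cvg_cst|exact: rbin_poly_cvg].
Qed.

(** Geometric series: $1+A(1-m)=(1+A)(1-\frac{A}{1+A}m)$. *)
Lemma mult_cone_resolvent m (A : R) : 0 <= A -> (forall n, 0 <= m n <= 1) ->
  P m -> P (fun n => (1 + A * (1 - m n))^-1).
Proof.
move=> A0 m01 Pm.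
have A1 : 0 < 1 + A by lra.
have q01 n : 0 <= A * m n / (1 + A) < 1.
  have /andP[m0 m1] := m01 n.
  rewrite divr_ge0 ?mulr_ge0 ?(ltW A1)//= ltr_pdivrMr// mul1r.
  have : A * m n <= A by rewrite ler_piMr.
  by lra.
pose F k n := series (geometric (1 + A)^-1 (A * m n / (1 + A))) k.
have E n : (1 + A * (1 - m n))^-1 = (1 + A)^-1 / (1 - A * m n / (1 + A)).
  have /andP[m0 m1] := m01 n.
  have ? : 1 + A * (1 - m n) != 0.
    by rewrite gt_eqF// ltr_wpDr// mulr_ge0// subr_ge0.
  have ? : 1 + A - A * m n != 0.
    by have -> : 1 + A - A * m n = 1 + A * (1 - m n) by ring.
  by field; rewrite gt_eqF// andbT; apply/andP.
have C n : F k n @[k --> \oo] --> (1 + A * (1 - m n))^-1.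
  rewrite E; apply: cvg_geometric_series.
  by have /andP[q0 q1] := q01 n; rewrite ger0_norm.
have F0 n k j : (k <= j)%N -> F k n <= F j n.
  apply: nondecreasing_series => i _ _ /=.
  have /andP[q0 q1] := q01 n.
  by rewrite mulr_ge0 ?invr_ge0 ?(ltW A1)// exprn_ge0.
apply: (mult_cone_lim HP (F := F) (M := 1)) => //.
- move=> k; apply: mult_cone_sum => j; apply: mult_cone_scale.
    by rewrite invr_ge0 ltW.
  apply: mult_cone_exp; under eq_fun do rewrite mulrAC.
  by apply: mult_cone_scale => //; rewrite divr_ge0// ltW.
- move=> k n; rewrite ger0_norm; last first.
    by have := F0 n 0%N k isT; rewrite /F /series /= big_geq.
  apply: (@le_trans _ _ (1 + A * (1 - m n))^-1).
    have nd : {homo (fun k => F k n) : k j / (k <= j)%N >-> k <= j} by move=> *; exact: F0.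
    have := nondecreasing_cvgn_le nd (cvgP _ (C n)) k.
    by rewrite (cvg_lim _ (C n)).
  have /andP[m0 m1] := m01 n.
  by rewrite invf_le1 ?lerDl ?mulr_ge0 ?subr_ge0// ltr_wpDr// mulr_ge0// subr_ge0.
Qed.

Lemma mult_cone_fractional x s (d : R) : 0 < s < 1 -> (forall n, 0 < x n) ->
  (forall e : R, 0 < e -> P (fun n => (1 + e * x n)^-1)) -> 0 < d ->
  P (fun n => (1 + d * x n `^ s)^-1).
Proof.
move=> s01 x0 Px d0.
(* The Yosida approximation of [x], equal to $(k+1)(1-h)$ for the resolvent $h$. Then
   $d\,y^s=A(1-m)$ with $A=d(k+1)^s$ and $m=1-(1-h)^s$, the form required by
   [mult_cone_resolvent]. *)
pose y (k : nat) n := x n / (1 + k.+1%:R^-1 * x n).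
have e0 (k : nat) : 0 < k.+1%:R^-1 :> R by [].
have p0 k n : 0 < 1 + k.+1%:R^-1 * x n by rewrite ltr_wpDr// mulr_ge0// ltW.
have y0 k n : 0 < y k n by rewrite divr_gt0.
apply: (mult_cone_lim HP (F := fun k n => (1 + d * y k n `^ s)^-1) (M := 1)).
- move=> k; pose h n := (1 + k.+1%:R^-1 * x n)^-1.
  have h01 n : 0 <= h n < 1.
    by rewrite /h invr_ge0 ltW//= invf_lt1// ltrDl mulr_gt0.
  have E n : y k n = (1 - h n) * k.+1%:R.
    rewrite /y /h; field.
    have k1 : 0 < 1 + k%:R :> R by rewrite addrC natr1.
    by rewrite (gt_eqF k1) gt_eqF// addr_gt0.
  have Q : P (fun n => 1 - (1 - h n) `^ s).
    by apply: mult_cone_binomial => //; exact: Px.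
  have -> : (fun n => (1 + d * y k n `^ s)^-1) =
      (fun n => (1 + d * k.+1%:R `^ s * (1 - (1 - (1 - h n) `^ s)))^-1).
    apply/funext => n; congr (_ ^-1); rewrite E powRM//; last first.
      by rewrite subr_ge0 ltW//; case/andP : (h01 n).
    by ring.
  apply: mult_cone_resolvent => //; first by rewrite mulr_ge0 ?powR_ge0// ltW.
  move=> n; rewrite subr_ge0 gerBl powR_ge0 andbT.
  have /andP[h0 h1] := h01 n.
  have {2}<- : (1 : R) `^ s = 1 by rewrite powR1.
  apply: ge0_ler_powR; rewrite ?nnegrE; lra.
- move=> k n; have d1 : 0 <= d * y k n `^ s by rewrite mulr_ge0 ?powR_ge0// ltW.
  by rewrite ger0_norm ?invr_ge0 ?addr_ge0// invf_le1 ?lerDl// ltr_wpDr.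
- move=> n; apply: cvgV.
    by rewrite gt_eqF// ltr_wpDr// mulr_ge0 ?powR_ge0// ltW.
  apply: cvgD; first exact: cvg_cst.
  apply: cvgM; first exact: cvg_cst.
  have yx : y k n @[k --> \oo] --> x n.
    have : y k n @[k --> \oo] --> x n * (1 + 0 * x n)^-1.
      apply: cvgM; first exact: cvg_cst.
      apply: cvgV; first by rewrite mul0r addr0 oner_neq0.
      apply: cvgD; first exact: cvg_cst.
      by apply: cvgM; [exact: cvg_harmonic|exact: cvg_cst].
    by rewrite mul0r addr0 invr1 mulr1.
  have cont : {for x n, continuous (fun y : R => y `^ s)}.
    apply: differentiable_continuous; apply/derivable1_diffP.
    by have [] := is_derive1_powR s (x0 n).
  exact: (continuous_cvg _ cont yx).
Qed.

Lemma mult_cone_scheme a g (y : nat -> R) k : 0 < a < 1 -> a <= g ->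
  P y -> P (fun n => scheme a g (y n) k).
Proof.
move=> a01 ag Py; elim/ltn_ind: k => k IH.
under eq_fun do rewrite schemeE.
apply: mult_cone_mul => //; apply: mult_cone_add => //.
  apply: mult_cone_sum => j; apply: mult_cone_scale.
    by rewrite oppr_ge0 rbinN_le0.
  by apply: IH; rewrite ltn_subrL (leq_ltn_trans _ (ltn_ord j)).
by apply: mult_cone_cst => //; apply: rbin_ge0; rewrite subr_ge0.
Qed.

Lemma mult_cone_mittag_leffler a g x : 0 < a < 1 -> a <= g ->
  (forall n, 0 <= x n) ->
  (forall e : R, 0 < e -> P (fun n => (1 + e * x n)^-1)) ->
  P (fun n => mittag_leffler a g (- x n)).
Proof.
move=> /[dup] a01 /andP[a0 a1] ag x0 Px.
have g0 : 0 < g by exact: lt_le_trans ag.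
(* The [a]-th power of the time step $1/(N+1)$: step [N] is then close to time 1. In [F] the factor
   $(N+1)^{1-g}$ compensates the growth of [rbin g N]. *)
pose d (N : nat) : R := N.+1%:R `^ (- a).
have d0 N : 0 < d N by rewrite powR_gt0.
pose F N n := N.+1%:R `^ (1 - g) * scheme a g (1 + d N * x n)^-1 N.
have [M HM] : exists M, forall N, norm_rbin g N <= M.
  have := cvg_seq_bounded (cvgP _ (norm_rbin_cvg g0)).
  move=> [M [_ HM]]; exists (M + 1) => N.
  by apply: (le_trans (ler_norm _)); apply: HM => //; rewrite ltrDl.
apply: (mult_cone_lim HP (F := F) (M := M)).
- move=> N; apply: mult_cone_scale; first exact: powR_ge0.
  by apply: mult_cone_scheme => //; exact: Px.
- move=> N n; apply: le_trans (HM N).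
  have p : 0 < 1 + d N * x n by rewrite ltr_wpDr// mulr_ge0// ltW.
  have y01 : 0 <= (1 + d N * x n)^-1 <= 1.
    by rewrite invr_ge0 ltW//= invf_le1// lerDl mulr_ge0// ltW.
  have /andP[s0 s1] := scheme_bounds N a01 ag y01.
  by rewrite ger0_norm ?mulr_ge0 ?powR_ge0// ler_wpM2l// powR_ge0.
move=> n; apply: cvg_trans (mittag_leffler_cvg a0 g0 (x0 n)).
apply: near_eq_cvg.
have dcvg : d N @[N --> \oo] --> (0 : R).
  have inv0 : N.+1%:R^-1 @[N --> \oo] --> (0 : R) by exact: cvg_harmonic.
  have -> : d = fun N => N.+1%:R^-1 `^ a.
    by apply/funext => N; rewrite /d -powR_inv1 ?ler0n// -powRrM mulN1r.
  have /cvg_at_rightP/(_ (fun N => N.+1%:R^-1)) := powR_cvg0 a0.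
  by apply; split => [N|//]; rewrite invr_gt0.
(* Here the eigenvalue is fixed, so the smallness condition of [scheme_series] holds for all large
   [N]. *)
have : d N * (x n * expR a) @[N --> \oo] --> (0 * (x n * expR a) : R).
  by apply: cvgM => //; exact: cvg_cst.
rewrite mul0r => /cvgrPdist_lt/(_ 1 ltr01); apply: filterS => N.
rewrite sub0r normrN => /(le_lt_trans (ler_norm _)); rewrite mulrA => H.
have z0 : 0 <= d N * x n by rewrite mulr_ge0// ltW.
apply/cvg_lim => //.
have -> : series (fun k => (- x n) ^+ k * norm_rbin (g + a * k%:R) N) =
    fun K => N.+1%:R `^ (1 - g) *
      series (fun k => (- (d N * x n)) ^+ k * rbin (g + a * k%:R) N) K.
  apply/funext => K; rewrite /series /= mulr_sumr; apply: eq_bigr => k _.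
  have q : 0 < N.+1%:R :> R by [].
  rewrite /norm_rbin.
  have -> : 1 - (g + a * k%:R) = 1 - g + - a * k%:R by ring.
  rewrite powRD; last by rewrite (gt_eqF q) implybT.
  by rewrite powRrM powR_mulrn ?powR_ge0// -/(d N) -mulrN exprMn; ring.
by apply: cvgM; [exact: cvg_cst|exact: scheme_series].
Qed.

End closure.
End mult_cone.

(** * Lebesgue measure on row vectors *)

Section rV_borel.
Context (R : realType).

Lemma measurable_box d (P : 'I_d -> set (measurableTypeR R)) :
  (forall i, measurable (P i)) ->
  measurable [set x : 'rV[R]_d | forall i, P i (x ord0 i)].
Proof.
move=> mP.
rewrite (_ : mkset _ = \bigcap_(i in [set: 'I_d]) (@Defs.coord R d i @^-1` P i)); last first.
  by apply/seteqP; split => x /= H i; [move=> _; exact: (H i)|exact: (H i I)].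
apply: fin_bigcap_measurable; first exact: finite_finset.
move=> i _; rewrite -[X in measurable X]setTI.
exact: (measurable_coord i measurableT (mP i)).
Qed.

Lemma open_measurable_rV d (U : set 'rV[R]_d) : open U -> measurable U.
Proof.
move=> oU.
pose box (qn : 'rV[rat]_d * nat) : set 'rV[R]_d :=
  [set y | forall i, `](ratr (qn.1 ord0 i) - qn.2.+1%:R^-1), (ratr (qn.1 ord0 i)
    + qn.2.+1%:R^-1)[%classic (y ord0 i)].
pose F qn := if `[< box qn `<=` U >] then box qn else set0.
have -> : U = \bigcup_qn F qn.
  apply/seteqP; split => [x Ux|x [qn _]]; last first.
    by rewrite /F; case: asboolP => // H; exact: H.
  have /nbhs_ballP[e /= e0 HU] := open_nbhs_nbhs (conj oU Ux).
  pose n := Num.truncn (2 / e).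
  (* The rational centre is within [n.+1%:R^-1] of [x] and the box has the same radius, so the box
     stays in the ball of radius [e]. *)
  have ne : n.+1%:R^-1 < e / 2.
    rewrite -[ltRHS]invrK ltf_pV2 ?posrE ?invr_gt0 ?divr_gt0//.
    by rewrite invf_div truncnS_gt.
  have n0 : 0 < n.+1%:R^-1 :> R by rewrite invr_gt0.
  have /choice[q Hq] : forall i, exists q : rat, ratr q \in `](x ord0 i - n.+1%:R^-1), (x ord0 i + n.+1%:R^-1)[.
    move=> i; apply: rat_in_itvoo; by move: n0; move: (n.+1%:R^-1 : R) => r; lra.
  exists (\row_i q i, n) => //.
  have sub : box (\row_i q i, n) `<=` U.
    move=> y Hy; apply: HU; split => // j i; rewrite (ord1 j).
    have := Hy i; rewrite /= !mxE in_itv/= => /andP[h1 h2].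
    have := Hq i; rewrite in_itv/= => /andP[h3 h4].
    rewrite /ball/= ltr_norml; move: h1 h2 h3 h4 ne; move: (n.+1%:R^-1 : R) => r.
    by move=> *; apply/andP; split; lra.
  rewrite /F asboolT// => i /=; rewrite mxE in_itv/=.
  have := Hq i; rewrite in_itv/= => /andP[h3 h4].
  move: h3 h4; move: (n.+1%:R^-1 : R) => r h3 h4.
  by apply/andP; split; lra.
apply: countable_bigcupT_measurable; first exact: countableP.
move=> qn; rewrite /F; case: asboolP => // _.
apply: (@measurable_box d (fun i => `](ratr (qn.1 ord0 i) - qn.2.+1%:R^-1),
  (ratr (qn.1 ord0 i) + qn.2.+1%:R^-1)[%classic)) => i.
exact: measurable_itv.
Qed.

Lemma continuous_measurable_rV d (f : 'rV[R]_d -> R) :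
  continuous f -> measurable_fun [set: 'rV[R]_d] (f : _ -> measurableTypeR R).
Proof.
move=> /continuousP cf; apply: (measurability _ (RGenOpens.measurableE R)).
move=> _ [_ [a [b ->] <-]]; rewrite setTI; apply: open_measurable_rV.
exact/cf/interval_open.
Qed.

Definition cube d (M : R) : set 'rV[R]_d :=
  [set x | forall i, `[- M, M]%classic (x ord0 i)].

Arguments cube : clear implicits.

Lemma measurable_cube d (M : R) : measurable (cube d M).
Proof.
by apply: (@measurable_box d (fun=> `[- M, M]%classic)) => i; exact: measurable_itv.
Qed.

Lemma leb_cube_fin d (M : R) : (leb R d (cube d M) < +oo)%E.
Proof.
elim: d => [|d IH].
  by apply: (@le_lt_trans _ _ 1%E); rewrite ?ltry//= diracE; case: (_ \in _);
    rewrite // lee_fin.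
rewrite /= /leb_step /pushforward.
rewrite (_ : _ @^-1` _ = cube d M `*` `[- M, M]%classic); last first.
  apply/seteqP; split => [[x y]|[x y] [/= Hx Hy]] /=.
    move=> H; split => [i|].
      by have := H (lift ord0 i); rewrite /consrV mxE liftK.
    by have := H ord0; rewrite /consrV mxE unlift_none.
  move=> i; rewrite /consrV mxE; case: (unliftP ord0 i) => [j|] _ //=.
  exact: Hx.
rewrite product_measure1E.
- rewrite lte_mul_pinfty ?measure_ge0//.
    by rewrite ge0_fin_numE.
  have : (lebesgue_measure (`[(- M)%R, M%R]%classic : set R) < +oo)%E.
    by rewrite lebesgue_measure_itv/=; case: ifP => // _; rewrite -EFinD ltry.
  exact.
- exact: measurable_cube.
- exact: measurable_itv.
Qed.

Lemma leb_bounded_fin d (A : set 'rV[R]_d) : measurable A -> bounded_set A ->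
  (leb R d A < +oo)%E.
Proof.
move=> mA [M [Mr HM]].
have {}HM : forall x, A x -> `|x| <= M + 1 by apply: HM; rewrite ltrDl.
apply: (le_lt_trans _ (leb_cube_fin d (M + 2))).
apply: le_measure; rewrite ?inE//.
  exact: measurable_cube.
move=> x /HM xM i /=.
have : ball (0 : 'rV[R]_d) (M + 2) x.
  by rewrite -ball_normE/= sub0r normrN; apply: (le_lt_trans xM); lra.
move=> [_ /(_ ord0 i)]; rewrite /ball/= mxE sub0r normrN in_itv/= => /ltW.
by rewrite ler_norml.
Qed.

End rV_borel.

(** * Square integrable functions on a domain *)

Section Lfun2.
Context d (T : measurableType d) (R : realType) (mu : {measure set T -> \bar R}).
Implicit Types (f g : T -> R).

Lemma Lfun2_measurable f : f \in Lfun mu 2%:E -> measurable_fun setT f.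
Proof. by rewrite inE => /andP[+ _]; rewrite inE. Qed.

Lemma Lnorm2E f : ('N[mu]_2%:E[EFin \o f] = (\int[mu]_x (f x ^+ 2)%:E) `^ 2^-1)%E.
Proof.
rewrite unlock; congr (_ `^ _)%E; apply: eq_integral => x _ /=.
by rewrite powR_mulrn// real_normK// num_real.
Qed.

Lemma Lfun2P f : f \in Lfun mu 2%:E <->
  measurable_fun setT f /\ mu.-integrable setT (EFin \o (fun x => f x ^+ 2)).
Proof.
split=> [f2|[mf /integrableP[_ fi]]].
  by split; [exact: Lfun2_measurable|exact: Lfun2_integrable_sqr].
rewrite inE; apply/andP; split; rewrite inE//= /finite_norm Lnorm2E poweR_lty//.
under eq_integral => x _ do rewrite -(ger0_norm (sqr_ge0 (f x))).
exact: fi.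
Qed.

Lemma Lfun2_le f g : measurable_fun setT f -> g \in Lfun mu 2%:E ->
  (forall x, `|f x| <= `|g x|) -> f \in Lfun mu 2%:E.
Proof.
move=> mf /Lfun2P[mg ig] fg; apply/Lfun2P; split => //.
apply: le_integrable ig => //.
  by apply/measurable_EFinP; exact: measurable_funX.
by move=> x _ /=; rewrite lee_fin !normrX; apply: lerXn2r.
Qed.

Lemma Lfun2_mul_integrable f g : f \in Lfun mu 2%:E -> g \in Lfun mu 2%:E ->
  mu.-integrable setT (EFin \o (f \* g)%R).
Proof. by move=> f2 g2; apply/Lfun1_integrable; exact: Lfun2_mul_Lfun1. Qed.

Lemma Lfun2D f g : f \in Lfun mu 2%:E -> g \in Lfun mu 2%:E ->
  (fun x => f x + g x) \in Lfun mu 2%:E.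
Proof.
move=> /[dup] f2 /Lfun2P[mf fi] /[dup] g2 /Lfun2P[mg gi].
apply/Lfun2P; split; first exact: measurable_funD.
rewrite (_ : _ \o _ = (EFin \o (fun x => f x ^+ 2)%R) \+
   ((fun x => 2%:E * (EFin \o (f \* g)%R) x) \+ (EFin \o (fun x => g x ^+ 2)%R)))%E.
  apply: integrableD => //; apply: integrableD => //; apply: integrableZl => //.
  exact: Lfun2_mul_integrable.
by apply/funext => x /=; rewrite -EFinM -!EFinD; congr EFin; ring.
Qed.

Lemma Lfun2Z (c : R) f : f \in Lfun mu 2%:E -> (fun x => c * f x) \in Lfun mu 2%:E.
Proof.
move=> /Lfun2P[mf fi]; apply/Lfun2P; split; first exact: measurable_funM.
rewrite (_ : _ \o _ = (fun x => (c ^+ 2)%:E * (EFin \o (fun x => f x ^+ 2)%R) x))%E.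
  exact: integrableZl.
by apply/funext => x /=; rewrite -EFinM exprMn.
Qed.

End Lfun2.

(** * The space of square integrable functions on the domain *)

Section L2_domain.
Context (R : realType) (d : nat) (Omega : set 'rV[R]_d).
Implicit Types (w v f g : 'rV[R]_d -> R).
Let mu := leb R d.
Local Notation L2 := (L2 Omega).
Local Notation ip := (ip Omega).
Local Notation cvgL2 := (cvgL2 Omega).

Lemma patchM w v : (w \* v) \_ Omega = (w \_ Omega) \* (v \_ Omega).
Proof. by apply/funext => x; rewrite /= !patchE /=; case: ifP; rewrite ?mulr0. Qed.

Lemma patchD w v : (fun x => w x + v x) \_ Omega = (fun x => (w \_ Omega) x + (v \_ Omega) x).
Proof. by apply/funext => x; rewrite /= !patchE /=; case: ifP; rewrite ?addr0. Qed.

Lemma patchZ c w : (fun x => c * w x) \_ Omega = (fun x => c * (w \_ Omega) x).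
Proof. by apply/funext => x; rewrite /= !patchE /=; case: ifP; rewrite ?mulr0. Qed.

Lemma ipE w v : ip w v = \int[mu]_x ((w \_ Omega) x * (v \_ Omega) x).
Proof.
rewrite /Defs.ip Rintegral_mkcond; congr (Rintegral _ _ _).
by rewrite -[X in X \_ _]/(w \* v) patchM.
Qed.

Lemma L2D w v : L2 w -> L2 v -> L2 (fun x => w x + v x).
Proof. by rewrite /Defs.L2 patchD; exact: Lfun2D. Qed.

Lemma L2Z c w : L2 w -> L2 (fun x => c * w x).
Proof. by rewrite /Defs.L2 patchZ; exact: Lfun2Z. Qed.

Lemma L2B w v : L2 w -> L2 v -> L2 (fun x => w x - v x).
Proof.
move=> hw hv; under [X in L2 X]eq_fun do rewrite -mulN1r.
by apply: L2D => //; exact: L2Z.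
Qed.

Lemma L2_0 : L2 (fun=> 0).
Proof.
rewrite /Defs.L2 (_ : _ \_ _ = cst 0); last first.
  by apply/funext => x; rewrite patchE; case: ifP.
apply/Lfun2P; split; first exact: measurable_cst.
rewrite (_ : _ \o _ = cst 0%E); first exact: integrable0.
by apply/funext => x /=; rewrite expr0n.
Qed.

Lemma L2_sum (I : Type) (r : seq I) (F : I -> 'rV[R]_d -> R) :
  (forall i, L2 (F i)) -> L2 (fun x => \sum_(i <- r) F i x).
Proof.
move=> LF; elim: r => [|i r IH].
  by under [X in L2 X]eq_fun do rewrite big_nil; exact: L2_0.
by under [X in L2 X]eq_fun do rewrite big_cons; exact: L2D.
Qed.

Lemma ip_integrable w v : L2 w -> L2 v ->
  mu.-integrable setT (EFin \o (fun x => (w \_ Omega) x * (v \_ Omega) x)).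
Proof. exact: Lfun2_mul_integrable. Qed.

Lemma ipC w v : ip w v = ip v w.
Proof. by rewrite !ipE; apply: eq_Rintegral => x _; rewrite mulrC. Qed.

Lemma ipDl w1 w2 v : L2 w1 -> L2 w2 -> L2 v ->
  ip (fun x => w1 x + w2 x) v = ip w1 v + ip w2 v.
Proof.
move=> h1 h2 hv; rewrite !ipE patchD -RintegralD//; [|exact: ip_integrable..].
by apply: eq_Rintegral => x _; rewrite mulrDl.
Qed.

Lemma ipZl c w v : L2 w -> L2 v -> ip (fun x => c * w x) v = c * ip w v.
Proof.
move=> hw hv; rewrite !ipE patchZ -RintegralZl//; last exact: ip_integrable.
by apply: eq_Rintegral => x _; rewrite mulrA.
Qed.

Lemma ip0l v : ip (fun=> 0) v = 0.
Proof.
rewrite /Defs.ip (_ : (fun _ => _) = cst 0); first by rewrite /Rintegral integral0.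
by apply/funext => x; rewrite mul0r.
Qed.

Lemma ip_suml (I : Type) (r : seq I) (F : I -> 'rV[R]_d -> R) v :
  (forall i, L2 (F i)) -> L2 v ->
  ip (fun x => \sum_(i <- r) F i x) v = \sum_(i <- r) ip (F i) v.
Proof.
move=> LF Lv; elim: r => [|i r IH].
  by rewrite big_nil -[RHS](ip0l v); congr ip; apply/funext => x; rewrite big_nil.
rewrite big_cons -IH -ipDl//; last exact: L2_sum.
by congr ip; apply/funext => x; rewrite big_cons.
Qed.

Lemma ipBl w1 w2 v : L2 w1 -> L2 w2 -> L2 v ->
  ip (fun x => w1 x - w2 x) v = ip w1 v - ip w2 v.
Proof.
move=> h1 h2 hv; rewrite -mulN1r -ipZl// -ipDl//; last exact: L2Z.
by congr ip; apply/funext => x; rewrite mulN1r.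
Qed.

Lemma ipDr w1 w2 v : L2 w1 -> L2 w2 -> L2 v ->
  ip v (fun x => w1 x + w2 x) = ip v w1 + ip v w2.
Proof. by move=> *; rewrite ipC ipDl// ![ip v _]ipC. Qed.

Lemma ipZr c w v : L2 w -> L2 v -> ip v (fun x => c * w x) = c * ip v w.
Proof. by move=> *; rewrite ipC ipZl// [ip v _]ipC. Qed.

Lemma ipBr w1 w2 v : L2 w1 -> L2 w2 -> L2 v ->
  ip v (fun x => w1 x - w2 x) = ip v w1 - ip v w2.
Proof. by move=> *; rewrite ipC ipBl// ![ip v _]ipC. Qed.

Lemma ip_sumr (I : Type) (r : seq I) (F : I -> 'rV[R]_d -> R) v :
  (forall i, L2 (F i)) -> L2 v ->
  ip v (fun x => \sum_(i <- r) F i x) = \sum_(i <- r) ip v (F i).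
Proof.
by move=> *; rewrite ipC ip_suml//; apply: eq_bigr => i _; rewrite ipC.
Qed.

Lemma ip_sqr_ge0 w : 0 <= ip w w.
Proof. by rewrite ipE; apply: Rintegral_ge0 => x _; rewrite -expr2 sqr_ge0. Qed.

Lemma ip_sqrB w v : L2 w -> L2 v ->
  ip (fun x => w x - v x) (fun x => w x - v x) = ip w w - 2 * ip w v + ip v v.
Proof.
move=> hw hv; have hB := L2B hw hv.
by rewrite ipBl// !ipBr// (ipC v w); ring.
Qed.

Lemma ip_CS w v : L2 w -> L2 v -> ip w v ^+ 2 <= ip w w * ip v v.
Proof.
move=> hw hv.
have H t : 0 <= ip w w - 2 * (t * ip w v) + t ^+ 2 * ip v v.
  have := ip_sqr_ge0 (fun x => w x - t * v x).
  have htv := L2Z t hv.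
  by rewrite ip_sqrB// ipZr// ipZl// ipZr//; lra.
have [v0|v0] := eqVneq (ip v v) 0.
  rewrite v0 mulr0; have [->|n0] := eqVneq (ip w v) 0; first by rewrite expr0n.
  (* When [v] has norm 0 the quadratic in [t] is affine; at this [t] it equals -1. *)
  have := H ((ip w w + 1) / (2 * ip w v)); rewrite v0 mulr0 addr0.
  have -> : 2 * ((ip w w + 1) / (2 * ip w v) * ip w v) = ip w w + 1 by field.
  by lra.
have vp : 0 < ip v v by rewrite lt_neqAle eq_sym v0 ip_sqr_ge0.
have := H (ip w v / ip v v).
have -> : ip w w - 2 * (ip w v / ip v v * ip w v) + (ip w v / ip v v) ^+ 2 * ip v v =
  ip w w - ip w v ^+ 2 / ip v v by field.
by rewrite subr_ge0 ler_pdivrMr.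
Qed.

Lemma L2normE w : L2 w -> L2norm Omega w = ((ip w w) `^ 2^-1)%:E.
Proof.
move=> hw; rewrite /L2norm Lnorm2E ipE -poweR_EFin; congr (_ `^ _)%E.
rewrite /Rintegral fineK//.
exact/integrable_fin_num/ip_integrable.
Qed.

Lemma cvgL2P (w_ : nat -> 'rV[R]_d -> R) w : (forall n, L2 (w_ n)) -> L2 w ->
  cvgL2 w_ w -> 
  ip (fun x => w_ n x - w x) (fun x => w_ n x - w x) @[n --> \oo] --> (0 : R).
Proof.
move=> hw_ hw; rewrite /Defs.cvgL2.
have hB n : L2 (fun x => w_ n x - w x) by exact: L2B.
have -> : (fun n => L2norm Omega (fun x => w_ n x - w x)) =
    (fun n => ((ip (fun x => w_ n x - w x) (fun x => w_ n x - w x)) `^ 2^-1)%:E).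
  by apply/funext => n; rewrite L2normE.
move=> /fine_cvg /= C.
have {C} := cvgM C C; rewrite mulr0.
rewrite (_ : _ \* _ = fun n => ip (fun x => w_ n x - w x) (fun x => w_ n x - w x))//.
  by apply.
apply/funext => n /=.
by rewrite powR12_sqrt ?ip_sqr_ge0// -expr2 sqr_sqrtr ?ip_sqr_ge0.
Qed.

Lemma ip_ge0 w v : {ae mu, forall x, Omega x -> 0 <= w x} ->
  {ae mu, forall x, Omega x -> 0 <= v x} -> L2 w -> L2 v -> 0 <= ip w v.
Proof.
move=> w0 v0 hw hv; rewrite ipE.
have -> : \int[mu]_x ((w \_ Omega) x * (v \_ Omega) x) =
   \int[mu]_x `|(w \_ Omega) x * (v \_ Omega) x|.
  rewrite /Rintegral; congr fine; apply: ae_eq_integral => //.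
  - by have /integrableP[] := ip_integrable hw hv.
  - have /integrableP[+ _] := ip_integrable hw hv.
    by move=> /measurable_EFinP m; apply/measurable_EFinP; exact: measurableT_comp.
  apply: filterS2 w0 v0 => x w0 v0 _ /=; congr EFin.
  rewrite ger0_norm// !patchE; case: ifPn => [|_]; last by rewrite mulr0.
  by rewrite inE => xO; rewrite mulr_ge0 ?w0 ?v0.
by apply: Rintegral_ge0.
Qed.

Lemma ip_ae_eql w w' v : ae_eqO Omega w w' -> L2 w -> L2 w' -> L2 v -> ip w v = ip w' v.
Proof.
move=> ww hw hw' hv; rewrite !ipE /Rintegral; congr fine; apply: ae_eq_integral => //.
- by have /integrableP[] := ip_integrable hw hv.
- by have /integrableP[] := ip_integrable hw' hv.
apply: filterS ww => x ww _ /=; congr EFin.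
by rewrite !patchE; case: ifPn => // /[!inE] xO; rewrite ww.
Qed.

Lemma ip_sqr_eq0 w : L2 w -> ip w w = 0 -> {ae mu, forall x, Omega x -> w x = 0}.
Proof.
move=> hw; rewrite ipE => H.
have mw := Lfun2_measurable hw.
have : (\int[mu]_x `|((w \_ Omega) x * (w \_ Omega) x)%:E| = 0)%E.
  under eq_integral => x _ do rewrite gee0_abs ?lee_fin -?expr2 ?sqr_ge0//.
  rewrite -[LHS]fineK; last first.
    under eq_integral => x _ do rewrite expr2.
    exact/integrable_fin_num/ip_integrable.
  by rewrite -[RHS]/((0 : R)%:E) -[X in _ = X%:E]H; congr EFin; apply: eq_Rintegral
    => x _; rewrite expr2.
move/ae_eq_integral_abs => /= A.
have {}A : ae_eq mu setT (fun x => ((w \_ Omega) x * (w \_ Omega) x)%:E) (cst 0%E).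
  by apply: A => //; apply/measurable_EFinP; exact: measurable_funM.
apply: filterS A => x /(_ I) /= [/eqP]; rewrite mulf_eq0 orbb => /eqP + Ox.
by rewrite patchE mem_set.
Qed.

Lemma L2_le w v : measurable_fun setT (w \_ Omega) -> L2 v ->
  (forall x, Omega x -> `|w x| <= `|v x|) -> L2 w.
Proof.
move=> mw hv wv; apply: Lfun2_le mw hv _ => x; rewrite !patchE; case: ifP => //.
by rewrite inE => /wv.
Qed.

Lemma L2_measurable w : L2 w -> measurable_fun setT (w \_ Omega).
Proof. exact: Lfun2_measurable. Qed.

Hypotheses (mO : measurable Omega) (fO : (mu Omega < +oo)%E).

Lemma L2_indic (A : set 'rV[R]_d) : measurable A -> A `<=` Omega -> L2 (\1_A : 'rV[R]_d -> R).
Proof.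
move=> mA AO; apply/Lfun2P; rewrite (_ : _ \_ _ = (\1_A : 'rV[R]_d -> R)); last first.
  apply/funext => x; rewrite patchE indicE; case: ifPn => //; rewrite notin_setE => xO.
  by rewrite memNset// => /AO.
split; first exact: measurable_indic.
rewrite (_ : _ \o _ = EFin \o (\1_A : 'rV[R]_d -> R)); last first.
  by apply/funext => x /=; rewrite indicE; case: (_ \in _); rewrite ?expr1n// expr0n.
apply/integrableP; split; first by apply/measurable_EFinP; exact: measurable_indic.
under eq_integral => x _ do rewrite gee0_abs ?lee_fin//.
rewrite integral_indic// setIT; apply: le_lt_trans fO.
by apply: le_measure; rewrite ?inE.
Qed.

Lemma L2_bounded w M : measurable_fun setT w -> (forall x, Omega x -> `|w x| <= M) -> L2 w.
Proof.
move=> mw wM; apply: (@L2_le _ (fun x => `|M| * \1_Omega x)).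
- by apply/(measurable_restrictT _ mO)/measurable_funTS.
- by apply: L2Z; exact: L2_indic.
- move=> x xO; rewrite indicE mem_set// mulr1 normr_id.
  by apply: le_trans (wM x xO) (ler_norm _).
Qed.

End L2_domain.

(** * Test functions *)

Section smooth.
Context (R : realType) (d : nat).
Implicit Types (f g phi : 'rV[R]_d -> R) (l : seq 'I_d) (p : {poly R}).

(** Finite order makes the product rule inductive: a derivative of a product is a sum of products,
    whose regularity is known one order lower. *)
Definition smooth_upto n f := forall l, (size l <= n)%N ->
  continuous (iter_partial l f) /\
  forall (i : 'I_d) x, derivable (iter_partial l f) x (basis_vec R i).

Lemma smooth_uptoP f : smooth f <-> forall n, smooth_upto n f.
Proof. by split => [sf n l _|sf l]; [exact: sf|exact: (sf (size l))]. Qed.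

Lemma iter_partial_rcons l i f :
  iter_partial (rcons l i) f = iter_partial l (partial i f).
Proof. by rewrite /iter_partial foldr_rcons. Qed.

Lemma smooth_partial i f : smooth f -> smooth (partial i f).
Proof. by move=> sf l; rewrite -iter_partial_rcons; exact: sf. Qed.

Lemma smooth_derivable f i x : smooth f -> derivable f x (basis_vec R i).
Proof. by move=> /(_ [::])[_]; apply. Qed.

Lemma smooth_continuous f : smooth f -> continuous f.
Proof. by move=> /(_ [::])[]. Qed.

Lemma partialD i f g : (forall x, derivable f x (basis_vec R i)) ->
  (forall x, derivable g x (basis_vec R i)) ->
  partial i (f \+ g) = partial i f \+ partial i g.
Proof.
by move=> df dg; apply/funext => x; rewrite /partial deriveD.
Qed.

Lemma partialM i f g : (forall x, derivable f x (basis_vec R i)) ->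
  (forall x, derivable g x (basis_vec R i)) ->
  partial i (f \* g) = (f \* partial i g) \+ (g \* partial i f).
Proof.
by move=> df dg; apply/funext => x; rewrite /partial deriveM.
Qed.

Lemma iter_partialD l f g n : (size l <= n.+1)%N -> smooth_upto n f -> smooth_upto n g ->
  iter_partial l (f \+ g) = iter_partial l f \+ iter_partial l g.
Proof.
elim: l => // i l IH /= ln sf sg.
by rewrite IH ?partialD//; [exact: (sf l ln).2|exact: (sg l ln).2|exact: leqW].
Qed.

Lemma smooth_uptoD n f g : smooth_upto n f -> smooth_upto n g -> smooth_upto n (f \+ g).
Proof.
move=> sf sg l ln; rewrite (@iter_partialD l f g n)//; last exact: leqW.
have [cf df] := sf l ln; have [cg dg] := sg l ln; split.
  by move=> x; exact: (cvgD (cf x) (cg x)).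
by move=> i x; apply: derivableD; [exact: df|exact: dg].
Qed.

Lemma smooth_uptoM n f g : smooth f -> smooth g -> smooth_upto n (f \* g).
Proof.
elim: n f g => [|n IH] f g sf sg; last first.
  (* The last index of the list is the first derivative taken, the one to which the product rule
     applies. *)
  move=> l; elim/last_ind: l => [_|l i _]; first exact: (IH f g sf sg [::]).
  rewrite size_rcons ltnS => ln; rewrite iter_partial_rcons partialM; last 2 first.
  - by move=> x; exact: smooth_derivable.
  - by move=> x; exact: smooth_derivable.
  exact: (smooth_uptoD (IH _ _ sf (smooth_partial i sg)) (IH _ _ sg (smooth_partial i sf)) ln).
move=> l; rewrite leqn0 => /nilP ->; split => [x|i x].
  exact: (cvgM (smooth_continuous sf (x := x)) (smooth_continuous sg (x := x))).
by apply: derivableM; exact: smooth_derivable.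
Qed.

Lemma smoothD f g : smooth f -> smooth g -> smooth (f \+ g).
Proof.
by move=> /smooth_uptoP sf /smooth_uptoP sg; apply/smooth_uptoP => n; exact: smooth_uptoD.
Qed.

Lemma smoothM f g : smooth f -> smooth g -> smooth (f \* g).
Proof. by move=> sf sg; apply/smooth_uptoP => n; exact: smooth_uptoM. Qed.

Lemma partial_cst i (c : R) : partial i (cst c : 'rV[R]_d -> R) = cst 0.
Proof. by apply/funext => x; rewrite /partial derive_cst. Qed.

Lemma smooth_cst (c : R) : smooth (cst c : 'rV[R]_d -> R).
Proof.
move=> l; suff [c' ->] : exists c', iter_partial l (cst c : 'rV[R]_d -> R) = cst c'.
  by split => [x|i x]; [exact: cst_continuous|exact: derivable_cst].
elim: l => [|i l [c' E]] /=; first by exists c.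
by exists 0; rewrite E partial_cst.
Qed.

Lemma horner_comp_rec p (c : R) f : (fun x => (p * 'X + c%:P).[f x]) =
  (fun x => p.[f x]) \* f \+ cst c.
Proof. by apply/funext => x; rewrite !hornerE. Qed.

Lemma smooth_horner p f : smooth f -> smooth (fun x => p.[f x]).
Proof.
move=> sf; elim/poly_ind: p => [|p c IH].
  by rewrite (_ : (fun _ => _) = cst 0); [exact: smooth_cst|apply/funext => x; rewrite horner0].
by rewrite horner_comp_rec; apply: smoothD; [exact: smoothM|exact: smooth_cst].
Qed.

Lemma partial_horner p f i x : smooth f ->
  partial i (fun x => p.[f x]) x = p^`().[f x] * partial i f x.
Proof.
move=> sf; elim/poly_ind: p => [|p c IH].
  rewrite (_ : (fun _ => _) = cst 0); first by rewrite partial_cst deriv0 horner0 mul0r.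
  by apply/funext => y; rewrite horner0.
have dp y : derivable (fun x => p.[f x]) y (basis_vec R i).
  exact/smooth_derivable/smooth_horner.
have df y : derivable f y (basis_vec R i) by exact: smooth_derivable.
rewrite horner_comp_rec partialD; last 2 first.
- by move=> y; exact: derivableM.
- by move=> y; exact: derivable_cst.
rewrite partialM// partial_cst /= IH derivD derivM derivX derivC mulr1 !addr0.
by rewrite hornerD hornerM hornerX; ring.
Qed.

Variable Omega : set 'rV[R]_d.

Lemma test_fun_horner p f : p.[0] = 0 -> test_fun Omega f ->
  test_fun Omega (fun x => p.[f x]).
Proof.
move=> p0 [sf [K [cK KO fK]]]; split; first exact: smooth_horner.
by exists K; split => // x /fK ->.
Qed.

Lemma test_funD f g : test_fun Omega f -> test_fun Omega g ->
  test_fun Omega (fun x => f x + g x).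
Proof.
move=> [sf [K [cK KO fK]]] [sg [L [cL LO gL]]]; split; first exact: smoothD.
exists (K `|` L); split; first exact: compactU.
  by move=> x [/KO|/LO].
by move=> x /not_orP[/fK -> /gL ->]; rewrite addr0.
Qed.

Lemma test_funZ c f : test_fun Omega f -> test_fun Omega (fun x => c * f x).
Proof.
move=> tf; have -> : (fun x => c * f x) = (fun x => (c *: 'X).[f x]).
  by apply/funext => x; rewrite hornerZ hornerX.
by apply: test_fun_horner => //; rewrite hornerZ hornerX mulr0.
Qed.

Lemma test_fun0 : test_fun Omega (fun=> 0).
Proof.
split; first exact: smooth_cst.
by exists set0; split => //; exact: compact0.
Qed.

Lemma test_fun_sum (I : Type) (r : seq I) (F : I -> 'rV[R]_d -> R) :
  (forall i, test_fun Omega (F i)) -> test_fun Omega (fun x => \sum_(i <- r) F i x).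
Proof.
move=> tF; elim: r => [|i r IH].
  by under eq_fun do rewrite big_nil; exact: test_fun0.
by under eq_fun do rewrite big_cons; exact: test_funD.
Qed.

Lemma partial_lin (r : seq nat) (a : nat -> R) (F : nat -> 'rV[R]_d -> R) i x :
  (forall n, smooth (F n)) ->
  partial i (fun x => \sum_(n <- r) a n * F n x) x = \sum_(n <- r) a n * partial i (F n) x.
Proof.
move=> sF.
have saF n : smooth (fun x => a n * F n x) by apply: smoothM => //; exact: smooth_cst.
elim: r x => [|n r IH] x.
  by under eq_fun do rewrite big_nil; rewrite big_nil partial_cst.
under eq_fun do rewrite big_cons; rewrite big_cons.
have ss : smooth (fun x => \sum_(n <- r) a n * F n x).
  elim: r {IH} => [|m r IH].
    by under eq_fun do rewrite big_nil; exact: smooth_cst.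
  by under eq_fun do rewrite big_cons; exact: smoothD.
rewrite -[X in partial i X]/((fun x => a n * F n x) \+ (fun x => \sum_(n <- r) a n * F n x)).
rewrite partialD; last 2 first.
- by move=> y; exact: smooth_derivable (saF n).
- by move=> y; exact: smooth_derivable ss.
rewrite /= IH; congr (_ + _).
rewrite -[X in partial i X]/(cst (a n) \* F n) partialM; last 2 first.
- by move=> y; exact: derivable_cst.
- by move=> y; exact: smooth_derivable.
by rewrite /= partial_cst /= mulr0 addr0.
Qed.

End smooth.

Lemma continuous_bounded_rV (R : realType) (d : nat) (Omega : set 'rV[R]_d)
    (f : 'rV[R]_d -> R) : bounded_set Omega -> continuous f ->
  exists2 M : R, 0 < M & forall x, Omega x -> `|f x| <= M.
Proof.
move=> bO cf.
have [M [Mr HM]] := bO.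
have {}HM : forall x, Omega x -> `|x| <= M + 1 by apply: HM; rewrite ltrDl.
have cB : compact (closed_ball (0 : 'rV[R]_d) (`|M| + 2)).
  apply: bounded_closed_compact; last exact: closed_ball_closed.
  exists (`|M| + 2); split; first exact: num_real.
  move=> y My x; rewrite closed_ballE ?ltr_wpDl//= /closed_ball_ /= sub0r normrN => H.
  by apply: (le_trans H); exact: ltW.
have [N [Nr HN]] := compact_bounded (continuous_compact (continuous_subspaceT cf) cB).
exists (`|N| + 1); first by rewrite ltr_wpDl.
move=> x Ox; apply: HN; first by rewrite (le_lt_trans (ler_norm N))// ltrDl.
exists x => //; rewrite closed_ballE ?ltr_wpDl//= /closed_ball_ /= sub0r normrN.
apply: (le_trans (HM x Ox)); have := ler_norm M; lra.
Qed.

(** * Decrease of the Dirichlet energy under absolute values *)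

Section L2_limits.
Context (R : realType) (d : nat) (Omega : set 'rV[R]_d).
Implicit Types (w v : 'rV[R]_d -> R).
Let mu := leb R d.
Local Notation L2 := (L2 Omega).
Local Notation ip := (ip Omega).
Local Notation cvgL2 := (cvgL2 Omega).

Lemma ip_sqrZ c w : L2 w -> ip (fun x => c * w x) (fun x => c * w x) = c ^+ 2 * ip w w.
Proof. by move=> hw; have hc := L2Z c hw; rewrite ipZl// ipZr// mulrA. Qed.

Lemma ip_sqrD w v : L2 w -> L2 v ->
  ip (fun x => w x + v x) (fun x => w x + v x) = ip w w + 2 * ip w v + ip v v.
Proof.
move=> hw hv; have hD := L2D hw hv.
by rewrite ipDl// !ipDr// (ipC _ v w); ring.
Qed.

Lemma ip_sqrD_le w v : L2 w -> L2 v ->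
  ip (fun x => w x + v x) (fun x => w x + v x) <= 2 * ip w w + 2 * ip v v.
Proof.
move=> hw hv; have := ip_sqr_ge0 Omega (fun x => w x - v x).
by rewrite ip_sqrB// ip_sqrD//; lra.
Qed.

Lemma ip_sqr_le w v : L2 w -> L2 v -> (forall x, Omega x -> `|w x| <= `|v x|) ->
  ip w w <= ip v v.
Proof.
move=> hw hv wv; rewrite !ipE; apply: le_Rintegral => //; [exact: ip_integrable..|].
move=> x _; rewrite !patchE; case: ifPn => // /[!inE] /wv.
by rewrite -!expr2 -[w x ^+ 2]real_normK ?num_real// -[v x ^+ 2]real_normK ?num_real//
  => ?; rewrite lerXn2r.
Qed.

Lemma L2_norm w : L2 w -> L2 (fun x => `|w x|).
Proof.
move=> hw; apply: (L2_le _ hw) => [|x _]; last by rewrite normr_id.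
rewrite (_ : _ \_ _ = (fun y : R => `|y|) \o (w \_ Omega)).
  by apply: measurableT_comp => //; exact: L2_measurable.
by apply/funext => x /=; rewrite !patchE; case: ifP; rewrite ?normr0.
Qed.

(** Mean square convergence through the real squared distance, free of roots and of infinite
    values. *)
Definition cvgQ (w_ : nat -> 'rV[R]_d -> R) w :=
  ip (fun x => w_ n x - w x) (fun x => w_ n x - w x) @[n --> \oo] --> (0 : R).

Lemma cvgQ_ip (w_ : nat -> 'rV[R]_d -> R) w v : (forall n, L2 (w_ n)) -> L2 w -> L2 v
  -> cvgQ w_ w ->
  ip (w_ n) v @[n --> \oo] --> ip w v.
Proof.
move=> hw_ hw hv C.
have {}C : ip (fun x => w_ n x - w x) (fun x => w_ n x - w x) * ip v v @[n --> \oo]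
  --> (0 * ip v v : R).
  by apply: cvgM => //; exact: cvg_cst.
rewrite mul0r in C.
apply/cvgrPdist_lt => e e0; move/cvgrPdist_lt/(_ (e ^+ 2)) : C.
rewrite exprn_gt0// => /(_ isT); apply: filterS => n.
rewrite sub0r normrN => /(le_lt_trans (ler_norm _)) H.
rewrite -(@ltr_pXn2r _ 2) ?nnegrE ?(ltW e0)// real_normK ?num_real//.
rewrite (_ : (ip w v - ip (w_ n) v) ^+ 2 = (ip (fun x => w_ n x - w x) v) ^+ 2).
  by apply: le_lt_trans H; exact: ip_CS (L2B _ _) _.
by rewrite ipBl//; ring.
Qed.

Lemma cvgQ_le (w_ : nat -> 'rV[R]_d -> R) w (b : nat -> R) : (forall n, L2 (w_ n)) -> L2 w ->
  b n @[n --> \oo] --> (0 : R) ->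
  (forall n, ip (fun x => w_ n x - w x) (fun x => w_ n x - w x) <= b n) -> cvgQ w_ w.
Proof.
move=> hw_ hw b0 H; apply: (squeeze_cvgr _ (cvg_cst 0) b0); apply: nearW => n.
by rewrite ip_sqr_ge0 H.
Qed.

Lemma cvgQD (w_ : nat -> 'rV[R]_d -> R) w (v_ : nat -> 'rV[R]_d
  -> R) v : (forall n, L2 (w_ n)) -> L2 w -> (forall n, L2 (v_ n)) -> L2 v ->
  cvgQ w_ w -> cvgQ v_ v -> cvgQ (fun n x => w_ n x + v_ n x) (fun x => w x + v x).
Proof.
move=> hw_ hw hv_ hv Cw Cv.
apply: (@cvgQ_le _ _ (fun n => 2 * ip (fun x => w_ n x - w x) (fun x => w_ n x - w x) +
   2 * ip (fun x => v_ n x - v x) (fun x => v_ n x - v x))).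
- by move=> n; exact: L2D.
- exact: L2D.
- have -> : (0 : R) = 2 * 0 + 2 * 0 by ring.
  apply: cvgD; apply: cvgM; (exact: cvg_cst || by []).
- move=> n.
  rewrite (_ : (fun x => _) = fun x => (w_ n x - w x) + (v_ n x - v x)); last first.
    by apply/funext => x; ring.
  by apply: ip_sqrD_le; exact: L2B.
Qed.

Lemma cvgQZ (w_ : nat -> 'rV[R]_d -> R) w c : (forall n, L2 (w_ n)) -> L2 w -> cvgQ w_ w ->
  cvgQ (fun n x => c * w_ n x) (fun x => c * w x).
Proof.
move=> hw_ hw Cw; rewrite /cvgQ.
have E n : ip (fun x => c * w_ n x - c * w x) (fun x => c * w_ n x - c * w x) =
    c ^+ 2 * ip (fun x => w_ n x - w x) (fun x => w_ n x - w x).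
  rewrite -ip_sqrZ; last exact: L2B.
  by congr ip; apply/funext => x; rewrite mulrBr.
under eq_fun do rewrite E.
have : c ^+ 2 * ip (fun x => w_ n x - w x) (fun x => w_ n x - w x) @[n --> \oo]
  --> (c ^+ 2 * 0 : R).
  by apply: cvgM => //; exact: cvg_cst.
by rewrite mulr0.
Qed.

Lemma cvgQ_lin (r : seq nat) (a : nat -> R) (F : nat -> nat -> 'rV[R]_d -> R) G :
  (forall n k, L2 (F n k)) -> (forall n, L2 (G n)) -> (forall n, cvgQ (F n) (G n)) ->
  cvgQ (fun k x => \sum_(n <- r) a n * F n k x) (fun x => \sum_(n <- r) a n * G n x).
Proof.
move=> hF hG C; elim: r => [|n r IH].
  rewrite /cvgQ; under eq_fun => k.
    under eq_fun do rewrite !big_nil subr0.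
    rewrite ip0l; over.
  exact: cvg_cst.
rewrite (_ : (fun k x => _) = (fun k x => a n * F n k x
  + \sum_(n <- r) a n * F n k x)); last first.
  by apply/funext => k; apply/funext => x; rewrite big_cons.
rewrite (_ : (fun x => _) = (fun x => a n * G n x + \sum_(n <- r) a n * G n x)); last first.
  by apply/funext => x; rewrite big_cons.
apply: cvgQD => //.
- by move=> k; exact: L2Z.
- exact: L2Z.
- by move=> k; apply: L2_sum => m; exact: L2Z.
- by apply: L2_sum => m; exact: L2Z.
- exact: cvgQZ.
Qed.

Lemma cvgQ_sqr (w_ : nat -> 'rV[R]_d -> R) w : (forall n, L2 (w_ n)) -> L2 w -> cvgQ w_ w ->
  ip (w_ n) (w_ n) @[n --> \oo] --> ip w w.
Proof.
move=> hw_ hw C; have C2 := cvgQ_ip hw_ hw hw C.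
have E n : ip (w_ n) (w_ n) = ip (fun x => w_ n x - w x) (fun x => w_ n x - w x) +
   2 * ip (w_ n) w - ip w w by rewrite ip_sqrB//; ring.
under eq_fun do rewrite E.
have H : ip (fun x => w_ n x - w x) (fun x => w_ n x - w x) + 2 * ip (w_ n) w - ip w w
    @[n --> \oo] --> (0 + 2 * ip w w - ip w w : R).
  apply: cvgB; last exact: cvg_cst.
  by apply: cvgD => //; apply: cvgM => //; exact: cvg_cst.
by move: H; rewrite (_ : 0 + 2 * ip w w - ip w w = ip w w) //; ring.
Qed.

Lemma cvgQ_norm (w_ : nat -> 'rV[R]_d -> R) w : (forall n, L2 (w_ n)) -> L2 w -> cvgQ w_ w ->
  cvgQ (fun n x => `|w_ n x|) (fun x => `|w x|).
Proof.
move=> hw_ hw C; apply: (cvgQ_le _ _ C).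
- by move=> n; exact: L2_norm.
- exact: L2_norm.
- move=> n; apply: ip_sqr_le.
  + by apply: L2B; exact: L2_norm.
  + exact: L2B.
  + by move=> x _; exact: ler_dist_dist.
Qed.

Lemma cvgQ_trans (w_ v_ : nat -> 'rV[R]_d -> R) w : (forall n, L2 (w_ n))
  -> (forall n, L2 (v_ n)) -> L2 w ->
  cvgQ w_ w -> ip (fun x => v_ n x - w_ n x) (fun x => v_ n x - w_ n x) @[n --> \oo]
    --> (0 : R) ->
  cvgQ v_ w.
Proof.
move=> hw_ hv_ hw Cw Cv.
apply: (@cvgQ_le _ _ (fun n => 2 * ip (fun x => v_ n x - w_ n x) (fun x => v_ n x - w_ n x) +
   2 * ip (fun x => w_ n x - w x) (fun x => w_ n x - w x))) => //.
- have -> : (0 : R) = 2 * 0 + 2 * 0 by ring.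
  apply: cvgD; apply: cvgM; (exact: cvg_cst || by []).
- move=> n.
  rewrite (_ : (fun x => v_ n x - w x) = fun x => (v_ n x - w_ n x)
    + (w_ n x - w x)); last first.
    by apply/funext => x; ring.
  by apply: ip_sqrD_le; exact: L2B.
Qed.

End L2_limits.

(** * The Dirichlet energy of combinations of eigenfunctions *)

Section energy.
Context (R : realType) (d : nat) (Omega : set 'rV[R]_d).
Hypotheses (oO : open Omega) (bO : bounded_set Omega).
Context (lambda : nat -> R) (e : nat -> 'rV[R]_d -> R).
Hypotheses (lambda_gt0 : forall n, 0 < lambda n)
    (eigenpairs : forall n, dirichlet_eigenpair Omega (lambda n) (e n))
    (e_basis : orthonormal_basis Omega e).
Let mu := leb R d.
Local Notation L2 := (L2 Omega).
Local Notation ip := (ip Omega).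
Local Notation cvgQ := (cvgQ Omega).
Implicit Types (w v f : 'rV[R]_d -> R).

Let mO : measurable Omega := open_measurable_rV oO.
Let fO : (mu Omega < +oo)%E := leb_bounded_fin mO bO.

Lemma L2_continuous f : continuous f -> L2 f.
Proof.
move=> cf; have [M _ fM] := continuous_bounded_rV bO cf.
apply: (L2_bounded mO fO _ fM); exact: continuous_measurable_rV.
Qed.

Lemma L2_test f : test_fun Omega f -> L2 f.
Proof. by move=> [sf _]; apply: L2_continuous; exact: smooth_continuous. Qed.

Lemma L2_partial_test i f : test_fun Omega f -> L2 (partial i f).
Proof.
by move=> [sf _]; apply: L2_continuous; apply: smooth_continuous; exact: smooth_partial.
Qed.

Let e_L2 n : L2 (e n). Proof. by case: e_basis. Qed.

Let gradients : exists (g : nat -> 'I_d -> 'rV[R]_d -> R) (phi : nat -> nat -> 'rV[R]_d -> R),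
  [/\ forall n i, L2 (g n i), forall n k, test_fun Omega (phi n k),
      forall n, cvgQ (phi n) (e n),
      forall n i, cvgQ (fun k => partial i (phi n k)) (g n i) &
      forall n f, test_fun Omega f ->
        \sum_(i < d) ip (g n i) (partial i f) = lambda n * ip (e n) f].
Proof.
have /choice[g Hg] := eigenpairs.
have /choice[phi Hphi] : forall n, exists phi : nat -> 'rV[R]_d -> R,
    [/\ forall k, test_fun Omega (phi k), cvgL2 Omega phi (e n) &
        forall i, cvgL2 Omega (fun k => partial i (phi k)) (g n i)].
  by move=> n; have [[_ _]] := Hg n.
exists g, phi.
have gL n i : L2 (g n i) by have [[]] := Hg n.
split => //.
- by move=> n; have [] := Hphi n.
- move=> n; have [tp C _] := Hphi n; apply: cvgL2P => // k; exact: L2_test.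
- move=> n i; have [tp _ C] := Hphi n; apply: cvgL2P => // k; exact: L2_partial_test.
- by move=> n f tf; have [_] := Hg n; apply.
Qed.

Let sum_delta (N : nat) (F : nat -> R) m : (m < N)%N ->
  \sum_(0 <= n < N) (n == m)%:R * F n = F m.
Proof.
move=> mN; rewrite big_mkord (bigD1 (Ordinal mN))//= eqxx mul1r big1 ?addr0// => i im.
by rewrite (_ : (_ == _) = false) ?mul0r//; apply/negbTE; apply: contra im => /eqP E;
  apply/eqP/val_inj.
Qed.

(* The spectral energy [sum_n lambda_n w_n ^+ 2] decreases under [w |-> `|w|]:
   on test functions it is dominated by the Dirichlet integral, and polynomial
   contractions approximating the absolute value do not increase the latter. *)
Lemma energy_norm (a : nat -> R) N M :
  \sum_(0 <= n < M)
    lambda n * ip (fun x => `|\sum_(0 <= k < N) a k * e k x|) (e n) ^+ 2 <=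
  \sum_(0 <= n < N) lambda n * a n ^+ 2.
Proof.
pose w x := \sum_(0 <= n < N) a n * e n x.
change (\sum_(0 <= n < M) lambda n * ip (fun x => `|w x|) (e n) ^+ 2 <=
  \sum_(0 <= n < N) lambda n * a n ^+ 2).
have [g [phi [gL tphi Cphi Cdphi eig]]] := gradients.
have ee m n : ip (e m) (e n) = (m == n)%:R by case: e_basis.
(* Orthogonality of the gradients: the weak equation for [e n] is tested on the approximations of
   [e m], and the limit is taken on both sides. *)
have gg m n : \sum_(i < d) ip (g n i) (g m i) = lambda n * (n == m)%:R.
  have C1 : \sum_(i < d) ip (partial i (phi m k)) (g n i) @[k --> \oo]
    --> \sum_(i < d) ip (g m i) (g n i).
    apply: cvg_sumr => i; apply: cvgQ_ip => // k; exact: L2_partial_test.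
  have C2 : lambda n * ip (phi m k) (e n) @[k --> \oo] --> lambda n * ip (e m) (e n).
    apply: cvgM; first exact: cvg_cst.
    by apply: cvgQ_ip => // k; exact: L2_test.
  have E : (fun k => \sum_(i < d) ip (partial i (phi m k)) (g n i)) =
      (fun k => lambda n * ip (phi m k) (e n)).
    apply/funext => k; rewrite (ipC _ (phi m k)) -eig//.
    by apply: eq_bigr => i _; rewrite ipC.
  rewrite E in C1; have := cvg_unique _ C1 C2; rewrite ee eq_sym => <- //.
  by apply: eq_bigr => i _; rewrite ipC.
have energy_lin (c : nat -> R) K (S : 'I_d -> 'rV[R]_d -> R) :
    (forall i, S i = fun x => \sum_(0 <= n < K) c n * g n i x) ->
    \sum_(i < d) ip (S i) (S i) = \sum_(0 <= n < K) lambda n * c n ^+ 2.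
  move=> SE.
  have cg n i : L2 (fun x => c n * g n i x) by exact: L2Z.
  transitivity (\sum_(i < d) \sum_(0 <= n < K) \sum_(0
    <= m < K) c n * c m * ip (g n i) (g m i)).
    apply: eq_bigr => i _; rewrite SE ip_suml//; last by apply: L2_sum.
    apply: eq_bigr => n _; rewrite ip_sumr//; apply: eq_bigr => m _.
    by rewrite ipZl// ipZr// mulrA.
  rewrite exchange_big/= !big_nat; apply: eq_bigr => n /andP[_ nK].
  rewrite exchange_big/=.
  transitivity (\sum_(0 <= m < K) (m == n)%:R * (c n * c m * lambda n)).
    by apply: eq_bigr => m _; rewrite -mulr_sumr gg (eq_sym n); ring.
  by rewrite sum_delta//; ring.
(* Bessel's inequality for gradients: the pairing of the gradient of [psi] with [S], and [S] with
   itself, both equal the spectral sum. *)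
have bessel psi : test_fun Omega psi ->
    \sum_(0 <= n < M) lambda n * ip psi (e n) ^+ 2
      <= \sum_(i < d) ip (partial i psi) (partial i psi).
  move=> tpsi; pose c n := ip psi (e n).
  pose S i x := \sum_(0 <= n < M) c n * g n i x.
  have cg n i : L2 (fun x => c n * g n i x) by exact: L2Z.
  have SL i : L2 (S i) by exact: L2_sum.
  have dL i := L2_partial_test i tpsi.
  have E1 := energy_lin c M S (fun i => erefl).
  have E2 : \sum_(i < d) ip (partial i psi) (S i) = \sum_(0 <= n < M) lambda n * c n ^+ 2.
    transitivity (\sum_(i < d) \sum_(0 <= n < M) c n * ip (g n i) (partial i psi)).
      apply: eq_bigr => i _; rewrite ip_sumr//; apply: eq_bigr => n _.
      by rewrite ipZr// ipC.
    rewrite exchange_big/=; apply: eq_bigr => n _.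
    by rewrite -mulr_sumr eig// ipC /c; ring.
  have : 0 <= \sum_(i < d) ip (fun x => partial i psi x - S i x) (fun x
    => partial i psi x - S i x).
    by apply: sumr_ge0 => i _; exact: ip_sqr_ge0.
  under eq_bigr do rewrite ip_sqrB//.
  by rewrite !big_split/= sumrN -mulr_sumr E1 E2 /c; lra.
pose wk k x := \sum_(0 <= n < N) a n * phi n k x.
have twk k : test_fun Omega (wk k).
  by apply: test_fun_sum => n; exact: test_funZ.
have wL : L2 w by apply: L2_sum => n; exact: L2Z.
have Cwk : cvgQ wk w by apply: cvgQ_lin => // n k; exact: L2_test.
pose S i x := \sum_(0 <= n < N) a n * g n i x.
have SL i : L2 (S i) by apply: L2_sum => n; exact: L2Z.
have Cdwk i : cvgQ (fun k => partial i (wk k)) (S i).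
  rewrite (_ : (fun k => _) = fun k x => \sum_(0
    <= n < N) a n * partial i (phi n k) x); last first.
    apply/funext => k; apply/funext => x; apply: partial_lin => n.
    by have [] := tphi n k.
  by apply: cvgQ_lin => // n k; exact: L2_partial_test.
have bnd k : exists2 B : R, 0 < B & forall x, Omega x -> `|wk k x| <= B.
  by apply: continuous_bounded_rV => //; apply: smooth_continuous; have [] := twk k.
(* [abs_poly] is controlled on $[-1,1]$ only, so it is conjugated by the scaling by a bound [B] of
   [wk k]. This keeps the derivative bound and multiplies the uniform error by [B]. *)
have approx k : exists p : {poly R}, [/\ p.[0] = 0,
    forall x, Omega x -> `|p^`().[wk k x]| <= 1 &
    forall x, Omega x -> `|p.[wk k x] - `|wk k x| | <= k.+1%:R^-1].
  have [B B0 HB] := bnd k.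
  have := @rbin_half_cvg0 R; rewrite -(cvg_shiftS (rbin 2^-1)).
  move=> /cvgrPdist_lt/(_ (k.+1%:R^-1 / B)); rewrite divr_gt0//
    => /(_ isT) [n _ /(_ n (leqnn n))].
  rewrite /= sub0r normrN => /(le_lt_trans (ler_norm _)) Hn.
  have sc x : Omega x -> `|B^-1 * wk k x| <= 1.
    by move=> /HB H; rewrite normrM gtr0_norm ?invr_gt0// mulrC ler_pdivrMr// mul1r.
  exists (B *: (abs_poly n \Po (B^-1 *: 'X))); split.
  - by rewrite hornerZ horner_comp hornerZ hornerX mulr0 abs_poly0 mulr0.
  - move=> x Ox; rewrite derivZ deriv_comp derivZ derivX hornerZ hornerM horner_comp.
    rewrite !hornerZ hornerX hornerC mulr1 mulrCA mulfV ?gt_eqF// mulr1.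
    by apply: deriv_abs_poly_le1; exact: sc.
  - move=> x Ox; rewrite hornerZ horner_comp hornerZ hornerX.
    have E : `|wk k x| = B * `|B^-1 * wk k x|.
      by rewrite normrM gtr0_norm ?invr_gt0// mulrA mulfV ?gt_eqF// mul1r.
    rewrite E -mulrBr normrM (gtr0_norm B0) -ler_pdivlMl// [leRHS]mulrC.
    by apply: (le_trans (abs_poly_dist n (sc x Ox))); exact: ltW.
have /choice[p Hp] := approx.
pose psi k x := (p k).[wk k x].
have tpsi k : test_fun Omega (psi k).
  by apply: test_fun_horner => //; have [] := Hp k.
have wkL k := L2_test (twk k).
have psiL k := L2_test (tpsi k).
have Cpsi : cvgQ psi (fun x => `|w x|).
  apply: (@cvgQ_trans _ _ _ (fun k x => `|wk k x|)) => //.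
  - by move=> k; exact: L2_norm.
  - exact: L2_norm.
  - exact: cvgQ_norm.
  have oneL : L2 (\1_Omega : 'rV[R]_d -> R) by exact: L2_indic.
  apply: (@squeeze_cvgr _ _ _ _ (fun=> 0) (fun k => k.+1%:R^-1 * ip (\1_Omega) (\1_Omega))).
  - apply: nearW => k; rewrite ip_sqr_ge0/=.
    have kL : L2 (fun x => k.+1%:R^-1 * \1_Omega x) by exact: L2Z.
    apply: (@le_trans _ _ (ip (fun x => k.+1%:R^-1 * \1_Omega x) (fun x
      => k.+1%:R^-1 * \1_Omega x))).
      apply: ip_sqr_le => //; first by apply: L2B => //; exact: L2_norm.
      move=> x Ox; rewrite indicE mem_set// mulr1 [leRHS]ger0_norm//.
      by have [_ _] := Hp k; apply.
    rewrite ip_sqrZ// ler_wpM2r ?ip_sqr_ge0// expr2 ler_piMl//.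
    by rewrite invf_le1// ler1n.
  - exact: cvg_cst.
  - rewrite -[X in _ --> X](mul0r (ip (\1_Omega) (\1_Omega))).
    by apply: cvgM; [exact: cvg_harmonic|exact: cvg_cst].
(* Only finitely many coefficients of [psi k] pass to the limit. The gradients of [psi k] are merely
   dominated by those of [wk k], which do converge. *)
have Lim1 : \sum_(0 <= n < M) lambda n * ip (psi k) (e n) ^+ 2 @[k --> \oo] -->
    \sum_(0 <= n < M) lambda n * ip (fun x => `|w x|) (e n) ^+ 2.
  apply: cvg_sumr => n; apply: cvgM; first exact: cvg_cst.
  have C : ip (psi k) (e n) @[k --> \oo] --> ip (fun x => `|w x|) (e n).
    by apply: cvgQ_ip => //; exact: L2_norm.
  by rewrite expr2; apply: cvgM.
have Lim2 : \sum_(i < d) ip (partial i (wk k)) (partial i (wk k)) @[k --> \oo] -->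
    \sum_(i < d) ip (S i) (S i).
  by apply: cvg_sumr => i; apply: cvgQ_sqr => // k; exact: L2_partial_test.
rewrite -(energy_lin a N S)//.
apply: (ler_cvg_to Lim1 Lim2); apply: nearW => k.
apply: (le_trans (bessel _ (tpsi k))); apply: ler_sum => i _.
apply: ip_sqr_le; [exact: L2_partial_test..|].
move=> x Ox; have [swk _] := twk k.
rewrite partial_horner// normrM ler_piMl//.
by have [_ + _] := Hp k; apply.
Qed.

End energy.

(** * Positivity preserving multipliers *)

Section positive_multipliers.
Context (R : realType) (d : nat) (Omega : set 'rV[R]_d).
Hypotheses (oO : open Omega) (bO : bounded_set Omega).
Context (lambda : nat -> R) (e : nat -> 'rV[R]_d -> R).
Hypotheses (lambda_gt0 : forall n, 0 < lambda n)
    (eigenpairs : forall n, dirichlet_eigenpair Omega (lambda n) (e n))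
    (e_basis : orthonormal_basis Omega e).
Let mu := leb R d.
Local Notation L2 := (L2 Omega).
Local Notation ip := (ip Omega).
Local Notation cvgQ := (cvgQ Omega).
Implicit Types (w v f F G : 'rV[R]_d -> R) (m : nat -> R).

Local Notation "F `^_ n" := (ip F (e n)) (at level 2, n at level 1).

Definition ae_ge0 F := {ae mu, forall x, Omega x -> 0 <= F x}.

Let e_L2 n : L2 (e n). Proof. by case: e_basis. Qed.

Lemma parseval F G : L2 F -> L2 G ->
  series (fun n => F`^_n * G`^_n) N @[N --> \oo] --> ip F G.
Proof.
move=> hF hG; have [_ _ /(_ F hF) C] := e_basis.
have hS N : L2 (fun x => \sum_(0 <= n < N) F`^_n * e n x).
  by apply: L2_sum => n; exact: L2Z.
have := cvgQ_ip hS hF hG (cvgL2P hS hF C).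
rewrite (_ : (fun n => ip _ G) = series (fun n => F`^_n * G`^_n))//.
apply/funext => N; rewrite ip_suml//; last by move=> n; exact: L2Z.
by apply: eq_bigr => n _; rewrite ipZl// (ipC _ (e n)).
Qed.

Lemma parseval_sqr F : L2 F -> series (fun n => F`^_n ^+ 2) N @[N --> \oo] --> ip F F.
Proof. by move=> hF; have := parseval hF hF. Qed.

Lemma bessel F N : L2 F -> \sum_(0 <= n < N) F`^_n ^+ 2 <= ip F F.
Proof.
move=> hF; have C := parseval_sqr hF.
have nd : {homo series (fun n => F`^_n ^+ 2) : n k / (n <= k)%N >-> n <= k}.
  by apply: nondecreasing_series => n _ _; exact: sqr_ge0.
have := nondecreasing_cvgn_le nd (cvgP _ C) N.
by rewrite (cvg_lim _ C).
Qed.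

(* The closure, in the space of square summable sequences, of the coefficient
   sequences of nonnegative functions. *)
Definition pos_closure (a : nat -> R) := forall eps : R, 0 < eps ->
  exists v, [/\ L2 v, ae_ge0 v &
    forall N, \sum_(0 <= n < N) (a n - v`^_n) ^+ 2 <= eps].

(** The image of [F] is represented by its coefficients. Boundedness of [m] keeps $\ell^2$ errors
    under control in products. *)
Definition pos_multiplier m := (exists M : R, forall n, `|m n| <= M) /\
  forall F, L2 F -> ae_ge0 F -> pos_closure (fun n => m n * F`^_n).

Lemma pos_multiplierM m1 m2 : pos_multiplier m1 -> pos_multiplier m2 ->
  pos_multiplier (fun n => m1 n * m2 n).
Proof.
move=> [[M1 b1] p1] [[M2 b2] p2]; split.
  by exists (M1 * M2) => n; rewrite normrM; apply: ler_pM.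
move=> F hF F0 eps eps0.
(* The error is $m_1(m_2F-v)+(m_1v-w)$; with $(a+b)^2\le2a^2+2b^2$ each part contributes at most
   [eps / 2]. Adding 1 makes the divisor positive. *)
pose M := M1 ^+ 2 + 1; have M0 : 0 < M by rewrite ltr_wpDl ?sqr_ge0.
have /p2 := hF => /(_ F0 (eps / (4 * M))).
rewrite divr_gt0 ?mulr_gt0// => /(_ isT) [v [hv v0 Hv]].
have /p1 := hv => /(_ v0 (eps / 4)).
rewrite divr_gt0// => /(_ isT) [w [hw w0 Hw]].
exists w; split => // N.
apply: (@le_trans _ _ (2 * (M * (\sum_(0 <= n < N) (m2 n * F`^_n - v`^_n) ^+ 2)) +
   2 * \sum_(0 <= n < N) (m1 n * v`^_n - w`^_n) ^+ 2)).
  rewrite !mulr_sumr -big_split/=; apply: ler_sum => n _.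
  set a := m2 n * _ - _; set b := m1 n * _ - _.
  have -> : m1 n * m2 n * F`^_n - w`^_n = m1 n * a + b by rewrite /a /b; ring.
  have h1 : m1 n ^+ 2 <= M.
    rewrite /M -real_normK ?num_real// (@le_trans _ _ (M1 ^+ 2)) ?lerDl//.
    by apply: lerXn2r => //; rewrite nnegrE (le_trans _ (b1 n)).
  have h2 : (m1 n * a) ^+ 2 <= M * a ^+ 2 by rewrite exprMn ler_wpM2r// sqr_ge0.
  have h3 : 0 <= (m1 n * a - b) ^+ 2 by exact: sqr_ge0.
  have -> : (m1 n * a + b) ^+ 2 = 2 * (m1 n * a) ^+ 2 + 2 * b ^+ 2 - (m1 n * a - b) ^+ 2.
    by ring.
  by lra.
have := Hv N; rewrite ler_pdivlMr ?mulr_gt0// => {}Hv; have {}Hw := Hw N.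
by rewrite mulrA in Hv; lra.
Qed.

(** Dominated convergence in $\ell^2$: the squares of $(m_n-F_{k,n})\langle F,e_n\rangle$ are at
    most $(2M)^2\langle F,e_n\rangle^2$, summable by Parseval. *)
Lemma pos_multiplier_lim (Fm : nat -> nat -> R) m (M : R) :
  (forall k, pos_multiplier (Fm k)) -> (forall k n, `|Fm k n| <= M) ->
  (forall n, Fm k n @[k --> \oo] --> m n) -> pos_multiplier m.
Proof.
move=> pF bF cF.
have bm n : `|m n| <= M.
  by apply: (ler_cvg_to (cvg_norm (cF n)) (cvg_cst M)); apply: nearW.
split; first by exists M.
move=> F hF F0 eps eps0.
have cdom : cvgn (series (fun n => (2 * M) ^+ 2 * F`^_n ^+ 2)).
  rewrite (_ : series _ = fun N => (2 * M) ^+ 2 * series (fun n => F`^_n ^+ 2) N).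
    by apply: is_cvgM; [exact: is_cvg_cst|exact: cvgP (parseval_sqr hF)].
  by apply/funext => N; rewrite /series /= mulr_sumr.
have tail : limn (series (fun n => ((m n - Fm k n) * F`^_n) ^+ 2)) @[k --> \oo] -->
    limn (series (fun n : nat => 0 : R)).
  apply: (@tannery R _ _ (fun n => (2 * M) ^+ 2 * F`^_n ^+ 2)).
  - apply: nearW => k n; rewrite ger0_norm ?sqr_ge0// exprMn ler_wpM2r ?sqr_ge0//.
    rewrite -real_normK ?num_real//; apply: lerXn2r => //.
    + by rewrite nnegrE mulr_ge0// (le_trans _ (bm n)).
    + by apply: (le_trans (ler_normB _ _)); have := bm n; have := bF k n; lra.
  - exact: cdom.
  - move=> n.
    have : ((m n - Fm k n) * F`^_n) ^+ 2 @[k --> \oo]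
      --> ((m n - m n) * F`^_n) * ((m n - m n) * F`^_n).
      rewrite (_ : (fun _ => _) = (fun k
        => ((m n - Fm k n) * F`^_n) * ((m n - Fm k n) * F`^_n)))//.
      have C : (m n - Fm k n) * F`^_n @[k --> \oo] --> (m n - m n) * F`^_n.
        by apply: cvgM; [apply: cvgB => //; exact: cvg_cst|exact: cvg_cst].
      exact: cvgM.
    by rewrite subrr !mul0r.
have z0 : limn (series (fun n : nat => 0 : R)) = 0.
  rewrite (_ : series _ = cst 0); first exact: lim_cst.
  by apply/funext => N; rewrite /series /= big1.
rewrite z0 in tail.
move/cvgrPdist_lt/(_ (eps / 4)) : tail; rewrite divr_gt0// => /(_ isT) [k _ /(_ k (leqnn k))].
rewrite sub0r normrN => /(le_lt_trans (ler_norm _)) Hk.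
have ck : cvgn (series (fun n => ((m n - Fm k n) * F`^_n) ^+ 2)).
  apply: (@dominated_series_cvg _ _ (fun n => (2 * M) ^+ 2 * F`^_n ^+ 2)).
    move=> n; rewrite ger0_norm ?sqr_ge0// exprMn ler_wpM2r ?sqr_ge0//.
    rewrite -real_normK ?num_real//; apply: lerXn2r => //.
    + by rewrite nnegrE mulr_ge0// (le_trans _ (bm n)).
    + by apply: (le_trans (ler_normB _ _)); have := bm n; have := bF k n; lra.
  exact: cdom.
have part N : \sum_(0 <= n < N) ((m n - Fm k n) * F`^_n) ^+ 2 <= eps / 4.
  apply: le_trans (ltW Hk); apply: (nondecreasing_cvgn_le _ ck).
  by apply: nondecreasing_series => n _ _; exact: sqr_ge0.
have [_ /(_ F hF F0 (eps / 4))] := pF k; rewrite divr_gt0// => /(_ isT) [v [hv v0 Hv]].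
exists v; split => // N.
apply: (@le_trans _ _ (2 * (\sum_(0 <= n < N) ((m n - Fm k n) * F`^_n) ^+ 2) +
   2 * \sum_(0 <= n < N) (Fm k n * F`^_n - v`^_n) ^+ 2)).
  rewrite !mulr_sumr -big_split/=; apply: ler_sum => n _.
  set b := Fm k n * _ - _; set a := (m n - _) * _.
  have -> : m n * F`^_n - v`^_n = a + b by rewrite /a /b; ring.
  by have := sqr_ge0 (a - b); nra.
by have := part N; have := Hv N; lra.
Qed.

Lemma pos_multiplier_cone : mult_cone pos_multiplier.
Proof.
split.
- move=> c c0; split; first by exists `|c|.
  move=> F hF F0 eps eps0; exists (fun x => c * F x); split; first exact: L2Z.
    by apply: filterS F0 => x H Ox; rewrite mulr_ge0// H.
  move=> N; rewrite big1 ?ltW// => n _; by rewrite ipZl// subrr expr0n.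
- move=> m1 m2 [[M1 b1] p1] [[M2 b2] p2]; split.
    by exists (M1 + M2) => n; apply: (le_trans (ler_normD _ _)); exact: lerD.
  move=> F hF F0 eps eps0.
  have e4 : 0 < eps / 4 by rewrite divr_gt0.
  have [v [hv v0 Hv]] := p1 F hF F0 _ e4.
  have [w [hw w0 Hw]] := p2 F hF F0 _ e4.
  exists (fun x => v x + w x); split; first exact: L2D.
    by apply: filterS2 v0 w0 => x H1 H2 Ox; rewrite addr_ge0 ?H1 ?H2.
  move=> N.
  apply: (@le_trans _ _ (2 * (\sum_(0 <= n < N) (m1 n * F`^_n - v`^_n) ^+ 2) +
    2 * \sum_(0 <= n < N) (m2 n * F`^_n - w`^_n) ^+ 2)).
    rewrite !mulr_sumr -big_split/=; apply: ler_sum => n _.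
    rewrite ipDl//; set a := m1 n * _ - _; set b := m2 n * _ - _.
    have -> : (m1 n + m2 n) * F`^_n - (v`^_n + w`^_n) = a + b by rewrite /a /b; ring.
    by have := sqr_ge0 (a - b); nra.
  by have := Hv N; have := Hw N; lra.
- exact: pos_multiplierM.
- exact: pos_multiplier_lim.
Qed.

(* Variational: [sum_n m_n F_n e_n] minimises
   [sum_n (1 + eps lambda_n) w_n ^+ 2 / 2 - ip F w], and replacing [w] by [`|w|]
   does not increase this functional. *)
Lemma pos_multiplier_resolvent (eps : R) : 0 < eps ->
  pos_multiplier (fun n => (1 + eps * lambda n)^-1).
Proof.
move=> eps0; pose m n := (1 + eps * lambda n)^-1.
have p0 n : 0 < 1 + eps * lambda n by rewrite addr_gt0// mulr_gt0.
have m0 n : 0 < m n by rewrite invr_gt0.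
have m1 n : m n <= 1 by rewrite invf_le1// lerDl mulr_ge0// ltW.
split; first by exists 1 => n; rewrite -/(m n) ger0_norm ?m1// ltW.
move=> F hF F0 eta eta0.
(* The minimum of the functional is $-\frac12\lim q$; truncation at [N] loses less than [eta] of
   $\lim q$. *)
pose q K := \sum_(0 <= n < K) m n * F`^_n ^+ 2.
have cq : cvgn q.
  apply: (@dominated_series_cvg _ _ (fun n => F`^_n ^+ 2)).
    move=> n; have k : 0 <= m n * F`^_n ^+ 2 by rewrite mulr_ge0 ?sqr_ge0// ltW.
    by rewrite (ger0_norm k) ler_piMl ?sqr_ge0.
  exact: cvgP (parseval_sqr hF).
have /cvgrPdist_lt/(_ _ eta0) [N _ /(_ N (leqnn N))] : q K @[K --> \oo] --> limn q by [].
move=> /(le_lt_trans (ler_norm _)) /= HN.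
pose w x := \sum_(0 <= n < N) m n * F`^_n * e n x.
have wL : L2 w by apply: L2_sum => n; exact: L2Z.
pose v x := `|w x|.
have vL : L2 v by exact: L2_norm.
exists v; split => //; first by apply: aeW => x _; exact: normr_ge0.
have ee i j : ip (e i) (e j) = (i == j)%:R by case: e_basis.
have wF G : L2 G -> ip w G = \sum_(0 <= n < N) m n * F`^_n * G`^_n.
  move=> hG; rewrite ip_suml//; last by move=> n; exact: L2Z.
  by apply: eq_bigr => n _; rewrite ipZl// (ipC _ (e n)).
have wn n : (n < N)%N -> w`^_n = m n * F`^_n.
  move=> nN; rewrite wF// big_mkord (bigD1 (Ordinal nN))//= ee eqxx mulr1.
  rewrite big1 ?addr0// => i /eqP iN; rewrite ee.
  by case: eqP => [E|]; rewrite ?mulr0//; case: iN; exact/val_inj.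
have vv : ip v v = \sum_(0 <= n < N) (m n * F`^_n) ^+ 2.
  transitivity (ip w w).
    rewrite !ipE; apply: eq_Rintegral => x _; rewrite !patchE; case: ifP => // _.
    by rewrite /v -normrM -expr2 ger0_norm ?sqr_ge0.
  by rewrite wF// !big_nat; apply: eq_bigr => n /andP[_ nN]; rewrite wn// expr2.
(* [q N] is the pairing of [F] with [w], and $w\le|w|$ while [F] is nonnegative. *)
have Fv : q N <= ip F v.
  have -> : q N = ip F w.
    by rewrite ipC wF//; apply: eq_bigr => n _; rewrite expr2 mulrA.
  rewrite -subr_ge0 -ipBr//; apply: ip_ge0 => //; last exact: L2B.
  by apply: aeW => x _; rewrite subr_ge0 ler_norm.
have en K := energy_norm oO bO eigenpairs e_basis (fun n => m n * F`^_n) N K.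
(* Completing the square, using $(1+\varepsilon\lambda_n)m_n=1$. *)
have E K : \sum_(0 <= n < K) (1 + eps * lambda n) * (m n * F`^_n - v`^_n) ^+ 2 =
   (\sum_(0 <= n < K) v`^_n ^+ 2) + eps * (\sum_(0 <= n < K) lambda n * v`^_n ^+ 2)
   - 2 * (\sum_(0 <= n < K) F`^_n * v`^_n) + q K.
  rewrite /q !mulr_sumr -!sumrN -!big_split/=; apply: eq_bigr => n _.
  by rewrite /m; field; rewrite gt_eqF.
have D K : \sum_(0 <= n < K) (1 + eps * lambda n) * (m n * F`^_n - v`^_n) ^+ 2 <=
    q N - 2 * (\sum_(0 <= n < K) F`^_n * v`^_n) + q K.
  rewrite E lerD2r lerD2r.
  have -> : q N = \sum_(0 <= n < N) (m n * F`^_n) ^+ 2 +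
      eps * \sum_(0 <= n < N) lambda n * (m n * F`^_n) ^+ 2.
    rewrite /q mulr_sumr -big_split/=; apply: eq_bigr => n _.
    by rewrite /m; field; rewrite gt_eqF.
  apply: lerD; first by rewrite -vv; exact: bessel.
  by rewrite ler_wpM2l ?(ltW eps0)//; exact: en.
have nd : {homo (fun K => \sum_(0 <= n < K) (1 + eps * lambda n) * (m n * F`^_n - v`^_n) ^+ 2) :
    n k / (n <= k)%N >-> n <= k}.
  apply: nondecreasing_series => n _ _; rewrite mulr_ge0 ?sqr_ge0//; exact: ltW.
move=> K.
apply: (@le_trans _ _ (\sum_(0 <= n < K) (1 + eps * lambda n) * (m n * F`^_n - v`^_n) ^+ 2)).
  by apply: ler_sum => n _; rewrite ler_peMl ?sqr_ge0// lerDl mulr_ge0// ltW.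
(* By [Fv] this quantity is at most $\lim q-q_N<\eta$. It bounds every weighted partial sum, since
   these increase and [D] passes to the limit. *)
apply: (@le_trans _ _ (q N - 2 * ip F v + limn q)); last by move: HN Fv; lra.
have C : q N - 2 * (\sum_(0 <= n < J) F`^_n * v`^_n) + q J @[J --> \oo] -->
    q N - 2 * ip F v + limn q.
  apply: cvgD => //; apply: cvgB; first exact: cvg_cst.
  by apply: cvgM; [exact: cvg_cst|exact: parseval].
apply: (ler_cvg_to (cvg_cst _) C); exists K => // J /= KJ.
by apply: le_trans (D J); exact: nd.
Qed.

(** Replacing the coefficients $m_n\langle F,e_n\rangle$ by those of a nonnegative [v] at squared
    distance [eta ^+ 2] costs at most [eta * c] by Young's inequality, and [ip v G] is
    nonnegative. *)
Lemma pos_multiplier_pairing m F G L : pos_multiplier m -> L2 F -> L2 G ->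
  ae_ge0 F -> ae_ge0 G ->
  series (fun n => m n * F`^_n * G`^_n) N @[N --> \oo] --> L -> 0 <= L.
Proof.
move=> [_ pm] hF hG F0 G0 CL.
pose c := 1 + ip G G.
have c0 : 0 < c by rewrite ltr_pwDl// ip_sqr_ge0.
suff H eta : 0 < eta -> - (eta * c) <= L.
  rewrite leNgt; apply/negP => L0.
  have := H (- L / (2 * c)); rewrite divr_gt0 ?oppr_gt0 ?mulr_gt0// => /(_ isT).
  have -> : - L / (2 * c) * c = - L / 2 by field; rewrite gt_eqF.
  by lra.
move=> eta0.
have eta2 : 0 < eta ^+ 2 by rewrite exprn_gt0.
have [v [hv v0 Hv]] := pm F hF F0 _ eta2.
have Cv := parseval hv hG.
have C2 : series (fun n => m n * F`^_n * G`^_n) N - series (fun n => v`^_n * G`^_n) N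
    @[N --> \oo] --> L - ip v G by exact: cvgB.
have : - (eta * c) <= L - ip v G.
  apply: (ler_cvg_to (cvg_cst _) C2); apply: nearW => N /=.
  rewrite /series /= -sumrB.
  have H1 := Hv N; have H2 := bessel N hG.
  apply: (@le_trans _ _ (\sum_(0 <= n < N) (- (eta^-1 * (m n * F`^_n - v`^_n) ^+ 2
    + eta * G`^_n ^+ 2)))).
    rewrite sumrN lerN2 big_split/= -!mulr_sumr /c mulrDr mulr1; apply: lerD.
      by rewrite ler_pdivrMl// -expr2.
    by rewrite ler_wpM2l// ltW.
  apply: ler_sum => n _; set a := m n * _ - _; set b := G`^_n.
  have -> : m n * F`^_n * b - v`^_n * b = a * b by rewrite /a; ring.
  have -> : a = eta * (a / eta) by field; rewrite gt_eqF.
  move: (a / eta) => t.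
  have -> : eta^-1 * (eta * t) ^+ 2 = eta * t ^+ 2 by field; rewrite gt_eqF.
  by have := sqr_ge0 (t + b); have := sqr_ge0 t; have := sqr_ge0 b; nra.
by have := ip_ge0 v0 G0 hv hG; lra.
Qed.

End positive_multipliers.

(** * Strict positivity through pairings *)

Section faithful.
Context (R : realType) (d : nat) (Omega : set 'rV[R]_d).
Hypotheses (oO : open Omega) (bO : bounded_set Omega).
Context (lambda : nat -> R) (e : nat -> 'rV[R]_d -> R).
Hypotheses (lambda_gt0 : forall n, 0 < lambda n)
    (eigenpairs : forall n, dirichlet_eigenpair Omega (lambda n) (e n))
    (e_basis : orthonormal_basis Omega e).
Let mu := leb R d.
Local Notation L2 := (L2 Omega).
Local Notation ip := (ip Omega).
Implicit Types (w v f F G : 'rV[R]_d -> R) (m : nat -> R).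
Local Notation "F `^_ n" := (ip F (e n)) (at level 2, n at level 1).

Let e_L2 n : L2 (e n). Proof. by case: e_basis. Qed.

(** $\langle m(-\Delta)F,G\rangle$ by Parseval, expressed through coefficients only. *)
Definition pairing m F G := limn (series (fun n => m n * F`^_n * G`^_n)).

Lemma cvg_pairing m (M : R) F G : (forall n, `|m n| <= M) -> L2 F -> L2 G ->
  series (fun n => m n * F`^_n * G`^_n) N @[N --> \oo] --> pairing m F G.
Proof.
move=> bm hF hG.
apply: (@dominated_series_cvg _ _ (fun n => M * (F`^_n ^+ 2 + G`^_n ^+ 2))).
  move=> n; rewrite -mulrA normrM; apply: ler_pM => //.
  by rewrite ler_norml; apply/andP; split; nra.
rewrite (_ : series _ = fun N => M * (series (fun n => F`^_n ^+ 2) N + series (fun n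
  => G`^_n ^+ 2) N)).
  apply: is_cvgM; first exact: is_cvg_cst.
  by apply: is_cvgD; [exact: cvgP (parseval_sqr e_basis hF)|exact: cvgP (parseval_sqr e_basis hG)].
by apply/funext => N; rewrite /series /= -big_split/= mulr_sumr.
Qed.

Lemma pairingDl m (M : R) F1 F2 G : (forall n, `|m n| <= M) -> L2 F1 -> L2 F2 -> L2 G ->
  pairing m (fun x => F1 x + F2 x) G = pairing m F1 G + pairing m F2 G.
Proof.
move=> bm h1 h2 hG; apply/cvg_lim => //.
have : series (fun n => m n * F1`^_n * G`^_n) N + series (fun n => m n * F2`^_n * G`^_n) N
    @[N --> \oo] --> pairing m F1 G + pairing m F2 G.
  by apply: cvgD; [exact: cvg_pairing bm _ _|exact: cvg_pairing bm _ _].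
rewrite (_ : (fun N => _ + _) =
  series (fun n => m n * (fun x => F1 x + F2 x)`^_n * G`^_n))//.
apply/funext => N; rewrite /series /= -big_split/=; apply: eq_bigr => n _.
by rewrite ipDl//; ring.
Qed.

Lemma pairingZl m (M c : R) F G : (forall n, `|m n| <= M) -> L2 F -> L2 G ->
  pairing m (fun x => c * F x) G = c * pairing m F G.
Proof.
move=> bm h1 hG; apply/cvg_lim => //.
have : c * series (fun n => m n * F`^_n * G`^_n) N @[N --> \oo] --> c * pairing m F G.
  by apply: cvgM; [exact: cvg_cst|exact: cvg_pairing bm _ _].
rewrite (_ : (fun N => c * _) = series (fun n => m n * (fun x => c * F x)`^_n * G`^_n))//.
apply/funext => N; rewrite /series /= mulr_sumr; apply: eq_bigr => n _.
by rewrite ipZl//; ring.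
Qed.

Lemma pairing_ge0 m F G : pos_multiplier Omega e m -> L2 F -> L2 G ->
  ae_ge0 Omega F -> ae_ge0 Omega G -> 0 <= pairing m F G.
Proof.
move=> pm hF hG F0 G0; have [[M bm] _] := pm.
exact: (pos_multiplier_pairing e_basis pm hF hG F0 G0 (cvg_pairing bm hF hG)).
Qed.

(** Young's inequality with a free weight: [eta] is fixed first to make the [G] term small, then the
    [F] term is made small by convergence. *)
Lemma pairing_bound m (M eta : R) F G : 0 < eta -> (forall n, `|m n| <= M) -> L2 F -> L2 G ->
  pairing m F G <= M * (eta^-1 * ip F F + eta * ip G G).
Proof.
move=> eta0 bm hF hG.
have M0 : 0 <= M by apply: le_trans (bm 0%N).
apply: (ler_cvg_to (cvg_pairing bm hF hG) (cvg_cst _)); apply: nearW => N.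
apply: (@le_trans _ _ (\sum_(0 <= n < N) M * (eta^-1 * F`^_n ^+ 2 + eta * G`^_n ^+ 2))).
  apply: ler_sum => n _; apply: (le_trans (ler_norm _)).
  rewrite -mulrA normrM; apply: ler_pM => //.
  move: (F`^_n) (G`^_n) => a b.
  have -> : a = eta * (a / eta) by field; rewrite gt_eqF.
  move: (a / eta) => t.
  have -> : eta^-1 * (eta * t) ^+ 2 = eta * t ^+ 2 by field; rewrite gt_eqF.
  have h1 := sqr_ge0 (t + b); have h2 := sqr_ge0 (t - b).
  have h3 := sqr_ge0 t; have h4 := sqr_ge0 b.
  by rewrite ler_norml; apply/andP; split; nra.
rewrite -mulr_sumr ler_wpM2l// big_split/= -!mulr_sumr lerD// ler_wpM2l ?invr_ge0 ?(ltW eta0)//.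
  exact: bessel.
exact: bessel.
Qed.

Lemma L2_min F G : L2 F -> L2 G -> L2 (fun x => Num.min (F x) (G x)).
Proof.
move=> hF hG; apply: (@L2_le _ _ _ _ (fun x => `|F x| + `|G x|)).
- rewrite (_ : _ \_ _ = fun x => Num.min ((F \_ Omega) x) ((G \_ Omega) x)).
    by apply: measurable_minr; exact: L2_measurable.
  by apply/funext => x; rewrite !patchE; case: ifP => //; rewrite minxx.
- by apply: L2D; exact: L2_norm.
- move=> x _; rewrite [leRHS]ger0_norm ?addr_ge0//.
  by rewrite /Num.min; case: ifP; rewrite ?lerDl ?lerDr.
Qed.

(** Where [F] is positive the difference vanishes as soon as $j>G/F$, and its square is dominated by
    $G^2$. *)
Lemma min_truncation_cvg F G : L2 F -> L2 G ->
  {ae mu, forall x, Omega x -> 0 < F x} -> (forall x, 0 <= G x) -> (forall x, 0 <= F x) ->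
  ip (fun x => G x - Num.min (G x) (j%:R * F x)) (fun x => G x - Num.min (G x) (j%:R * F x))
    @[j --> \oo] --> (0 : R).
Proof.
move=> hF hG Fpos G0 F0.
pose H (j : nat) x := G x - Num.min (G x) (j%:R * F x).
have HL j : L2 (H j) by apply: L2B => //; apply: L2_min => //; exact: L2Z.
have HG j x : 0 <= H j x <= G x.
  rewrite /H /Num.min; case: ltP => [_|]; first by rewrite subrr G0 lexx.
  by move=> h; rewrite subr_ge0 h gerBl mulr_ge0.
have mH j : measurable_fun setT (fun x => ((H j \_ Omega) x * (H j \_ Omega) x)%:E).
  by have /integrableP[] := ip_integrable (HL j) (HL j).
have HO : {ae mu, forall x, [set: 'rV[R]_d] x ->
    ((H j \_ Omega) x * (H j \_ Omega) x)%:E @[j --> \oo] --> cst 0%E x}.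
  apply: filterS Fpos => x Fx _.
  have [xO|xO] := pselect (Omega x); last first.
    rewrite (_ : (fun j => _) = cst 0%E); first exact: cvg_cst.
    by apply/funext => j; rewrite !patchE memNset// mulr0.
  have {}Fx := Fx xO.
  apply: cvg_near_cst; exists (Num.truncn (G x / F x)).+1 => // j /= jn.
  rewrite !patchE mem_set// (_ : H j x = 0) ?mulr0//.
  rewrite /H /Num.min; case: ltP; rewrite ?subrr// => h.
  have : G x / F x < j%:R by apply: lt_le_trans (truncnS_gt _) _; rewrite ler_nat.
  by rewrite ltr_pdivrMr// ltNge h.
have dom : {ae mu, forall x, forall j, [set: 'rV[R]_d] x ->
    (`|((H j \_ Omega) x * (H j \_ Omega) x)%:E| <= ((G \_ Omega) x * (G \_ Omega) x)%:E)%E}.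
  apply: aeW => x j _; rewrite abse_EFin lee_fin !patchE; case: ifP => _;
    rewrite ?mulr0 ?normr0//.
  have /andP[h0 h1] := HG j x.
  by rewrite ger0_norm ?mulr_ge0//; apply: ler_pM.
have [_ _ C] := dominated_convergence measurableT mH (measurable_cst _) HO (ip_integrable hG hG) dom.
rewrite integral0 in C.
have {}C := fine_cvg C.
rewrite (_ : (fun j => ip _ _) = fine \o (fun j
  => \int[mu]_x ((H j \_ Omega) x * (H j \_ Omega) x)%:E)%E)//.
  exact: C.
by apply/funext => j; rewrite ipE.
Qed.

Lemma pairing_faithful m F g : pos_multiplier Omega e m -> L2 F -> L2 g ->
  {ae mu, forall x, Omega x -> 0 < F x} -> ae_ge0 Omega g ->
  pairing m F g = 0 -> forall n, m n * g`^_n = 0.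
Proof.
move=> pm hF hg Fpos g0 B0 n; have [[M bm] _] := pm.
have M0 : 0 <= M by apply: le_trans (bm 0%N).
(* [F] is positive only almost everywhere, whereas the truncation argument uses pointwise
   nonnegativity. *)
pose F' x := `|F x|.
have hF' : L2 F' by exact: L2_norm.
have FF' : ae_eqO Omega F F'.
  by apply: filterS Fpos => x H Ox; rewrite /F' gtr0_norm// H.
have {}B0 : pairing m F' g = 0.
  rewrite -B0 /pairing; congr (limn (series _)); apply/funext => k.
  by rewrite (ip_ae_eql FF').
have {}Fpos : {ae mu, forall x, Omega x -> 0 < F' x}.
  by apply: filterS Fpos => x H Ox; rewrite /F' normr_gt0 gt_eqF// H.
have F'0 x : 0 <= F' x by exact: normr_ge0.
have zero G : L2 G -> (forall x, 0 <= G x) -> pairing m G g = 0.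
  move=> hG G0.
  pose T j x := Num.min (G x) (j%:R * F' x).
  have hjF j : L2 (fun x => j%:R * F' x) by exact: L2Z.
  have TL j : L2 (T j) by exact: L2_min.
  have HL j : L2 (fun x => G x - T j x) by exact: L2B.
  have T0 j x : 0 <= T j x by rewrite /T le_min G0 mulr_ge0.
  (* [T j] and [j%:R * F' - T j] are both nonnegative, and their nonnegative pairings add up to
     0. *)
  have pT j : pairing m (T j) g = 0.
    have E : (fun x => T j x + (j%:R * F' x - T j x)) = (fun x => j%:R * F' x).
      by apply/funext => x; rewrite addrC subrK.
    have := pairingDl bm (TL j) (L2B (hjF j) (TL j)) hg.
    rewrite E (pairingZl j%:R bm hF' hg) B0 mulr0.
    have h1 : 0 <= pairing m (T j) g by apply: pairing_ge0 => //; apply: aeW.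
    have h2 : 0 <= pairing m (fun x => j%:R * F' x - T j x) g.
      apply: pairing_ge0 => //; first exact: L2B.
      by apply: aeW => x _; rewrite subr_ge0 /T ge_min lexx orbT.
    by lra.
  have pG j : pairing m G g = pairing m (fun x => G x - T j x) g.
    have E : (fun x => T j x + (G x - T j x)) = G.
      by apply/funext => x; rewrite addrC subrK.
    by have := pairingDl bm (TL j) (HL j) hg; rewrite E pT add0r.
  apply/eqP; rewrite eq_le pairing_ge0 ?andbT//; last by apply: aeW => x _; exact: G0.
  apply/ler_addgt0Pr => eps eps0; rewrite add0r.
  (* This weight makes the [g] term of [pairing_bound] at most [eps / 2]; the threshold [k2] does
     the same for the other term. *)
  pose eta := eps / (2 * (M * ip g g + 1)).
  have k1 : 0 < M * ip g g + 1 by rewrite ltr_wpDl// mulr_ge0// ip_sqr_ge0.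
  have eta0 : 0 < eta by rewrite divr_gt0// mulr_gt0.
  have C := min_truncation_cvg hF' hG Fpos G0 F'0.
  have M1 : 0 < M + 1 by rewrite ltr_wpDl.
  have k2 : 0 < eps * eta / (2 * (M + 1)) by apply: divr_gt0; exact: mulr_gt0.
  move/cvgrPdist_lt/(_ _ k2) : C => [j _ /(_ j (leqnn j))].
  rewrite sub0r normrN => /(le_lt_trans (ler_norm _)) Hj.
  rewrite (pG j); apply: (le_trans (pairing_bound eta0 bm (HL j) hg)).
  have a1 : M * (eta^-1 * ip (fun x => G x - T j x) (fun x => G x - T j x)) <= eps / 2.
    apply: (@le_trans _ _ (M * (eta^-1 * (eps * eta / (2 * (M + 1)))))).
      by rewrite ler_wpM2l// ler_wpM2l ?invr_ge0 ?(ltW eta0)// ltW.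
    have -> : M * (eta^-1 * (eps * eta / (2 * (M + 1)))) = eps / 2 * (M / (M + 1)).
      by field; rewrite (gt_eqF eta0) (gt_eqF M1).
    by rewrite ler_piMr ?divr_ge0 ?(ltW eps0)// ler_pdivrMr// mul1r lerDl.
  have a2 : M * (eta * ip g g) <= eps / 2.
    have -> : M * (eta * ip g g) = eps / 2 * (M * ip g g / (M * ip g g + 1)).
      by rewrite /eta; field; rewrite gt_eqF.
    by rewrite ler_piMr ?divr_ge0 ?(ltW eps0)// ler_pdivrMr// mul1r lerDl.
  by rewrite mulrDr; lra.
(* Positive and negative parts give a vanishing pairing with [e n] itself, which by orthonormality
   is the single term [m n] times the coefficient of [g]. *)
pose ep x := Num.max (e n x) 0; pose em x := Num.max (- e n x) 0.
have half w : L2 w -> L2 (fun x => Num.max (w x) 0).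
  move=> hw; rewrite (_ : (fun x => _) = (fun x => 2^-1 * (w x + `|w x|))).
    by apply: L2Z; apply: L2D => //; exact: L2_norm.
  apply/funext => x; rewrite /Num.max; case: ltP => h.
    by rewrite ltr0_norm// subrr mulr0.
  by rewrite ger0_norm//; field.
have epL : L2 ep by exact: half.
have emL : L2 em.
  by apply: half; under [X in L2 X]eq_fun do rewrite -mulN1r; exact: L2Z.
have ep0 x : 0 <= ep x by rewrite le_max lexx orbT.
have em0 x : 0 <= em x by rewrite le_max lexx orbT.
have E : pairing m (e n) g = 0.
  have Ee : (fun x => ep x + (- 1) * em x) = e n.
    apply/funext => x; rewrite /ep /em /Num.max oppr_lt0.
    by case: ltP => h1; case: ltP => h2; lra.
  have := pairingDl bm epL (L2Z (- 1) emL) hg.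
  by rewrite Ee (pairingZl (- 1) bm emL hg) (zero _ epL ep0) (zero _ emL em0) mulr0 addr0.
rewrite -E; apply/esym/cvg_lim => //.
have ee i j : ip (e i) (e j) = (i == j)%:R by case: e_basis.
apply: cvg_near_cst; exists n.+1 => // N /= nN.
rewrite /series /= big_mkord (bigD1 (Ordinal nN))//= ee eqxx mulr1 big1 ?addr0// => i /eqP iN.
rewrite ee; case: eqP => [E'|]; rewrite ?mulr0 ?mul0r//; case: iN; exact/val_inj.
Qed.

Lemma spectral_calculus_pairing (s : R) (mm : R -> R) w v G :
  spectral_calculus Omega lambda e s mm w v -> L2 w -> L2 G ->
  series (fun n => mm (lambda n `^ s) * w`^_n * G`^_n) N @[N --> \oo] --> ip v G.
Proof.
move=> [hv C] hw hG.
have hS N : L2 (fun x => \sum_(0 <= n < N) mm (lambda n `^ s) * w`^_n * e n x).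
  by apply: L2_sum => n; exact: L2Z.
have := cvgQ_ip hS hv hG (cvgL2P hS hv C).
rewrite (_ : (fun n => ip _ G) = series (fun n => mm (lambda n `^ s) * w`^_n * G`^_n))//.
apply/funext => N; rewrite ip_suml//; last by move=> n; exact: L2Z.
by apply: eq_bigr => n _; rewrite ipZl// (ipC _ (e n)).
Qed.

(** The factor $t^\alpha$ is absorbed into the resolvent parameter:
    $c\,(\lambda^st^\alpha)=(ct^\alpha)\lambda^s$. *)
Lemma mittag_leffler_multiplier (alpha g s t : R) : 0 < alpha < 1 -> alpha <= g ->
  0 < s < 1 -> 0 < t ->
  pos_multiplier Omega e (fun n => mittag_leffler alpha g (- lambda n `^ s * t `^ alpha)).
Proof.
move=> a01 ag s01 t0; have HP := pos_multiplier_cone e_basis.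
under [X in pos_multiplier _ _ X]eq_fun do rewrite mulNr.
apply: (mult_cone_mittag_leffler HP a01 ag (x := fun n => lambda n `^ s * t `^ alpha)).
  by move=> n; rewrite mulr_ge0 ?powR_ge0.
move=> c c0; have d0 : 0 < c * t `^ alpha by rewrite mulr_gt0// powR_gt0.
have := mult_cone_fractional HP s01 lambda_gt0
  (fun eps eps0 => pos_multiplier_resolvent oO bO lambda_gt0 eigenpairs e_basis eps0) d0.
congr pos_multiplier; apply/funext => n; congr (_^-1); ring.
Qed.

End faithful.

(** * Positivity of the mild solution *)

Theorem lemma5p1 (R : realType) (d : nat) (d_gt0 : (0 < d)%N)
    (Omega : set 'rV[R]_d)
    (Omega_domain : domain Omega)
    (Omega_bounded : bounded_set Omega)
    (Omega_smooth : smooth_boundary Omega)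
    (lambda : nat -> R) (e : nat -> 'rV[R]_d -> R)
    (lambda_gt0 : forall n, 0 < lambda n)
    (eigenpairs : forall n, dirichlet_eigenpair Omega (lambda n) (e n))
    (e_basis : orthonormal_basis Omega e)
    (alpha s : R) (alpha01 : 0 < alpha < 1) (s01 : 0 < s < 1)
    (c rho : R) (c_gt0 : 0 < c) (rho_bounds : 0 < rho < c)
    (f Lf : R -> R) (f_reaction : reaction_term Omega lambda e s c rho f Lf)
    (u0 : 'rV[R]_d -> R) (u0_datum : initial_datum Omega lambda e s c u0)
    (T : R) (T_gt0 : 0 < T)
    (u : R -> 'rV[R]_d -> R)
    (u_solution : mild_solution Omega lambda e s alpha T c f u0 u) :
  forall t, 0 < t <= T -> {ae leb R d, forall x, Omega x -> 0 < u t x}.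
Proof.
move=> t /andP[t0 tT].
have [oO _ _] := Omega_domain.
have bO := Omega_bounded.
have mO := open_measurable_rV oO.
have fO := leb_bounded_fin mO bO.
have /andP[alpha0 alpha1] := alpha01.
have [[fpos _ _ _ _] _] := f_reaction.
have [_ u0c [u0L _]] := u0_datum.
have [_ _ /(_ t)] := u_solution; rewrite (ltW t0) tT
  => /(_ isT) [v [h [J [Sv hae [JL Jint] uE]]]].
have vL : L2 Omega v := Sv.1.
pose W x := v x + J x.
have WL : L2 Omega W by exact: L2D.
(* The intersection with [Omega] matters: the extension by 0 satisfies the sign condition everywhere
   outside. [W] agrees with [u t] almost everywhere on [Omega]. *)
pose Z := Omega `&` (W \_ Omega) @^-1` `]-oo, 0]%classic.
have mZ : measurable Z.
  apply: measurableI => //; rewrite -[X in measurable X]setTI.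
  by apply: (L2_measurable WL) => //; exact: measurable_itv.
pose g : 'rV[R]_d -> R := \1_Z.
have gL : L2 Omega g by apply: L2_indic => //; exact: subIsetl.
have g0 : ae_ge0 Omega g by apply: aeW.
have gW x : Omega x -> g x * W x <= 0.
  move=> Ox; rewrite /g indicE; case: (boolP (x \in Z)); last by rewrite mul0r.
  by rewrite inE => -[_]; rewrite /= patchE mem_set// in_itv/= mul1r.
have Wg : ip Omega W g <= 0.
  rewrite -oppr_ge0 -mulN1r -ipZl// ipE patchZ; apply: Rintegral_ge0 => x _.
  rewrite !patchE; case: ifPn => [|_]; last by rewrite !mulr0.
  by rewrite inE => /gW H; rewrite mulN1r mulNr oppr_ge0 mulrC.
have vg : 0 <= ip Omega v g.
  have u00 : ae_ge0 Omega u0 by apply: aeW => x /u0c /andP[].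
  have pm := mittag_leffler_multiplier oO bO lambda_gt0 eigenpairs e_basis alpha01 (ltW alpha1) s01 t0.
  exact: (pos_multiplier_pairing e_basis pm u0L gL u00 g0
    (spectral_calculus_pairing e_basis Sv u0L gL)).
have Jg : ip Omega J g <= 0 by move: Wg; rewrite ipDl//; lra.
have [intg Jgint] := Jint g gL.
pose G tau := ip Omega (fun x => (t - tau) `^ (alpha - 1) * h tau x) g.
pose D : set (measurableTypeR R) := `]0, t[%classic.
have mD : measurable D by exact: measurable_itv.
pose good tau := exists F, [/\ L2 Omega F, {ae leb R d, forall x, Omega x -> 0 < F x} &
  P_rel Omega lambda e s alpha (t - tau) F (h tau)].
have FF : Filter (nbhs (almost_everywhere (@lebesgue_measure R))).
  exact: ae_filter_ringOfSetsType.
have hgood : {ae @lebesgue_measure R, forall tau, 0 < tau < t -> good tau}.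
  apply: filterS hae => tau H /H [uc FL PF]; exists (f \o u tau); split => //.
  by apply: filterS uc => x Hx /Hx; exact: fpos.
have hg tau : 0 < tau < t -> good tau -> 0 <= ip Omega (h tau) g.
  move=> /andP[tau0 taut] [F [FL F0 PF]].
  have t'0 : 0 < t - tau by rewrite subr_gt0.
  have pm := mittag_leffler_multiplier oO bO lambda_gt0 eigenpairs e_basis alpha01 (lexx _) s01 t'0.
  have F00 : ae_ge0 Omega F by apply: filterS F0 => x H /H /ltW.
  exact: (pos_multiplier_pairing e_basis pm FL gL F00 g0
    (spectral_calculus_pairing e_basis PF FL gL)).
have GE tau : good tau -> G tau = (t - tau) `^ (alpha - 1) * ip Omega (h tau) g.
  by move=> [F [_ _ [hL _]]]; rewrite /G ipZl.
(* [G] is nonnegative almost everywhere, yet its integral is [ip Omega J g], which [Jg] bounds above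
   by 0. *)
have G0 : {ae @lebesgue_measure R, forall tau, D tau -> G tau = 0}.
  have Gabs : (\int[@lebesgue_measure R]_(tau in D) `|(G tau)%:E| = \int[@lebesgue_measure R]_(tau in D) (G tau)%:E)%E.
    apply: ae_eq_integral => //.
    - by have /integrableP[m _] := intg; apply: measurableT_comp m.
    - by have /integrableP[m _] := intg.
    - apply: filterS hgood => tau H; rewrite /D /= in_itv/= => Dt.
      have gt := H Dt; congr EFin; rewrite ger0_norm// GE// mulr_ge0 ?powR_ge0//.
      exact: hg.
  have Gint0 : (\int[@lebesgue_measure R]_(tau in D) `|(G tau)%:E| = 0)%E.
    apply/eqP; rewrite eq_le integral_ge0 ?andbT// Gabs.
    have fin := integrable_fin_num mD intg.
    by rewrite -(fineK fin) lee_fin; move: Jg; rewrite Jgint.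
  have /integrableP[mG _] := intg.
  have A := (ae_eq_integral_abs _ mD mG).1 Gint0.
  by apply: filterS A => tau H /H [].
have coef0 n : ip Omega g (e n) = 0.
  apply/eqP; apply: contrapT => /negP cn.
  have [eta eta0 Heta] := mittag_leffler_gt0 alpha0 alpha0.
  have ls0 : 0 < lambda n `^ s by rewrite powR_gt0.
  (* Solves $\lambda_n^s\kappa^\alpha=\eta$: for $t-\tau\le\kappa$ the Mittag-Leffler argument stays
     in the range where positivity is known. *)
  pose kappa := (eta / lambda n `^ s) `^ alpha^-1.
  have q0 : 0 < eta / lambda n `^ s by rewrite divr_gt0.
  have kappa0 : 0 < kappa by rewrite powR_gt0.
  pose a := Num.max 0 (t - kappa).
  have a0 : 0 <= a by rewrite le_max lexx.
  have at_ : a < t by rewrite gt_max t0 gtrBl.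
  (* The interval from [a] to [t] has positive length, so it cannot lie in the exceptional null
     set. *)
  have [tau [/andP[atau taut] gt Gt]] : exists tau, [/\ a < tau < t, good tau & G tau = 0].
    apply: contrapT => nex.
    have N : (@lebesgue_measure R).-negligible (`]a, t[%classic : set R).
      have H : (@lebesgue_measure R).-negligible
          (~` [set tau | (0 < tau < t -> good tau) /\ (D tau -> G tau = 0)]).
        exact: filterI hgood G0.
      apply: negligibleS H => tau /=; rewrite in_itv/= => /andP[atau taut] [H1 H2];
        apply: nex; exists tau.
      have tau0 : 0 < tau by exact: le_lt_trans atau.
      split; first by rewrite atau.
        by apply: H1; rewrite tau0.
      by apply: H2; rewrite /D /= in_itv/= tau0.
    have N0 : lebesgue_measure (`]a, t[%classic : set (measurableTypeR R)) = 0%E.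
      by apply/negligibleP => //; exact: measurable_itv.
    move: N0; rewrite lebesgue_measure_itv/= lte_fin at_ -EFinD => -[] /eqP.
    by rewrite subr_eq0 gt_eqF.
  have tau0 : 0 < tau by exact: le_lt_trans atau.
  have t'0 : 0 < t - tau by rewrite subr_gt0.
  have pm := mittag_leffler_multiplier oO bO lambda_gt0 eigenpairs e_basis alpha01 (lexx _) s01 t'0.
  have hg0 : ip Omega (h tau) g = 0.
    have := GE tau gt; rewrite Gt => /esym/eqP; rewrite mulf_eq0 => /orP[|/eqP//].
    by rewrite gt_eqF// powR_gt0.
  have [F [FL F0 PF]] := gt.
  have B0 : pairing Omega e (fun n
    => mittag_leffler alpha alpha (- lambda n `^ s * (t - tau) `^ alpha)) F g = 0.
    rewrite -hg0; apply/cvg_lim => //.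
    by have := spectral_calculus_pairing e_basis PF FL gL.
  have /eqP := pairing_faithful e_basis pm FL gL F0 g0 B0 n.
  rewrite mulf_eq0 (negbTE cn) orbF gt_eqF// mulNr; apply: Heta.
  rewrite mulr_ge0 ?powR_ge0//= mulrC -ler_pdivlMr//.
  rewrite -[leRHS](powRr1 (ltW q0)) -(mulVf (lt0r_neq0 alpha0)) powRrM.
  apply: ge0_ler_powR; rewrite ?nnegrE ?(ltW alpha0) ?(ltW t'0) ?powR_ge0//.
  have : t - kappa <= a by rewrite le_max lexx orbT.
  by rewrite -/kappa; lra.
(* By Parseval the indicator of [Z] has norm 0, so [Z] is negligible. *)
have gg0 : ip Omega g g = 0.
  have C := parseval_sqr e_basis gL.
  rewrite -(cvg_lim _ C)//; apply/cvg_lim => //.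
  rewrite (_ : series _ = cst 0); first exact: cvg_cst.
  by apply/funext => N; rewrite /series /= big1// => n _; rewrite coef0 expr0n.
have gz := ip_sqr_eq0 gL gg0.
apply: filterS2 uE gz => x uW gx Ox; rewrite (uW Ox) -/(W x) ltNge; apply/negP => W0.
have /eqP := gx Ox; rewrite /g indicE mem_set ?oner_eq0//.
by split => //; rewrite /= patchE mem_set// in_itv.
Qed.
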